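(* Let $\psi$ be an admissible vector of the form $\mathcal F\psi(\xi_1,\xi_2)=\mathcal F\psi_1(\xi_1)\,\mathcal F\psi_2(\xi_2/\xi_1)$ for $\xi_1\neq 0$, with $\psi_1,\psi_2\in L^2(\mathbb R)$, such that the function $\chi_1$ defined by $\mathcal F\chi_1(\tau)=|\tau|\,\mathcal F\psi_1(\tau)$ belongs to $\mathcal S_0(\mathbb R)$ and $\phi_2=\mathcal F\psi_2$ belongs to $\mathcal S(\mathbb R)$. Let $f\in\mathcal S_0'(\mathbb R^2)$ and let $\mathcal S_\psi f\in\mathcal S'(\mathbb S)$ be its shearlet transform, defined by $(\mathcal S_\psi f,\Phi)=(f,\mathcal S^t_{\overline\psi}\Phi)$ for $\Phi\in\mathcal S(\mathbb S)$. Then $\mathcal S_\psi f$ is given by the function $$(b,s,a)\mapsto (f,\overline{S_{b,s,a}\psi}),\qquad (b,s,a)\in\mathbb S,$$ that is, $$(\mathcal S_\psi f,\Phi)=\int_{\mathbb S}(f,\overline{S_{b,s,a}\psi})\,\Phi(b,s,a)\,d\mu(b,s,a)\qquad\text{for all }\Phi\in\mathcal S(\mathbb S).$$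
   Context: Fourier transform: $\mathcal F f(\xi)=\int_{\mathbb R^d} f(x)e^{-2\pi i\xi\cdot x}\,dx$, extended to $L^2(\mathbb R^d)$. $\mathbb R^\times=\mathbb R\setminus\{0\}$, $\langle x\rangle=(1+|x|^2)^{1/2}$, $\mathbb N=\{0,1,2,\dots\}$. Lizorkin space: $\mathcal S_0(\mathbb R^d)=\{\varphi\in\mathcal S(\mathbb R^d):\int_{\mathbb R^d}x^m\varphi(x)\,dx=0\ \ \forall m\in\mathbb N^d\}$, with the topology inherited from the Schwartz space $\mathcal S(\mathbb R^d)$. The space $\mathcal S(\mathbb S)$: $\mathbb S=\mathbb R^2\times\mathbb R\times\mathbb R^\times$, and $\mathcal S(\mathbb S)$ is the space of $\Phi\in C^\infty(\mathbb S)$ for which all seminorms $$\sup_{((b_1,b_2),s,a)\in\mathbb S}\langle b_1\rangle^{k_1}\langle b_2\rangle^{k_2}\langle s\rangle^{l}\Big(|a|^m+\frac1{|a|^m}\Big)\big|\partial_a^\gamma\partial_s^\beta\partial_{b_2}^{\alpha_2}\partial_{b_1}^{\alpha_1}\Phi((b_1,b_2),s,a)\big|,$$ $k_1,k_2,l,m,\alpha_1,\alpha_2,\beta,\gamma\in\mathbb N$, are finite; its topology is defined by these seminorms. The measure on $\mathbb S$ is $d\mu(b,s,a)=|a|^{-3}\,db\,ds\,da$. $\mathcal S_0'(\mathbb R^2)$ (Lizorkin distributions) and $\mathcal S'(\mathbb S)$ are the topological duals of $\mathcal S_0(\mathbb R^2)$ and $\mathcal S(\mathbb S)$; $(\cdot,\cdot)$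 denotes the bilinear dual pairing. For $(b,s,a)\in\mathbb S$ put $S_s=\begin{pmatrix}1&-s\\0&1\end{pmatrix}$, $A_a=a\begin{pmatrix}1&0\\0&|a|^{-1/2}\end{pmatrix}$, and $S_{b,s,a}\psi(x)=|a|^{-3/4}\psi(A_a^{-1}S_s^{-1}(x-b))$. A vector $\psi\in L^2(\mathbb R^2)$ is admissible if $0<\int_{\mathbb R^2}\frac{|\mathcal F\psi(\xi)|^2}{|\xi_1|^2}\,d\xi<+\infty$. For $\psi$ of the form in the claim, $\mathcal F\psi$ extends to a Schwartz function on $\mathbb R^2$ all of whose derivatives vanish at $0$, and $\psi$ denotes the corresponding function in $\mathcal S_0(\mathbb R^2)$. Shearlet synthesis operator with respect to $\overline\psi$: for $\Phi\in\mathcal S(\mathbb S)$, $$\mathcal S_{\overline\psi}^t\Phi(x)=\int_{\mathbb R^\times}\int_{\mathbb R}\int_{\mathbb R^2}\Phi(b,s,a)\,\overline{S_{b,s,a}\psi(x)}\,\frac{db\,ds\,da}{|a|^3},\qquad x\in\mathbb R^2,$$ which belongs to $\mathcal S_0(\mathbb R^2)$. *)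

(* Defs.v *)
(* MathComp-Analysis, over an arbitrary [R : realType]; complex numbers are
   [R[i]] from mathcomp-real-closed. *)
From HB Require Import structures.
From mathcomp Require Import all_boot all_order all_algebra.
From mathcomp Require Import all_classical all_reals all_analysis.
From mathcomp Require Import complex.
Set Implicit Arguments.
Unset Strict Implicit.
Unset Printing Implicit Defensive.
Import Order.TTheory GRing.Theory Num.Theory.
Import numFieldNormedType.Exports.
Local Open Scope classical_set_scope.
Local Open Scope ring_scope.

Notation cRe := complex.Re.
Notation cIm := complex.Im.

(* [normc] below is the real-valued modulus of a complex number. *)
Notation normc := ComplexField.Normc.normc.

Section Integration.
Context {R : realType}.

Definition leb1 : {measure set (measurableTypeR R) -> \bar R} :=
  @lebesgue_measure R.
Definition leb2 : {measure set (measurableTypeR R * measurableTypeR R) -> \bar R} :=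
  (@lebesgue_measure R \x @lebesgue_measure R)%E.
(* Lebesgue measure on R^2 x R x R, with points ((b, s), a) *)
Definition leb4 : {measure set (measurableTypeR R * measurableTypeR R *
    measurableTypeR R * measurableTypeR R) -> \bar R} :=
  ((@lebesgue_measure R \x @lebesgue_measure R) \x @lebesgue_measure R
     \x @lebesgue_measure R)%E.

Section Complex.
Context {d : measure_display} {T : measurableType d}.
Variable mu : {measure set T -> \bar R}.

Definition Cintegrable (D : set T) (f : T -> R[i]) : Prop :=
  mu.-integrable D (fun x => (cRe (f x))%:E) /\
  mu.-integrable D (fun x => (cIm (f x))%:E).

Definition Cintegral (D : set T) (f : T -> R[i]) : R[i] :=
  Complex (Rintegral mu D (fun x => cRe (f x)))
          (Rintegral mu D (fun x => cIm (f x))).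

Definition sq_integral (f : T -> R[i]) : \bar R :=
  (\int[mu]_x ((normc (f x)) ^+ 2)%:E)%E.

Definition memL2 (f : T -> R[i]) : Prop :=
  [/\ measurable_fun setT (fun x => cRe (f x)),
      measurable_fun setT (fun x => cIm (f x)) &
      (sq_integral f < +oo)%E].

(* [g] represents the L^2 Fourier transform of [f]: the extension to L^2, by
   density of L^1 /\ L^2 and L^2-continuity, of the integral transform [F]. *)
Definition L2_fourier (F : (T -> R[i]) -> T -> R[i]) (f g : T -> R[i]) : Prop :=
  [/\ memL2 f, memL2 g &
      exists u : nat -> T -> R[i],
        [/\ forall n, Cintegrable setT (u n) /\ memL2 (u n),
            (fun n => sq_integral (fun x => u n x - f x)) @ \oo --> 0%E &
            (fun n => sq_integral (fun x => F (u n) x - g x)) @ \oo --> 0%E]].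
End Complex.

Definition cis (t : R) : R[i] := Complex (cos t) (sin t).

Definition fourier1 (f : R -> R[i]) (xi : R) : R[i] :=
  Cintegral leb1 setT (fun x : R => f x * cis (- (2 * pi * (xi * x)))).

Definition fourier2 (f : R * R -> R[i]) (xi : R * R) : R[i] :=
  Cintegral leb2 setT (fun x : R * R =>
    f x * cis (- (2 * pi * (xi.1 * x.1 + xi.2 * x.2)))).

Definition admissible (psi : R * R -> R[i]) : Prop :=
  memL2 leb2 psi /\
  exists hpsi, L2_fourier leb2 fourier2 psi hpsi /\
    (0 < \int[leb2]_xi (normc (hpsi xi) ^+ 2 / `|xi.1| ^+ 2)%:E < +oo)%E.

End Integration.

Section Smooth.
Context {R : realType} {V : normedModType R}.

Definition derivC (v : V) (f : V -> R[i]) : V -> R[i] := fun x =>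
  Complex ('D_v (fun y => cRe (f y) : R^o) x) ('D_v (fun y => cIm (f y) : R^o) x).

(* The last direction in the list is differentiated first. *)
Definition derivsC (vs : seq V) (f : V -> R[i]) : V -> R[i] := foldr derivC f vs.

(* C^infinity on the open set [U]: every iterated partial derivative along the
   basis directions [es] exists and is continuous at every point of [U]. *)
Definition smooth_on (es : seq V) (U : set V) (f : V -> R[i]) : Prop :=
  forall vs : seq V, {subset vs <= es} -> forall x, U x ->
    let g := derivsC vs f in
    [/\ forall v, v \in es -> derivable (fun y => cRe (g y) : R^o) x v,
        forall v, v \in es -> derivable (fun y => cIm (g y) : R^o) x v,
        {for x, continuous (fun y => cRe (g y) : R^o)} &
        {for x, continuous (fun y => cIm (g y) : R^o)}].
End Smooth.

Section Spaces.
Context {R : realType}.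

Definition jap (x : R) : R := Num.sqrt (1 + x ^+ 2).
Definition jap2 (x : R * R) : R := Num.sqrt (1 + (x.1 ^+ 2 + x.2 ^+ 2)).

Definition e1 : R * R := (1, 0).
Definition e2 : R * R := (0, 1).

Definition seminorm1 (k m : nat) (f : R -> R[i]) : \bar R :=
  ereal_sup [set (jap x ^+ k * normc (derivsC (nseq m (1 : R^o)) f x))%:E
            | x in [set: R]].
Definition seminorm2 (k m1 m2 : nat) (f : R * R -> R[i]) : \bar R :=
  ereal_sup [set (jap2 x ^+ k * normc (derivsC (nseq m2 e2 ++ nseq m1 e1) f x))%:E
            | x in [set: R * R]].

Definition schwartz1 (f : R -> R[i]) : Prop :=
  smooth_on [:: (1 : R^o)] setT f /\
  forall k m, (seminorm1 k m f < +oo)%E.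
Definition schwartz2 (f : R * R -> R[i]) : Prop :=
  smooth_on [:: e1; e2] setT f /\
  forall k m1 m2, (seminorm2 k m1 m2 f < +oo)%E.

Definition lizorkin1 (f : R -> R[i]) : Prop :=
  schwartz1 f /\
  forall m : nat, Cintegral leb1 setT (fun x : R => (x ^+ m)%:C%C * f x) = 0.
Definition lizorkin2 (f : R * R -> R[i]) : Prop :=
  schwartz2 f /\
  forall m1 m2 : nat, Cintegral leb2 setT
    (fun x : R * R => (x.1 ^+ m1 * x.2 ^+ m2)%:C%C * f x) = 0.

(* Functionals on a function space are total; only their values on the space
   are constrained. Continuity is with respect to the topology generated by the
   Schwartz seminorms. *)
Definition lizorkin_dual (f : (R * R -> R[i]) -> R[i]) : Prop :=
  (forall (c : R[i]) phi1 phi2, lizorkin2 phi1 -> lizorkin2 phi2 ->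
     f (fun x => c * phi1 x + phi2 x) = c * f phi1 + f phi2) /\
  (forall phi0, lizorkin2 phi0 -> forall eps : R, 0 < eps ->
     exists (N : nat) (del : R), 0 < del /\
       forall phi, lizorkin2 phi ->
         (forall k m1 m2 : nat, (k <= N)%N -> (m1 <= N)%N -> (m2 <= N)%N ->
            (seminorm2 k m1 m2 (fun x => (phi x - phi0 x)%R) < del%:E)%E) ->
         normc (f phi - f phi0) < eps).

(* A point of S is ((b, s), a) with a != 0; functions on S are total on
   R^2 x R x R, and their values at a = 0 are irrelevant. *)
Definition shearS : set (R * R * R * R) := [set p | p.2 != 0].

Definition eb1 : R * R * R * R := (1, 0, 0, 0).
Definition eb2 : R * R * R * R := (0, 1, 0, 0).
Definition es : R * R * R * R := (0, 0, 1, 0).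
Definition ea : R * R * R * R := (0, 0, 0, 1).

Definition seminormS (k1 k2 l m alpha1 alpha2 beta gamma : nat)
    (Phi : R * R * R * R -> R[i]) : \bar R :=
  ereal_sup [set (let: (b1, b2, s, a) := p in
     jap b1 ^+ k1 * jap b2 ^+ k2 * jap s ^+ l * (`|a| ^+ m + 1 / `|a| ^+ m) *
     normc (derivsC (nseq gamma ea ++ nseq beta es ++
                     nseq alpha2 eb2 ++ nseq alpha1 eb1) Phi p))%:E
   | p in shearS].

Definition schwartzS (Phi : R * R * R * R -> R[i]) : Prop :=
  smooth_on [:: eb1; eb2; es; ea] shearS Phi /\
  forall k1 k2 l m alpha1 alpha2 beta gamma,
    (seminormS k1 k2 l m alpha1 alpha2 beta gamma Phi < +oo)%E.

(* The functional [T] on S(S) is the regular distribution given by [F] with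
   respect to |a|^-3 db ds da; integrability is part of the claim. *)
Definition given_by (T : (R * R * R * R -> R[i]) -> R[i])
    (F : R * R * R * R -> R[i]) : Prop :=
  forall Phi, schwartzS Phi ->
    let G := fun p : R * R * R * R => F p * Phi p * (`|p.2| ^- 3)%:C%C in
    Cintegrable leb4 shearS G /\ T Phi = Cintegral leb4 shearS G.

End Spaces.

Section Shearlets.
Context {R : realType}.

Definition mx2 (a b c d : R) : 'M[R]_2 :=
  \matrix_(i, j) if i == 0 then (if j == 0 then a else b)
                 else (if j == 0 then c else d).
Definition mxact (A : 'M[R]_2) (x : R * R) : R * R :=
  let y := A *m \col_i (if i == 0 then x.1 else x.2) in (y 0 0, y 1 0).

Definition shear_mx (s : R) : 'M[R]_2 := mx2 1 (- s) 0 1.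
Definition dil_mx (a : R) : 'M[R]_2 := a *: mx2 1 0 0 (`|a| `^ (- 2^-1)).

Definition shearlet (psi : R * R -> R[i]) (p : R * R * R * R) (x : R * R) : R[i] :=
  let: (b, s, a) := p in
  (`|a| `^ (- (3 / 4)))%:C%C *
  psi (mxact (invmx (dil_mx a)) (mxact (invmx (shear_mx s)) (x - b))).

Definition conj_shearlet (psi : R * R -> R[i]) (p : R * R * R * R) (x : R * R) : R[i] :=
  conjc (shearlet psi p x).

(* the synthesis operator with respect to the complex conjugate of [psi] *)
Definition synthesis_conj (psi : R * R -> R[i]) (Phi : R * R * R * R -> R[i])
    (x : R * R) : R[i] :=
  Cintegral leb1 [set a : R | a != 0] (fun a : R =>
    Cintegral leb1 setT (fun s : R =>
      Cintegral leb2 setT (fun b : R * R =>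
        Phi (b, s, a) * conj_shearlet psi (b, s, a) x * (`|a| ^- 3)%:C%C))).

Definition shearlet_transform (psi : R * R -> R[i]) (f : (R * R -> R[i]) -> R[i]) :
    (R * R * R * R -> R[i]) -> R[i] :=
  fun Phi => f (synthesis_conj psi Phi).

End Shearlets.

(* Main.v *)
(* Write K_p for the conjugate shearlet at p = (b, s, a) and w(p) = |a|^-3 Phi(p),
   so that the synthesis operator is T = int w(p) K_p dp and the claim is
   f(T) = int w(p) f(K_p) dp. The map p |-> K_p is continuous into S_0(R^2), with
   seminorms of polynomial growth in b, s, a and 1/a, while w decays rapidly, so
   this is the exchange of a continuous functional with a vector-valued integral.
   Continuity bounds |f(phi)| by finitely many Schwartz seminorms, i.e. by the
   evaluations phi |-> <x>^k D^m phi(x) with k and m bounded. Together with f these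
   yield an equicontinuous family of functions of p, and one finite sum
   sum_j c_j K_(q_j) approximates int w(p) l(K_p) dp by sum_j c_j l(K_(q_j)),
   uniformly over all l in the family. By differentiation under the integral sign
   the sum is then close to T in the seminorms, hence f(T) is close to
   sum_j c_j f(K_(q_j)), which is close to int w(p) f(K_p) dp. *)

(* The obstacle is that [f] is known only through linearity and continuity on the Lizorkin space. It
   can be applied only to finite combinations and to functions already shown to lie there, so every
   limit is taken in scalar integrals, and [T] itself must first be shown to be Schwartz with
   vanishing moments. Two closure properties carry this. Derivatives in [x] of a conjugate shearlet
   stay in one class of kernels, whose coefficients grow at most like a power of the single weight
   [om]; since [Phi] beats every power of [om], one estimate yields integrability, decay and
   differentiation under the integral for all orders at once. Vanishing moments survive the affine
   substitution defining a shearlet, because monomials become products of powers of affine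
   functions. The quadrature needs no regular grid: its cells are cut out of a countable base of the
   topology and made disjoint, and they have to be small only in the sense that every member of the
   family oscillates little on them. *)
Require Import Defs.
From HB Require Import structures.
From mathcomp Require Import all_boot all_order all_algebra.
From mathcomp Require Import all_classical all_reals all_analysis.
From mathcomp Require Import measurable_realfun complex ring lra.
Set Implicit Arguments.
Unset Strict Implicit.
Unset Printing Implicit Defensive.
Import Order.TTheory GRing.Theory Num.Theory.
Import numFieldNormedType.Exports.
Local Open Scope classical_set_scope.
Local Open Scope ring_scope.

(** * Complex-valued functions *)

Section ComplexModulus.
Context {R : realType}.
Implicit Types z w : R[i].

Lemma normc_triangle z w : normc (z + w) <= normc z + normc w.
Proof. exact: le_normcD. Qed.

Lemma normc_prod z w : normc (z * w) = normc z * normc w.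
Proof. exact: ComplexField.Normc.normcM. Qed.

Lemma normc_opp z : normc (- z) = normc z.
Proof. exact: normcN. Qed.

Lemma normc_zero : normc (0 : R[i]) = 0.
Proof. exact: ComplexField.Normc.normc0. Qed.

Lemma normc_ge0 z : 0 <= normc z.
Proof. by case: z => a b /=; rewrite sqrtr_ge0. Qed.

Lemma normc_distC z w : normc (z - w) = normc (w - z).
Proof. by rewrite -normc_opp opprB. Qed.

Lemma normc_conj z : normc (conjc z) = normc z.
Proof. by case: z => a b /=; rewrite sqrrN. Qed.

Lemma normc_real (r : R) : normc (r%:C)%C = `|r|.
Proof. by rewrite /= expr0n addr0 sqrtr_sqr. Qed.

Lemma cRe_le z : `|cRe z| <= normc z.
Proof.
by case: z => a b /=; rewrite -sqrtr_sqr ler_wsqrtr// lerDl sqr_ge0.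
Qed.

Lemma cIm_le z : `|cIm z| <= normc z.
Proof.
by case: z => a b /=; rewrite -sqrtr_sqr ler_wsqrtr// lerDr sqr_ge0.
Qed.

Lemma normc_le_ReIm z : normc z <= `|cRe z| + `|cIm z|.
Proof.
case: z => a b /=; rewrite -[leRHS]ger0_norm ?addr_ge0// -sqrtr_sqr ler_wsqrtr//.
rewrite -(real_normK (num_real a)) -(real_normK (num_real b)).
by have := normr_ge0 a; have := normr_ge0 b; nra.
Qed.

Lemma cReD z w : cRe (z + w) = cRe z + cRe w. Proof. by case: z; case: w. Qed.
Lemma cImD z w : cIm (z + w) = cIm z + cIm w. Proof. by case: z; case: w. Qed.
Lemma cReM z w : cRe (z * w) = cRe z * cRe w - cIm z * cIm w.
Proof. by case: z; case: w. Qed.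
Lemma cImM z w : cIm (z * w) = cRe z * cIm w + cIm z * cRe w.
Proof. by case: z => a b; case: w => c d. Qed.
Lemma cRe_conj z : cRe (conjc z) = cRe z. Proof. by case: z. Qed.
Lemma cIm_conj z : cIm (conjc z) = - cIm z. Proof. by case: z. Qed.

Lemma eq_ReIm z w : cRe z = cRe w -> cIm z = cIm w -> z = w.
Proof. by case: z; case: w => ? ? ? ? /= -> ->. Qed.

End ComplexModulus.

Section ComplexContinuity.
Context {R : realType} {V : topologicalType}.
Implicit Types (f g : V -> R[i]) (x : V).

(** Stated through real and imaginary parts, as in [smooth_on], so no topology on [R[i]] is
    involved. *)
Definition ccont f x :=
  (cRe (f y) @[y --> x] --> cRe (f x)) /\ (cIm (f y) @[y --> x] --> cIm (f x)).

Lemma ccont_cst c x : ccont (fun=> c) x.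
Proof. by split; apply: cvg_cst. Qed.

Lemma ccontD f g x : ccont f x -> ccont g x -> ccont (fun y => f y + g y) x.
Proof.
move=> [f1 f2] [g1 g2]; split.
- by under eq_fun do rewrite cReD; rewrite cReD; apply: cvgD.
- by under eq_fun do rewrite cImD; rewrite cImD; apply: cvgD.
Qed.

Lemma ccontM f g x : ccont f x -> ccont g x -> ccont (fun y => f y * g y) x.
Proof.
move=> [f1 f2] [g1 g2]; split.
- under eq_fun do rewrite cReM; rewrite cReM.
  by apply: cvgB; apply: cvgM.
- under eq_fun do rewrite cImM; rewrite cImM.
  by apply: cvgD; apply: cvgM.
Qed.

Lemma ccont_conj f x : ccont f x -> ccont (fun y => conjc (f y)) x.
Proof.
move=> [f1 f2]; split; first by under eq_fun do rewrite cRe_conj; rewrite cRe_conj.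
by under eq_fun do rewrite cIm_conj; rewrite cIm_conj; apply: cvgN.
Qed.

Lemma ccont_real (r : V -> R) x :
  r y @[y --> x] --> r x -> ccont (fun y => (r y)%:C%C) x.
Proof. by move=> rx; split => //=; apply: cvg_cst. Qed.

Lemma ccont_normc f x : ccont f x -> normc (f y) @[y --> x] --> normc (f x).
Proof.
move=> [f1 f2].
have E z : normc z = Num.sqrt (cRe z * cRe z + cIm z * cIm z) by case: z.
under eq_fun do rewrite E; rewrite E.
have H : (cRe (f y) * cRe (f y) + cIm (f y) * cIm (f y)) @[y --> x] -->
  cRe (f x) * cRe (f x) + cIm (f x) * cIm (f x) by apply: cvgD; apply: cvgM.
by apply: (cvg_comp _ _ H); exact: sqrt_continuous.
Qed.

Lemma eq_near_ccont f g x : (\forall y \near x, f y = g y) ->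
  ccont f x -> ccont g x.
Proof.
move=> fg [f1 f2]; have fgx := nbhs_singleton fg; rewrite /ccont -fgx; split.
- move: f1; apply: cvg_trans.
  by apply: near_eq_cvg; near=> y; rewrite (near fg y).
- move: f2; apply: cvg_trans.
  by apply: near_eq_cvg; near=> y; rewrite (near fg y).
Unshelve. all: by end_near. Qed.

End ComplexContinuity.

Lemma ccont_comp {R : realType} {U V : topologicalType} (f : V -> R[i])
  (h : U -> V) (x : U) : h y @[y --> x] --> h x -> ccont f (h x) ->
  ccont (fun y => f (h y)) x.
Proof.
move=> hx [f1 f2].
by split; [apply: (cvg_comp _ _ hx f1)|apply: (cvg_comp _ _ hx f2)].
Qed.

Section ComplexDerivative.
Context {R : realType} {V : normedModType R}.
Implicit Types (f g : V -> R[i]) (x v : V) (c d : R[i]).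

(** Existence and value in one relation: [derivC] is total, so an equation about it alone would not
    give differentiability. *)
Definition is_cderive x v f d :=
  is_derive x v (fun y => cRe (f y) : R^o) (cRe d) /\
  is_derive x v (fun y => cIm (f y) : R^o) (cIm d).

Lemma is_cderive_derivC x v f d : is_cderive x v f d -> Defs.derivC v f x = d.
Proof.
by move=> [[df1 e1] [df2 e2]]; apply: eq_ReIm; rewrite /Defs.derivC/=.
Qed.

Lemma derivable_is_cderive x v f :
  derivable (fun y => cRe (f y) : R^o) x v ->
  derivable (fun y => cIm (f y) : R^o) x v ->
  is_cderive x v f (Defs.derivC v f x).
Proof. by move=> f1 f2; split; exact: DeriveDef. Qed.

Lemma is_cderiveD x v f g c d : is_cderive x v f c -> is_cderive x v g d ->
  is_cderive x v (fun y => f y + g y) (c + d).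
Proof.
move=> [f1 f2] [g1 g2]; split.
- under eq_fun do rewrite cReD.
  by rewrite cReD; exact: (is_deriveD f1 g1).
- under eq_fun do rewrite cImD.
  by rewrite cImD; exact: (is_deriveD f2 g2).
Qed.

Lemma is_cderiveZ x v f c d : is_cderive x v f d ->
  is_cderive x v (fun y => c * f y) (c * d).
Proof.
move=> [f1 f2]; split.
- under eq_fun do rewrite cReM.
  rewrite cReM.
  exact: (is_deriveB (is_deriveZ (cRe c) f1) (is_deriveZ (cIm c) f2)).
- under eq_fun do rewrite cImM.
  rewrite cImM.
  exact: (is_deriveD (is_deriveZ (cRe c) f2) (is_deriveZ (cIm c) f1)).
Qed.

Lemma is_cderive_conj x v f d : is_cderive x v f d ->
  is_cderive x v (fun y => conjc (f y)) (conjc d).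
Proof.
move=> [f1 f2]; split; first by under eq_fun do rewrite cRe_conj; rewrite cRe_conj.
under eq_fun do rewrite cIm_conj.
by rewrite cIm_conj; exact: (is_deriveN f2).
Qed.

Lemma is_cderive_cst x v c : is_cderive x v (fun=> c) 0.
Proof. by split; exact: is_derive_cst. Qed.

End ComplexDerivative.

(** * Differential calculus on the plane *)

Section LineDerivatives.
Context {R : realType} {V : normedModType R}.
Implicit Types (g : V -> R^o) (x v : V).

Lemma is_derive_line g x v (t : R) : derivable g (t *: v + x) v ->
  is_derive t 1 (fun s : R => g (s *: v + x)) ('D_v g (t *: v + x)).
Proof.
have E : (fun h : R => h^-1 *:
      (((fun s : R => g (s *: v + x)) \o shift t) (h *: 1) - g (t *: v + x))) =
    (fun h => h^-1 *: ((g \o shift (t *: v + x)) (h *: v) - g (t *: v + x))).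
  apply/funext => h; congr (_ *: (_ - _)) => /=; congr g.
  by rewrite scalerDl addrA -[h *: 1]/(h * 1) mulr1.
by move=> dg; split; rewrite ?/derivable ?/derive E.
Qed.

(** The sign of [h] is free, and of the intermediate point only [|c| <= |h|] is kept: this is what
    places it in the small squares of [near_plane]. *)
Lemma mvt_line g x v (h : R) : (forall y, derivable g y v) ->
  exists2 c : R, `|c| <= `|h| &
    g (h *: v + x) - g x = h * 'D_v g (c *: v + x).
Proof.
move=> dg; pose p (s : R) : R := g (s *: v + x).
have dp (t : R) : is_derive t 1 p ('D_v g (t *: v + x)) by exact: is_derive_line.
have cp (i : interval R) : {within [set` i], continuous p}.
  by apply: derivable_within_continuous => t _; case: (dp t).
have p0 : p 0 = g x by rewrite /p scale0r add0r.
have [h0|h0] := leP 0 h.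
- have [c] := MVT_segment h0 (fun t _ => dp t) (cp _).
  rewrite in_itv/= => /andP[c0 ch]; rewrite p0 subr0 => ->.
  by exists c; rewrite ?ger0_norm// mulrC.
- have [c] := MVT_segment (ltW h0) (fun t _ => dp t) (cp _).
  rewrite in_itv/= => /andP[ch c0]; rewrite p0 sub0r => E.
  exists c; first by rewrite !ler0_norm// ?lerN2// ltW.
  by rewrite -[LHS]opprB E mulrN opprK mulrC.
Qed.

End LineDerivatives.

Lemma dist_half {R : realType} (e t u v : R) :
  `|u - t| <= e / 2 -> `|v - t| <= e / 2 -> `|u - v| <= e.
Proof.
move=> H1 H2; rewrite (le_trans (ler_distD t _ _))// [e]splitr lerD//.
by rewrite distrC.
Qed.

Section Plane.
Context {R : realType}.
Implicit Types (g : R * R -> R^o) (x : R * R).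
Local Notation E1 := (Defs.e1 : R * R).
Local Notation E2 := (Defs.e2 : R * R).

Lemma plane_shift (c1 c2 : R) x : c1 *: E1 + (c2 *: E2 + x) = (c1 + x.1, c2 + x.2).
Proof.
case: x => x1 x2; rewrite /Defs.e1 /Defs.e2 -[c1 *: (1, 0)]/(c1 * 1, c1 * 0).
rewrite -[c2 *: (0, 1)]/(c2 * 0, c2 * 1) !mulr1 !mulr0.
by congr pair; rewrite /= ?add0r.
Qed.

Lemma near_plane (P : R * R -> Prop) x : (\forall y \near x, P y) ->
  exists2 d : R, 0 < d & forall c1 c2 : R, `|c1| < d -> `|c2| < d ->
    P (c1 *: E1 + (c2 *: E2 + x)).
Proof.
case: x => x1 x2 /nbhs_ballP[d d0 dP]; exists d => // c1 c2 h1 h2; apply: dP.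
rewrite plane_shift; split => /=; rewrite /ball/= opprD addrCA subrr addr0.
  by rewrite normrN.
by rewrite normrN.
Qed.

(** The increment along [w] is split into a step along [E2] followed by one along [E1], each treated
    by the mean value theorem. General directions are needed because moving [x] along [E2] moves its
    shear point in both coordinates. *)
Lemma derive_plane g x (w : R * R) :
  (forall y, derivable g y E1) -> (forall y, derivable g y E2) ->
  {for x, continuous ('D_E1 g : R * R -> R^o)} ->
  {for x, continuous ('D_E2 g : R * R -> R^o)} ->
  is_derive x w g (w.1 * 'D_E1 g x + w.2 * 'D_E2 g x).
Proof.
move=> d1 d2 c1 c2.
suff H : h^-1 *: ((g \o shift x) (h *: w) - g x) @[h --> 0^'] -->
    (w.1 * 'D_E1 g x + w.2 * 'D_E2 g x : R^o).
  by split; [apply/cvg_ex; eexists; exact: H|exact: cvg_lim].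
apply/cvgrPdist_le => /= e e0.
(* The two errors, weighted by the components of [w], must add up to at most [e], and both
   increments must stay below [d]; the summand 1 covers [w = 0]. *)
pose M : R := `|w.1| + `|w.2| + 1.
have M0 : 0 < M by rewrite /M ltr_pwDr// addr_ge0.
have eM : 0 < e / M by rewrite divr_gt0.
move/cvgrPdist_le : c1 => /(_ _ eM) n1; move/cvgrPdist_le : c2 => /(_ _ eM) n2.
have [d dgt0 dP] := near_plane (filterI n1 n2).
have dM : 0 < d / M by rewrite divr_gt0.
near=> h.
have h0 : h != 0 by near: h; exact: nbhs_dnbhs_neq.
have hd : `|h| < d / M by near: h; apply: dnbhs0_lt.
have hw1 : `|h * w.1| < d.
  rewrite normrM (le_lt_trans (y := `|h| * M))// -?ltr_pdivlMr//.
  by rewrite ler_wpM2l// /M; have := normr_ge0 w.2; lra.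
have hw2 : `|h * w.2| < d.
  rewrite normrM (le_lt_trans (y := `|h| * M))// -?ltr_pdivlMr//.
  by rewrite ler_wpM2l// /M; have := normr_ge0 w.1; lra.
have [a ah aE] := mvt_line ((h * w.2) *: E2 + x) (h * w.1) d1.
have [b bh bE] := mvt_line x (h * w.2) d2.
have -> : (g \o shift x) (h *: w) - g x =
    (h * w.1) * 'D_E1 g (a *: E1 + ((h * w.2) *: E2 + x)) +
    (h * w.2) * 'D_E2 g (b *: E2 + x).
  rewrite -aE -bE addrA subrK; congr (_ - _) => /=; congr g.
  by rewrite plane_shift; case: (w) (x) => ? ? [].
have [A _] := dP _ _ (le_lt_trans ah hw1) hw2.
have := dP 0 b; rewrite normr0 scale0r add0r => /(_ dgt0 (le_lt_trans bh hw2))[_ B].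
rewrite -[_ *: _]/(h^-1 * _) mulrDr !mulrA mulVf// !mul1r.
rewrite opprD addrACA -!mulrBr (le_trans (ler_normD _ _))// !normrM.
rewrite (@le_trans _ _ (`|w.1| * (e / M) + `|w.2| * (e / M)))//.
  by rewrite lerD// ler_wpM2l.
rewrite -mulrDl mulrC -mulrA ger_pMr// mulrC ler_pdivrMr// mul1r /M; lra.
Unshelve. all: by end_near. Qed.

(** The second difference [D] over a square of side [h] is symmetric in the two directions. Two
    applications of the mean value theorem in each order write it as [h ^+ 2] times either mixed
    derivative at a point near [x]; cancelling [h] twice and using continuity at [x] makes the
    values there differ by at most [e]. *)
Lemma clairaut g x :
  (forall y, derivable g y E1) -> (forall y, derivable g y E2) ->
  (forall y, derivable ('D_E1 g : R * R -> R^o) y E2) ->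
  (forall y, derivable ('D_E2 g : R * R -> R^o) y E1) ->
  {for x, continuous ('D_E2 ('D_E1 g : R * R -> R^o) : R * R -> R^o)} ->
  {for x, continuous ('D_E1 ('D_E2 g : R * R -> R^o) : R * R -> R^o)} ->
  'D_E2 ('D_E1 g : R * R -> R^o) x = 'D_E1 ('D_E2 g : R * R -> R^o) x.
Proof.
move=> d1 d2 d12 d21 c12 c21; apply/eqP; rewrite -subr_eq0 -normr_le0.
apply/ler_addgt0Pr => e e0; rewrite add0r.
have e2 : 0 < e / 2 by rewrite divr_gt0.
move/cvgrPdist_le : c12 => /(_ _ e2) n1; move/cvgrPdist_le : c21 => /(_ _ e2) n2.
have [d dgt0 dP] := near_plane (filterI n1 n2).
pose h : R := d / 2.
have h0 : 0 < h by rewrite divr_gt0.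
have hd : `|h| < d by rewrite gtr0_norm// /h; lra.
pose D : R := g (h *: E1 + (h *: E2 + x)) - g (h *: E1 + x)
            - (g (h *: E2 + x) - g x).
have swap (a b : R) y : a *: E1 + (b *: E2 + y) = b *: E2 + (a *: E1 + y).
  by rewrite addrCA.
have [a ah [b bh DE]] : exists2 a : R, `|a| <= `|h| & exists2 b : R, `|b| <= `|h| &
    D = h * (h * 'D_E2 ('D_E1 g : R * R -> R^o) (a *: E1 + (b *: E2 + x))).
  pose q y : R^o := g (h *: E2 + y) - g y.
  have dq y : is_derive y E1 q ('D_E1 g (h *: E2 + y) - 'D_E1 g y).
    apply: is_deriveB; last exact: DeriveDef.
    have E : (fun k : R => k^-1 *:
          (((fun z => g (h *: E2 + z)) \o shift y) (k *: E1) - g (h *: E2 + y))) =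
        (fun k => k^-1 *: ((g \o shift (h *: E2 + y)) (k *: E1) - g (h *: E2 + y))).
      by apply/funext => k /=; congr (_ *: (g _ - _)); rewrite addrCA.
    by split; rewrite ?/derivable ?/derive E//; exact: d1.
  have [a ah aE] := mvt_line x h (fun y => ex_derive (is_derive := dq y)).
  have [b bh bE] := mvt_line (a *: E1 + x) h d12.
  exists a; [exact: ah|exists b; first exact: bh].
  rewrite swap -bE -(derive_val (is_derive := dq (a *: E1 + x))) -aE /q /D swap.
  by rewrite opprD opprK; ring.
have [a' ah' [b' bh' DE']] :
    exists2 a : R, `|a| <= `|h| & exists2 b : R, `|b| <= `|h| &
    D = h * (h * 'D_E1 ('D_E2 g : R * R -> R^o) (b *: E1 + (a *: E2 + x))).
  pose q y : R^o := g (h *: E1 + y) - g y.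
  have dq y : is_derive y E2 q ('D_E2 g (h *: E1 + y) - 'D_E2 g y).
    apply: is_deriveB; last exact: DeriveDef.
    have E : (fun k : R => k^-1 *:
          (((fun z => g (h *: E1 + z)) \o shift y) (k *: E2) - g (h *: E1 + y))) =
        (fun k => k^-1 *: ((g \o shift (h *: E1 + y)) (k *: E2) - g (h *: E1 + y))).
      by apply/funext => k /=; congr (_ *: (g _ - _)); rewrite addrCA.
    by split; rewrite ?/derivable ?/derive E//; exact: d2.
  have [u uh uE] := mvt_line x h (fun y => ex_derive (is_derive := dq y)).
  have [v vh vE] := mvt_line (u *: E2 + x) h d21.
  exists u; [exact: uh|exists v; first exact: vh].
  rewrite -vE -(derive_val (is_derive := dq (u *: E2 + x))) -uE /q /D.
  by rewrite opprD opprK; ring.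
have [A _] := dP _ _ (le_lt_trans ah hd) (le_lt_trans bh hd).
have [_ B] := dP _ _ (le_lt_trans bh' hd) (le_lt_trans ah' hd).
have hN0 : h != 0 by rewrite gt_eqF.
have EE := mulfI hN0 (mulfI hN0 (etrans (esym DE) DE')).
move: A B; rewrite EE => A B.
exact: dist_half A B.
Qed.

(** The mean value theorem in each coordinate gives a Lipschitz bound. It uses bounds on the partial
    derivatives and not their continuity, so it applies to all synthesis integrals without
    circularity. *)
Lemma bounded_partials_continuous g x (M : R) :
  (forall y, derivable g y E1) -> (forall y, derivable g y E2) ->
  (forall y, `|'D_E1 g y| <= M) -> (forall y, `|'D_E2 g y| <= M) ->
  g y @[y --> x] --> g x.
Proof.
move=> d1 d2 b1 b2; apply/cvgrPdist_le => /= e e0.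
pose K : R := 2 * (`|M| + 1).
have K0 : 0 < K by rewrite mulr_gt0// ltr_pwDr.
have [d dgt0 dP] : exists2 d : R, 0 < d & d * K <= e.
  by exists (e / K); rewrite ?divr_gt0// divfK ?gt_eqF.
have nb : \forall y \near x, ball x d y by apply/nbhs_ballP; exists d.
near=> y.
have [y1 y2] : ball x d y by near: y.
pose c1 := y.1 - x.1; pose c2 := y.2 - x.2.
have -> : y = c1 *: E1 + (c2 *: E2 + x).
  by rewrite plane_shift !subrK; case: (y).
have [a _ aE] := mvt_line (c2 *: E2 + x) c1 d1.
have [b _ bE] := mvt_line x c2 d2.
rewrite distrC -(subrK (g (c2 *: E2 + x)) (g (c1 *: _ + _))) -addrA aE bE.
rewrite (le_trans (ler_normD _ _))// !normrM.
have h1 : `|c1| <= d by rewrite ltW// /c1 distrC.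
have h2 : `|c2| <= d by rewrite ltW// /c2 distrC.
apply: le_trans dP; rewrite /K mulrA.
have MM : M <= `|M| + 1 by have := ler_norm M; lra.
rewrite (_ : d * 2 * (`|M| + 1) = d * (`|M| + 1) + d * (`|M| + 1)); last by ring.
by rewrite lerD// ler_pM// (le_trans _ MM).
Unshelve. all: by end_near. Qed.

End Plane.

(** * Measurability of continuous functions on products *)

Section CountableNets.
Context {R : realType}.

(* The neighbourhood system is an explicit argument because the topology and the
   sigma-algebra of [R * R] live on the distinct aliases [R] and
   [measurableTypeR R]. *)
Definition countable_net d (T : measurableType d) (nb : T -> set (set T)) :=
  exists B : nat -> set T, (forall n, measurable (B n)) /\
    forall x U, nb x U -> exists2 n, B n x & B n `<=` U.

Lemma countable_net_R : countable_net (T := measurableTypeR R) (@nbhs R R).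
Proof.
pose B n : set R := if (unpickle n : option (rat * rat)) is Some (q, r)
  then [set` `]ratr q, ratr r[%R] else set0.
exists B; split=> [n|x U /nbhs_ballP[e /= e0 eU]].
  by rewrite /B; case: unpickle => [[q r]|//]; exact: measurable_itv.
have [|q] := @rat_in_itvoo R (x - e) x; first by rewrite ltrBlDr ltrDl.
have [|r] := @rat_in_itvoo R x (x + e); first by rewrite ltrDl.
rewrite !in_itv/= => /andP[xr re] /andP[eq qx].
exists (pickle (q, r)); rewrite /B pickleK/=; first by rewrite in_itv/= qx.
move=> y /=; rewrite in_itv/= => /andP[qy yr]; apply: eU => /=.
by rewrite /ball/= ltr_norml; apply/andP; split; lra.
Qed.

Lemma countable_net_prod d1 d2 (T1 : measurableType d1) (T2 : measurableType d2)
    (nb1 : T1 -> set (set T1)) (nb2 : T2 -> set (set T2)) :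
  countable_net nb1 -> countable_net nb2 ->
  countable_net (T := (T1 * T2)%type) (fun x => filter_prod (nb1 x.1) (nb2 x.2)).
Proof.
move=> [B1 [mB1 nB1]] [B2 [mB2 nB2]].
pose B n : set (T1 * T2) := if (unpickle n : option (nat * nat)) is Some (j, k)
  then B1 j `*` B2 k else set0.
exists B; split=> [n|[x y] U [[U1 U2] /= [xU1 yU2] U12]].
  by rewrite /B; case: unpickle => [[j k]|//]; exact: measurableX.
have [j jx jU] := nB1 _ _ xU1; have [k ky kU] := nB2 _ _ yU2.
exists (pickle (j, k)); rewrite /B pickleK//.
by move=> [u v] [/= /jU ? /kU ?]; exact: U12.
Qed.

Section Measurability.
Context d {T : measurableType d} {nb : T -> set (set T)}.
Hypotheses (net : countable_net nb) (fnb : forall x, Filter (nb x)).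

Lemma net_open_measurable (U : set T) : (forall x, U x -> nb x U) ->
  measurable U.
Proof.
have [B [mB nB]] := net.
move=> oU; rewrite (_ : U = \bigcup_(n in [set n | B n `<=` U]) B n).
  by apply: bigcup_measurable.
apply/seteqP; split=> [x Ux|x [n /= BU Bx]]; last exact: BU.
by have [n Bx BU] := nB _ _ (oU _ Ux); exists n.
Qed.

(** Made for functions that may jump at [a = 0]. The preimage of a ray above [c] is open inside [U],
    and it contains the complement of [U], where [f] is 0, exactly when [c < 0]. *)
Lemma net_measurable_fun (U : set T) (f : T -> R) :
  (forall x, U x -> nb x U) ->
  (forall x, U x -> forall e : R, 0 < e -> nb x [set y | `|f x - f y| < e]) ->
  (forall x, ~ U x -> f x = 0) ->
  measurable_fun setT f.
Proof.
move=> oU cf f0.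
apply: (measurability _ (measurable_realfun.RGenOInfty.measurableE R)) => _ [_ [c ->] <-].
rewrite setTI (_ : f @^-1` _ =
    [set x | U x /\ c < f x] `|` (if c < 0 then ~` U else set0)).
  apply: measurableU.
    apply: net_open_measurable => x [Ux cx].
    have e0 : 0 < f x - c by rewrite subr_gt0.
    have nbx := @filterI _ _ (fnb x) _ _ (oU _ Ux) (cf _ Ux _ e0).
    apply: (@filterS _ _ (fnb x)) nbx => y [Uy /=].
    by rewrite ltr_norml => /andP[_ ?]; split=> //; lra.
  case: ifP => _ //; apply: measurableC; exact: net_open_measurable.
apply/seteqP; split=> [x /=|x /= [[Ux cx]|]].
- rewrite in_itv/= andbT => cx; have [Ux|nUx] := pselect (U x); first by left.
  by right; rewrite f0// in cx; rewrite cx.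
- by rewrite in_itv/= andbT.
- by case: ifP => // c0 nUx; rewrite in_itv/= andbT f0.
Qed.

End Measurability.
End CountableNets.

Section ConcreteMeasurability.
Context {R : realType}.

Local Notation M1 := (measurableTypeR R).
Local Notation M2 := (measurableTypeR R * measurableTypeR R)%type.
Local Notation M4 := (measurableTypeR R * measurableTypeR R *
    measurableTypeR R * measurableTypeR R)%type.

Let net2 : countable_net (T := M2) (@nbhs (R * R)%type (R * R)%type).
Proof. exact: countable_net_prod countable_net_R countable_net_R. Qed.

Lemma net4 : countable_net (T := M4) (@nbhs (R * R * R * R)%type (R * R * R * R)%type).
Proof.
exact: countable_net_prod (countable_net_prod net2 countable_net_R) countable_net_R.
Qed.

Let net6 : countable_net (T := (M4 * M2)%type)
  (@nbhs (R * R * R * R * (R * R))%type (R * R * R * R * (R * R))%type).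
Proof. exact: countable_net_prod net4 net2. Qed.

Lemma continuous_measurable2 (f : M2 -> R) :
  (forall x : R * R, f y @[y --> x] --> f x) -> measurable_fun setT f.
Proof.
move=> cf; apply: (net_measurable_fun net2 (@nbhs_filter (R * R)%type) (U := setT)) => [x _|x _|x []//].
- exact: (@filterT _ (nbhs (x : R * R))).
- by move: (cf x) => /cvgrPdist_lt.
Qed.

Lemma shearS_nbhs (p : R * R * R * R) : shearS p -> nbhs p shearS.
Proof.
case: p => q a /= a0.
exists (setT, [set b : R | b != 0]) => /=; last by move=> [? ?] [].
split; first exact: filterT.
exact: (cvgr_neq0 _ (@cvg_id _ (nbhs a)) a0).
Qed.

Lemma continuous_measurable4 (f : M4 -> R) :
  (forall p : R * R * R * R, shearS p -> f y @[y --> p] --> f p) ->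
  (forall p, ~ shearS p -> f p = 0) -> measurable_fun setT f.
Proof.
move=> cf f0; apply: (net_measurable_fun net4 (@nbhs_filter (R * R * R * R)%type) (U := shearS)) => // p Sp.
- exact: shearS_nbhs.
- by move: (cf p Sp) => /cvgrPdist_lt.
Qed.

Lemma continuous_measurable6 (f : M4 * M2 -> R) :
  (forall z : R * R * R * R * (R * R), shearS z.1 -> f y @[y --> z] --> f z) ->
  (forall z, ~ shearS z.1 -> f z = 0) -> measurable_fun setT f.
Proof.
move=> cf f0; apply: (net_measurable_fun net6 (@nbhs_filter (R * R * R * R * (R * R))%type) (U := [set z | shearS z.1])) => // z Sz.
- exists (shearS, setT) => /=; last by move=> [? ?] [].
  by split; [exact: shearS_nbhs|exact: filterT].
- by move: (cf z Sz) => /cvgrPdist_lt.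
Qed.

Lemma measurable_shearS : measurable (shearS : set M4).
Proof. by apply: (net_open_measurable net4 (U := shearS)) => p; exact: shearS_nbhs. Qed.

End ConcreteMeasurability.

(** * Complex integrals, Fubini and affine changes of variables *)

Section ComplexIntegral.
Context {d : measure_display} {T : measurableType d} {R : realType}.
Variable mu : {measure set T -> \bar R}.
Implicit Types (f g : T -> R[i]) (h : T -> R).

Definition cmeasurable f :=
  measurable_fun setT (fun x => cRe (f x)) /\
  measurable_fun setT (fun x => cIm (f x)).

Lemma cmeasurable_cst c : cmeasurable (fun=> c).
Proof. by split; exact: measurable_cst. Qed.

Lemma cmeasurableD f g : cmeasurable f -> cmeasurable g ->
  cmeasurable (fun x => f x + g x).
Proof.
move=> [f1 f2] [g1 g2]; split.
- by under eq_fun do rewrite cReD; exact: measurable_funD.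
- by under eq_fun do rewrite cImD; exact: measurable_funD.
Qed.

Lemma cmeasurableM f g : cmeasurable f -> cmeasurable g ->
  cmeasurable (fun x => f x * g x).
Proof.
move=> [f1 f2] [g1 g2]; split.
- by under eq_fun do rewrite cReM; apply: measurable_funB; exact: measurable_funM.
- by under eq_fun do rewrite cImM; apply: measurable_funD; exact: measurable_funM.
Qed.

Lemma cmeasurable_indic (A : set T) : measurable A ->
  cmeasurable (fun x => (\1_A x : R)%:C%C).
Proof. by move=> mA; split => /=; [exact: measurable_indic|exact: measurable_cst]. Qed.

Lemma cintegrable_le f h : cmeasurable f -> mu.-integrable setT (EFin \o h) ->
  (forall x, normc (f x) <= h x) -> Cintegrable mu setT f.
Proof.
move=> [f1 f2] ih fh; split; apply: le_integrable ih => //; first 1 last.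
- by move=> x _; rewrite lee_fin (le_trans (cRe_le _))// (le_trans (fh x))// ler_norm.
- exact/measurable_EFinP.
- by move=> x _; rewrite lee_fin (le_trans (cIm_le _))// (le_trans (fh x))// ler_norm.
- exact/measurable_EFinP.
Qed.

(** The factor 2 comes from bounding real and imaginary parts separately; it is harmless wherever
    the bound is used. *)
Lemma normc_Cintegral_le f h : cmeasurable f ->
  mu.-integrable setT (EFin \o h) -> (forall x, normc (f x) <= h x) ->
  normc (Cintegral mu setT f) <= 2 * Rintegral mu setT h.
Proof.
move=> mf ih fh; have [i1 i2] := cintegrable_le mf ih fh.
rewrite (le_trans (normc_le_ReIm _))//= mulr_natl mulr2n lerD//.
- rewrite (le_trans (le_normr_Rintegral _ _))// le_Rintegral//.
    exact: integrable_norm.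
  by move=> x _; rewrite (le_trans (cRe_le _)).
- rewrite (le_trans (le_normr_Rintegral _ _))// le_Rintegral//.
    exact: integrable_norm.
  by move=> x _; rewrite (le_trans (cIm_le _)).
Qed.

Lemma CintegrableD f g : Cintegrable mu setT f -> Cintegrable mu setT g ->
  Cintegrable mu setT (fun x => f x + g x).
Proof.
move=> [f1 f2] [g1 g2]; split.
- by under eq_fun do rewrite cReD EFinD; exact: integrableD.
- by under eq_fun do rewrite cImD EFinD; exact: integrableD.
Qed.

Lemma CintegralD f g : Cintegrable mu setT f -> Cintegrable mu setT g ->
  Cintegral mu setT (fun x => f x + g x) =
  Cintegral mu setT f + Cintegral mu setT g.
Proof.
move=> [f1 f2] [g1 g2]; apply: eq_ReIm; rewrite ?cReD ?cImD /=.
- by under eq_Rintegral do rewrite cReD; rewrite RintegralD.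
- by under eq_Rintegral do rewrite cImD; rewrite RintegralD.
Qed.

Lemma CintegrableZ c f : Cintegrable mu setT f ->
  Cintegrable mu setT (fun x => c * f x).
Proof.
move=> [f1 f2]; split.
- under eq_fun do rewrite cReM EFinB !EFinM.
  by apply: integrableB => //; exact: integrableZl.
- under eq_fun do rewrite cImM EFinD !EFinM.
  by apply: integrableD => //; exact: integrableZl.
Qed.

Lemma CintegralZ c f : Cintegrable mu setT f ->
  Cintegral mu setT (fun x => c * f x) = c * Cintegral mu setT f.
Proof.
move=> [f1 f2].
have iZ (r : R) h : mu.-integrable setT (EFin \o h) ->
    mu.-integrable setT (EFin \o (fun x => r * h x)).
  by move=> ih; rewrite /comp; under eq_fun do rewrite EFinM; exact: integrableZl.
apply: eq_ReIm; rewrite ?cReM ?cImM /=.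
- under eq_Rintegral do rewrite cReM.
  by rewrite RintegralB ?RintegralZl//; exact: iZ.
- under eq_Rintegral do rewrite cImM.
  by rewrite RintegralD ?RintegralZl//; exact: iZ.
Qed.

Lemma Cintegral0 : Cintegral mu setT (fun=> 0) = 0.
Proof. by apply: eq_ReIm; rewrite /= Rintegral_cst//= mul0r. Qed.

Lemma Cintegrable_sum n (F : nat -> T -> R[i]) :
  (forall j, Cintegrable mu setT (F j)) ->
  Cintegrable mu setT (fun x => \sum_(j < n) F j x).
Proof.
move=> iF; elim: n => [|n IH].
  by under eq_fun do rewrite big_ord0; split; exact: integrable0.
by under eq_fun do rewrite big_ord_recr; exact: CintegrableD.
Qed.

Lemma Cintegral_sum n (F : nat -> T -> R[i]) :
  (forall j, Cintegrable mu setT (F j)) ->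
  Cintegral mu setT (fun x => \sum_(j < n) F j x) =
  \sum_(j < n) Cintegral mu setT (F j).
Proof.
move=> iF; elim: n => [|n IH].
  by under eq_fun do rewrite big_ord0; rewrite big_ord0 Cintegral0.
under eq_fun do rewrite big_ord_recr.
by rewrite CintegralD ?IH ?big_ord_recr//; exact: Cintegrable_sum.
Qed.

Lemma Cintegral_mkcond (D : set T) f :
  Cintegral mu D f = Cintegral mu setT (fun x => if x \in D then f x else 0).
Proof.
apply: eq_ReIm; rewrite /= Rintegral_mkcond; congr (Rintegral _ _ _);
  by apply/funext => x; rewrite !patchE; case: ifP.
Qed.

Lemma Cintegrable_mkcond (D : set T) f : measurable D ->
  Cintegrable mu setT (fun x => if x \in D then f x else 0) ->
  Cintegrable mu D f.
Proof.
move=> mD [f1 f2]; split; rewrite integrable_mkcond//; apply: eq_integrable.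
3: exact: f1. 5: exact: f2. all: rewrite //.
- by move=> x _; rewrite !patchE; case: ifP.
- by move=> x _; rewrite !patchE; case: ifP.
Qed.

End ComplexIntegral.

Section ComplexFubini.
Context {d1 d2 : measure_display} {T1 : measurableType d1} {T2 : measurableType d2}.
Context {R : realType}.
Variables (m1 : {sigma_finite_measure set T1 -> \bar R}).
Variables (m2 : {sigma_finite_measure set T2 -> \bar R}).

(** [Rintegral] applies [fine] to the inner integral, which is known to be finite only for almost
    every [y]; hence the passage through almost everywhere equality. *)
Lemma Rfubini2 (f : T1 * T2 -> R) : (m1 \x m2)%E.-integrable setT (EFin \o f) ->
  Rintegral (m1 \x m2)%E setT f =
  Rintegral m2 setT (fun y => Rintegral m1 setT (fun x => f (x, y))).
Proof.
move=> fi; rewrite /Rintegral -[in LHS]integral21_prod_meas1//; congr fine.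
have mG := measurable_fubini_G fi.
apply: ae_eq_integral => //=.
  by apply/measurable_EFinP; exact: measurableT_comp.
have := ae_integrable2 fi; apply: filterS => y iy _.
by rewrite fineK//; apply: integrable_fin_num.
Qed.

Lemma Rfubini1 (f : T1 * T2 -> R) : (m1 \x m2)%E.-integrable setT (EFin \o f) ->
  Rintegral (m1 \x m2)%E setT f =
  Rintegral m1 setT (fun x => Rintegral m2 setT (fun y => f (x, y))).
Proof.
move=> fi; rewrite /Rintegral -[in LHS]integral12_prod_meas1//; congr fine.
have mF := measurable_fubini_F fi.
apply: ae_eq_integral => //=.
  by apply/measurable_EFinP; exact: measurableT_comp.
have := ae_integrable1 fi; apply: filterS => x ix _.
by rewrite fineK//; apply: integrable_fin_num.
Qed.

Lemma Cfubini2 (f : T1 * T2 -> R[i]) : Cintegrable (m1 \x m2)%E setT f ->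
  Cintegral (m1 \x m2)%E setT f =
  Cintegral m2 setT (fun y => Cintegral m1 setT (fun x => f (x, y))).
Proof. by move=> [f1 f2]; apply: eq_ReIm; rewrite /= Rfubini2. Qed.

Lemma Cfubini1 (f : T1 * T2 -> R[i]) : Cintegrable (m1 \x m2)%E setT f ->
  Cintegral (m1 \x m2)%E setT f =
  Cintegral m1 setT (fun x => Cintegral m2 setT (fun y => f (x, y))).
Proof. by move=> [f1 f2]; apply: eq_ReIm; rewrite /= Rfubini1. Qed.

Lemma integrable_prod (f : T1 -> R) (g : T2 -> R) :
  (forall x, 0 <= f x) -> (forall y, 0 <= g y) ->
  m1.-integrable setT (EFin \o f) -> m2.-integrable setT (EFin \o g) ->
  (m1 \x m2)%E.-integrable setT (EFin \o (fun z => f z.1 * g z.2)).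
Proof.
move=> f0 g0 fi gi.
have mf : measurable_fun setT f by have /measurable_int/measurable_EFinP := fi.
have mg : measurable_fun setT g by have /measurable_int/measurable_EFinP := gi.
have mfg : measurable_fun setT (fun z : T1 * T2 => f z.1 * g z.2).
  by apply: measurable_funM; exact: measurableT_comp.
apply/(integrable12ltyP _); first exact/measurable_EFinP.
under eq_integral => x _.
  under eq_integral => y _.
    rewrite /= ger0_norm ?mulr_ge0// EFinM; over.
  rewrite ge0_integralZl//; first over.
  - exact/measurable_EFinP.
  - by move=> y _; rewrite lee_fin.
  - by rewrite lee_fin.
rewrite ge0_integralZr//.
- rewrite lte_mul_pinfty//.
  + by apply: integral_ge0 => x _; rewrite lee_fin.
  + exact: integrable_fin_num.
  + by have := integrable_fin_num measurableT gi; rewrite fin_numE ltey => /andP[].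
- exact/measurable_EFinP.
- by move=> x _; rewrite lee_fin.
- by apply: integral_ge0 => x _; rewrite lee_fin.
Qed.

End ComplexFubini.

Section AffineChange.
Context {R : realType}.
Local Notation leb := (@lebesgue_measure R).

(** The right-hand side is a measure in [A], so by uniqueness of Lebesgue measure half-open
    intervals suffice. For negative [al] the preimage is closed at the other end, which leaves its
    length unchanged. *)
Lemma lebesgue_measure_affine (al be : R) (A : set R) : al != 0 ->
  measurable (A : set (measurableTypeR R)) ->
  leb A = (`|al|%:E * leb ((fun x : R => (al * x + be)%R) @^-1` A))%E.
Proof.
move=> al0 mA; pose phi (x : measurableTypeR R) : measurableTypeR R := al * x + be.
have mphi : measurable_fun setT phi.
  by apply: measurable_funD; [exact: measurable_funM|exact: measurable_cst].
have @nu : {measure set (measurableTypeR R) -> \bar R}.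
  by refine (mscale (NngNum (normr_ge0 al)) (pushforward leb phi)); exact: mphi.
rewrite -[RHS]/(nu A); apply: lebesgue_measure_unique => // _ [[a b]] _ <-.
rewrite -[RHS]/(`|al|%:E * leb (phi @^-1` `]a, b]))%E.
have [agt|alt|/eqP] := ltgtP al 0; last by rewrite (negbTE al0).
- have -> : phi @^-1` `]a, b]%classic = `[(b - be) / al, (a - be) / al[%classic.
    apply/seteqP; split=> x; rewrite /phi /= !in_itv/= => /andP[h1 h2].
      rewrite ler_ndivrMr// ltr_ndivlMr//; apply/andP; split; lra.
    move: h1 h2; rewrite ler_ndivrMr// ltr_ndivlMr// => h1 h2.
    by apply/andP; split; lra.
  rewrite !lebesgue_measure_itv/= !lte_fin ltr_nM2r ?invr_lt0//.
  rewrite ltrD2r; case: ifPn => ab; last by rewrite mule0.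
  rewrite -!EFinB -EFinM; congr EFin; rewrite ltr0_norm//; field.
  by rewrite lt_eqF.
- have -> : phi @^-1` `]a, b]%classic = `](a - be) / al, (b - be) / al]%classic.
    apply/seteqP; split=> x; rewrite /phi /= !in_itv/= => /andP[h1 h2].
      rewrite ler_pdivlMr// ltr_pdivrMr//; apply/andP; split; lra.
    move: h1 h2; rewrite ler_pdivlMr// ltr_pdivrMr// => h1 h2.
    by apply/andP; split; lra.
  rewrite !lebesgue_measure_itv/= !lte_fin ltr_pM2r ?invr_gt0//.
  rewrite ltrD2r; case: ifPn => ab; last by rewrite mule0.
  rewrite -!EFinB -EFinM; congr EFin; rewrite gtr0_norm//; field.
  by rewrite gt_eqF.
Qed.

Lemma ge0_integral_affine (al be : R) (g : R -> \bar R) : al != 0 ->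
  measurable_fun (setT : set (measurableTypeR R)) g -> (forall x, 0 <= g x)%E ->
  (\int[leb]_x g (al * x + be)%R = (`|al|^-1)%:E * \int[leb]_x g x)%E.
Proof.
move=> al0 mg g0; pose phi (x : measurableTypeR R) : measurableTypeR R := al * x + be.
have mphi : measurable_fun setT phi.
  by apply: measurable_funD; [exact: measurable_funM|exact: measurable_cst].
have @nu : {measure set (measurableTypeR R) -> \bar R}.
  by refine (mscale (NngNum (normr_ge0 al)) (pushforward leb phi)); exact: mphi.
rewrite [in RHS](eq_measure_integral nu); last first.
  by move=> A mA _; exact: lebesgue_measure_affine.
rewrite /nu.
rewrite ge0_integral_mscale// ge0_integral_pushforward//.
by rewrite muleA -EFinM mulVf ?normr_eq0// mul1e.
Qed.

Lemma integrable_oneDsqrV :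
  leb.-integrable setT (fun x : R => ((1 + x ^+ 2)^-1)%:E).
Proof.
apply/integrableP; split.
  apply/measurable_EFinP; apply: continuous_measurable_fun.
  exact: continuous_oneDsqrV.
under eq_integral => x _ do rewrite gee0_abs ?lee_fin ?invr_ge0 ?addr_ge0 ?sqr_ge0//.
rewrite (ge0_symfun_integralT (f := fun x => (oneDsqr x)^-1)).
- rewrite (_ : [set x | _] = `[0, +oo[%classic); last first.
    by apply/seteqP; split => x/=; rewrite in_itv/= andbT.
  by rewrite integral0y_oneDsqr -EFinM ltry.
- by move=> x; rewrite invr_ge0 addr_ge0 ?sqr_ge0.
- exact: continuous_oneDsqrV.
- by move=> x /=; rewrite /oneDsqr sqrrN.
Qed.

End AffineChange.

Section PlaneChange.
Context {R : realType}.
Local Notation leb := (@lebesgue_measure R).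
Local Notation M1 := (measurableTypeR R).
Local Notation M2 := (measurableTypeR R * measurableTypeR R)%type.

Variables (al ga de : R) (be : R -> R).
Hypotheses (al0 : al != 0) (ga0 : ga != 0) (mbe : measurable_fun setT be).

Let L (x : M2) : M2 := (al * x.1 + be x.2, ga * x.2 + de).

Lemma measurable_triangular : measurable_fun setT L.
Proof.
apply/measurable_fun_pairP; split => /=.
- by apply: measurable_funD; [exact: measurable_funM|exact: measurableT_comp].
- by apply: measurable_funD; [exact: measurable_funM|exact: measurable_cst].
Qed.

(** By Tonelli, for fixed [y] the inner substitution is affine with shift [be y], and the outer one
    is affine in [y]. The map from [x] to its shear point has this triangular shape. *)
Lemma ge0_integral_triangular (F : M2 -> \bar R) : measurable_fun setT F ->
  (forall x, 0 <= F x)%E ->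
  (\int[leb2]_x F (L x) = (`|al|^-1 * `|ga|^-1)%:E * \int[leb2]_x F x)%E.
Proof.
move=> mF F0.
have mFL : measurable_fun setT (F \o L).
  by apply: measurableT_comp => //; exact: measurable_triangular.
have mF1 y : measurable_fun (setT : set M1) (fun x => F (x, y)).
  by apply: measurableT_comp => //; exact: measurable_pair2.
rewrite [LHS](fubini_tonelli2 (m1 := leb) (m2 := leb) (F \o L))//=.
rewrite /fubini_G/=.
under eq_integral => y _.
  rewrite (ge0_integral_affine (be y) al0 (g := fun x => F (x, ga * y + de)))//.
  over.
have mG := measurable_fun_fubini_tonelli_G (m1 := leb) F mF F0.
have G0 y : (0 <= fubini_G leb F y)%E by apply: integral_ge0.
have mA : measurable_fun (setT : set M1) (fun y : M1 => ga * y + de : M1).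
  by apply: measurable_funD; [exact: measurable_funM|exact: measurable_cst].
rewrite ge0_integralZl//; [|exact: (measurableT_comp mG mA)|by move=> y _; exact: G0].
rewrite (ge0_integral_affine de ga0 (g := fubini_G leb F))// EFinM -muleA.
by rewrite [in RHS](fubini_tonelli2 (m1 := leb) (m2 := leb)).
Qed.

Lemma Rintegral_triangular (f : M2 -> R) : leb2.-integrable setT (EFin \o f) ->
  Rintegral leb2 setT (f \o L) = `|al|^-1 * `|ga|^-1 * Rintegral leb2 setT f.
Proof.
move=> fi; have /measurable_int mf := fi.
have fp := integrable_pos_fin_num measurableT fi.
have fn := integrable_neg_fin_num measurableT fi.
transitivity (fine (\int[leb2]_x ((EFin \o f)^\+%E (L x)) -
    \int[leb2]_x ((EFin \o f)^\-%E (L x)))%E).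
  rewrite /Rintegral integralE; congr (fine (_ - _)); apply: eq_integral => x _.
    exact: (congr1 (fun h => h x) (funepos_comp (EFin \o f) L)).
  exact: (congr1 (fun h => h x) (funeneg_comp (EFin \o f) L)).
rewrite /Rintegral.
rewrite !ge0_integral_triangular//; [|exact: measurable_funeneg|exact: measurable_funepos].
rewrite -muleBr//; last by rewrite fin_num_adde_defr.
by rewrite -integralE fineM//; exact: integrable_fin_num.
Qed.

End PlaneChange.

Lemma cRe_lincomb {R : realType} (r s : R) (z w : R[i]) :
  cRe (r%:C%C * z + s%:C%C * w) = r * cRe z + s * cRe w.
Proof. by rewrite cReD !cReM/= !mul0r !subr0. Qed.

Lemma cIm_lincomb {R : realType} (r s : R) (z w : R[i]) :
  cIm (r%:C%C * z + s%:C%C * w) = r * cIm z + s * cIm w.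
Proof. by rewrite cImD !cImM/= !mul0r !addr0. Qed.

Lemma lty_exists_fin {R : realType} (e : \bar R) : (e < +oo)%E ->
  exists r : R, (e <= r%:E)%E.
Proof. by case: e => [r _|//|_]; [exists r|exists 0; rewrite leNye]. Qed.

(** * Schwartz functions and shearlet kernels *)

Section SchwartzPlane.
Context {R : realType}.
Local Notation E1 := (Defs.e1 : R * R).
Local Notation E2 := (Defs.e2 : R * R).

(** Equivalent to [jap2] up to a factor 2, but free of square roots, so that estimates under affine
    maps become linear arithmetic. *)
Definition size2 (x : R * R) : R := 1 + `|x.1| + `|x.2|.

Lemma size2_ge1 x : 1 <= size2 x.
Proof. by rewrite /size2 -addrA lerDl addr_ge0. Qed.

Lemma size2_gt0 x : 0 < size2 x.
Proof. exact: lt_le_trans (size2_ge1 x). Qed.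

Lemma jap2_ge0 (x : R * R) : 0 <= jap2 x.
Proof. exact: sqrtr_ge0. Qed.

Lemma jap2_le_size2 (x : R * R) : jap2 x <= size2 x.
Proof.
rewrite /jap2 /size2 -[leRHS]ger0_norm ?addr_ge0// -sqrtr_sqr ler_wsqrtr//.
rewrite -(real_normK (num_real x.1)) -(real_normK (num_real x.2)).
by have := normr_ge0 x.1; have := normr_ge0 x.2; nra.
Qed.

Lemma size2_le_jap2 (x : R * R) : size2 x <= 2 * jap2 x.
Proof.
have h1 : 0 <= size2 x by exact: ltW (size2_gt0 x).
have h2 : 0 <= 2 * jap2 x by rewrite mulr_ge0// jap2_ge0.
rewrite -ler_sqr ?nnegrE// /size2 /jap2 exprMn sqr_sqrtr; last by rewrite !addr_ge0 ?sqr_ge0.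
rewrite -(real_normK (num_real x.1)) -(real_normK (num_real x.2)).
move: `|x.1| `|x.2| => u v.
have := sqr_ge0 (u - v); have := sqr_ge0 (u - 1); have := sqr_ge0 (v - 1).
by rewrite !expr2; nra.
Qed.

Lemma seminorm2_le (k m1 m2 : nat) (f : R * R -> R[i]) (c : R) :
  (seminorm2 k m1 m2 f <= c%:E)%E <->
  forall x, jap2 x ^+ k * normc (derivsC (nseq m2 E2 ++ nseq m1 E1) f x) <= c.
Proof.
split=> [fc x|fc]; last by apply: ge_ereal_sup => _ [x _ <-]; rewrite lee_fin.
by rewrite -lee_fin; apply: le_trans fc; apply: ereal_sup_ubound; exists x.
Qed.

Definition word (us : seq (R * R)) := {subset us <= [:: E1; E2]}.

Lemma word_nil : word [::]. Proof. by []. Qed.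

Lemma word_cons v us : v \in [:: E1; E2] -> word us -> word (v :: us).
Proof. by move=> vE wus u; rewrite in_cons => /orP[/eqP->//|/wus]. Qed.

Lemma word_consP v us : word (v :: us) -> v \in [:: E1; E2] /\ word us.
Proof.
move=> w; split; first by apply: w; rewrite mem_head.
by move=> u uus; apply: w; rewrite in_cons uus orbT.
Qed.

Lemma mem_E1 : E1 \in [:: E1; E2]. Proof. by rewrite mem_head. Qed.
Lemma mem_E2 : E2 \in [:: E1; E2]. Proof. by rewrite !in_cons eqxx orbT. Qed.

Variable psi : R * R -> R[i].
Hypothesis psiS : schwartz2 psi.

Lemma schwartz2_is_cderive us v x : word us -> v \in [:: E1; E2] ->
  is_cderive x v (derivsC us psi) (derivsC (v :: us) psi x).
Proof.
move=> wus vE; have [smooth _] := psiS.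
by have [d1 d2 _ _] := smooth us wus x I; apply: derivable_is_cderive; [exact: d1|exact: d2].
Qed.

Lemma schwartz2_ccont us x : word us -> ccont (derivsC us psi) x.
Proof. by move=> wus; have [smooth _] := psiS; have [] := smooth us wus x I. Qed.

Let dRe us v : (fun x => cRe (derivsC (v :: us) psi x)) =
  'D_v (fun y => cRe (derivsC us psi y) : R^o).
Proof. by []. Qed.

Let dIm us v : (fun x => cIm (derivsC (v :: us) psi x)) =
  'D_v (fun y => cIm (derivsC us psi y) : R^o).
Proof. by []. Qed.

Let cRe_cont us v x : word us -> v \in [:: E1; E2] ->
  {for x, continuous ('D_v (fun y => cRe (derivsC us psi y) : R^o) : R * R -> R^o)}.
Proof.
move=> wus vE; rewrite -dRe.
exact: (proj1 (schwartz2_ccont x (word_cons vE wus))).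
Qed.

Let cIm_cont us v x : word us -> v \in [:: E1; E2] ->
  {for x, continuous ('D_v (fun y => cIm (derivsC us psi y) : R^o) : R * R -> R^o)}.
Proof.
move=> wus vE; rewrite -dIm.
exact: (proj2 (schwartz2_ccont x (word_cons vE wus))).
Qed.

Let cRe_der us v x : word us -> v \in [:: E1; E2] ->
  derivable (fun y => cRe (derivsC us psi y) : R^o) x v.
Proof. by move=> wus vE; have [[]] := schwartz2_is_cderive x wus vE. Qed.

Let cIm_der us v x : word us -> v \in [:: E1; E2] ->
  derivable (fun y => cIm (derivsC us psi y) : R^o) x v.
Proof. by move=> wus vE; have [_ []] := schwartz2_is_cderive x wus vE. Qed.

Let cRe_der2 us v v' x : word us -> v \in [:: E1; E2] -> v' \in [:: E1; E2] ->
  derivable ('D_v (fun y => cRe (derivsC us psi y) : R^o) : R * R -> R^o) x v'.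
Proof. by move=> wus vE v'E; rewrite -dRe; exact: cRe_der (word_cons vE wus) v'E. Qed.

Let cRe_cont2 us v v' x : word us -> v \in [:: E1; E2] -> v' \in [:: E1; E2] ->
  {for x, continuous ('D_v' ('D_v (fun y => cRe (derivsC us psi y) : R^o) :
    R * R -> R^o) : R * R -> R^o)}.
Proof. by move=> wus vE v'E; rewrite -dRe; exact: cRe_cont (word_cons vE wus) v'E. Qed.

Let cIm_der2 us v v' x : word us -> v \in [:: E1; E2] -> v' \in [:: E1; E2] ->
  derivable ('D_v (fun y => cIm (derivsC us psi y) : R^o) : R * R -> R^o) x v'.
Proof. by move=> wus vE v'E; rewrite -dIm; exact: cIm_der (word_cons vE wus) v'E. Qed.

Let cIm_cont2 us v v' x : word us -> v \in [:: E1; E2] -> v' \in [:: E1; E2] ->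
  {for x, continuous ('D_v' ('D_v (fun y => cIm (derivsC us psi y) : R^o) :
    R * R -> R^o) : R * R -> R^o)}.
Proof. by move=> wus vE v'E; rewrite -dIm; exact: cIm_cont (word_cons vE wus) v'E. Qed.

Lemma schwartz2_is_cderive_plane us (w : R * R) x : word us ->
  is_cderive x w (derivsC us psi)
    (w.1%:C%C * derivsC (E1 :: us) psi x + w.2%:C%C * derivsC (E2 :: us) psi x).
Proof.
move=> wus; split.
- rewrite cRe_lincomb -[X in _ * X + _]/('D_E1 (fun y => cRe (derivsC us psi y) : R^o) x).
  rewrite -[X in _ + _ * X]/('D_E2 (fun y => cRe (derivsC us psi y) : R^o) x).
  exact: (derive_plane w (fun y => @cRe_der us _ y wus mem_E1)
    (fun y => @cRe_der us _ y wus mem_E2) (@cRe_cont us _ x wus mem_E1) (@cRe_cont us _ x wus mem_E2)).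
- rewrite cIm_lincomb -[X in _ * X + _]/('D_E1 (fun y => cIm (derivsC us psi y) : R^o) x).
  rewrite -[X in _ + _ * X]/('D_E2 (fun y => cIm (derivsC us psi y) : R^o) x).
  exact: (derive_plane w (fun y => @cIm_der us _ y wus mem_E1)
    (fun y => @cIm_der us _ y wus mem_E2) (@cIm_cont us _ x wus mem_E1) (@cIm_cont us _ x wus mem_E2)).
Qed.

Lemma schwartz2_swap us : word us ->
  derivsC (E1 :: E2 :: us) psi = derivsC (E2 :: E1 :: us) psi.
Proof.
move=> wus; apply/funext => x.
apply/esym/eq_ReIm.
- exact: (clairaut (fun y => @cRe_der us _ y wus mem_E1)
    (fun y => @cRe_der us _ y wus mem_E2)
    (fun y => @cRe_der2 us _ _ y wus mem_E1 mem_E2)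
    (fun y => @cRe_der2 us _ _ y wus mem_E2 mem_E1)
    (@cRe_cont2 us _ _ x wus mem_E1 mem_E2) (@cRe_cont2 us _ _ x wus mem_E2 mem_E1)).
- exact: (clairaut (fun y => @cIm_der us _ y wus mem_E1)
    (fun y => @cIm_der us _ y wus mem_E2)
    (fun y => @cIm_der2 us _ _ y wus mem_E1 mem_E2)
    (fun y => @cIm_der2 us _ _ y wus mem_E2 mem_E1)
    (@cIm_cont2 us _ _ x wus mem_E1 mem_E2) (@cIm_cont2 us _ _ x wus mem_E2 mem_E1)).
Qed.

Lemma word_nseq m1 m2 : word (nseq m2 E2 ++ nseq m1 E1).
Proof.
move=> u; rewrite mem_cat !mem_nseq => /orP[|] /andP[_ /eqP->].
  exact: mem_E2.
exact: mem_E1.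
Qed.

(* The seminorms only bound derivatives taken first along [E1] and then along
   [E2]; Clairaut's theorem reduces every word to this case. *)
Lemma derivsC_sorted us : word us -> exists m1 m2,
  derivsC us psi = derivsC (nseq m2 E2 ++ nseq m1 E1) psi.
Proof.
elim: us => [|v us IH] wus; first by exists 0%N, 0%N.
have [vE {}wus] := word_consP wus.
have [m1 [m2 E]] := IH wus.
rewrite /= E; move: vE; rewrite !inE => /orP[|] /eqP ->; last by exists m1, m2.+1.
(* A new [E1] in front is carried past the block of [E2], one swap per induction step. *)
exists m1.+1, m2; elim: m2 {E} => [//|m2 IHm].
exact: (etrans (schwartz2_swap (@word_nseq m1 m2)) (congr1 (Defs.derivC E2) IHm)).
Qed.

Lemma schwartz2_decay us k : word us -> exists2 c : R, 0 <= c &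
  forall x, size2 x ^+ k * normc (derivsC us psi x) <= c.
Proof.
move=> /derivsC_sorted[m1 [m2 ->]]; have [_ fin] := psiS.
have [c /seminorm2_le cE] := lty_exists_fin (fin k m1 m2).
exists (2 ^+ k * `|c|); first by rewrite mulr_ge0// exprn_ge0.
move=> x; rewrite (le_trans (y := 2 ^+ k * (jap2 x ^+ k *
    normc (derivsC (nseq m2 E2 ++ nseq m1 E1) psi x))))//.
  rewrite mulrA -exprMn ler_wpM2r ?normc_ge0// lerXn2r ?nnegrE ?size2_le_jap2//.
    exact: ltW (size2_gt0 x).
  by rewrite mulr_ge0// jap2_ge0.
by rewrite ler_wpM2l ?exprn_ge0// (le_trans (cE x))// ler_norm.
Qed.

End SchwartzPlane.

Lemma conjc_realM {R : realType} (r : R) (z : R[i]) :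
  conjc (r%:C%C * z) = r%:C%C * conjc z.
Proof.
by apply: eq_ReIm; rewrite ?cRe_conj ?cIm_conj ?cReM ?cImM ?cRe_conj ?cIm_conj/=; ring.
Qed.

(** * The shear point and its growth weight *)

Section ShearPoint.
Context {R : realType}.
Local Notation P4 := (R * R * R * R)%type.
Local Notation P2 := (R * R)%type.
Implicit Types (p : P4) (x : P2).

Lemma jap_ge1 (t : R) : 1 <= jap t.
Proof. by rewrite /jap -{1}sqrtr1 ler_wsqrtr// lerDl sqr_ge0. Qed.

Lemma ler_jap (t : R) : `|t| <= jap t.
Proof. by rewrite /jap -sqrtr_sqr ler_wsqrtr// lerDr. Qed.

Lemma sqr_jap (t : R) : jap t ^+ 2 = 1 + t ^+ 2.
Proof. by rewrite /jap sqr_sqrtr// addr_ge0 ?sqr_ge0. Qed.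

(* Shearlets of a Schwartz function have Schwartz seminorms bounded by powers of
   this weight, against which elements of S(S) decay. *)
Definition om p : R :=
  jap p.1.1.1 * jap p.1.1.2 * jap p.1.2 * (`|p.2| + `|p.2|^-1).

Lemma tau_ge1 (a : R) : a != 0 -> 1 <= `|a| + `|a|^-1.
Proof.
move=> a0; have [h|h] := leP 1 `|a|; first by rewrite (le_trans h)// lerDl.
by rewrite (@le_trans _ _ `|a|^-1) ?lerDr// invf_ge1 ?normr_gt0// ltW.
Qed.

(** The powers of [|a|] occurring in shearlets, with exponents [-3/4] and [-1/2], are thereby
    absorbed by one factor of [om]. *)
Lemma powR_le_tau (a r : R) : a != 0 -> -1 <= r <= 1 ->
  `|a| `^ r <= `|a| + `|a|^-1.
Proof.
move=> a0 /andP[r1 r2]; have a1 : 0 < `|a| by rewrite normr_gt0.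
have [h|h] := leP 1 `|a|.
  by rewrite (le_trans (ler_powR h r2))// powRr1// lerDl.
have h' : 1 <= `|a|^-1 by rewrite invf_ge1// ltW.
have -> : `|a| `^ r = `|a|^-1 `^ (- r) by rewrite -powR_inv1// -powRrM mulN1r opprK.
rewrite (@le_trans _ _ (`|a|^-1 `^ 1))//; first by rewrite ler_powR// lerNl.
by rewrite powRr1 ?invr_ge0// lerDr.
Qed.

Section Bounds.
Variable p : P4.
Hypothesis Sp : shearS p.
Let J1 := jap p.1.1.1.
Let J2 := jap p.1.1.2.
Let Js := jap p.1.2.
Let t := `|p.2| + `|p.2|^-1.

(** All four factors of [om p] are at least 1, so every partial product is bounded by the whole. *)
Lemma om_factors : [/\ J1 <= om p, J2 <= om p, Js * t <= om p, Js <= om p & t <= om p].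
Proof.
have h1 : 1 <= J1 := jap_ge1 _; have h2 : 1 <= J2 := jap_ge1 _.
have h3 : 1 <= Js := jap_ge1 _; have h4 : 1 <= t := tau_ge1 Sp.
have ge (u v : R) : 1 <= u -> 1 <= v -> 1 <= u * v /\ u <= u * v /\ v <= u * v.
  by move=> hu hv; split; [nra|split; nra].
have [h12 [a1 a2]] := ge _ _ h1 h2; have [h34 [a3 a4]] := ge _ _ h3 h4.
have [h [b1 b2]] := ge _ _ h12 h34.
rewrite /om -/J1 -/J2 -/Js -/t -mulrA; split => //.
- exact: le_trans b1.
- exact: le_trans b1.
- exact: le_trans b2.
- exact: le_trans b2.
Qed.

Lemma om_ge1 : 1 <= om p.
Proof. by have [_ _ _ _ h] := om_factors; rewrite (le_trans _ h)// tau_ge1. Qed.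

Lemma om_le_sqr u : u <= om p -> u <= om p ^+ 2.
Proof. by move=> h; have := om_ge1; rewrite expr2; nra. Qed.

Lemma om_le_pow m n : (m <= n)%N -> om p ^+ m <= om p ^+ n.
Proof. by move=> mn; rewrite ler_weXn2l// om_ge1. Qed.

End Bounds.

(** The ratio of the two diagonal entries of [dil_mx a]. *)
Definition rho (a : R) : R := `|a| `^ (- 2^-1).

Lemma rho_gt0 a : a != 0 -> 0 < rho a.
Proof. by move=> a0; rewrite powR_gt0// normr_gt0. Qed.

(* [A_a^-1 S_s^-1 (x - b)] *)
Definition shear_point p x : P2 :=
  ((x.1 - p.1.1.1 + p.1.2 * (x.2 - p.1.1.2)) / p.2, (x.2 - p.1.1.2) / (p.2 * rho p.2)).

Lemma mxact_mx2 (a b c d : R) x :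
  mxact (mx2 a b c d) x = (a * x.1 + b * x.2, c * x.1 + d * x.2).
Proof. by rewrite /mxact !mxE !big_ord_recl !big_ord0 !mxE/= !addr0. Qed.

Lemma mulmx_mx2 (a b c d a' b' c' d' : R) :
  mx2 a b c d *m mx2 a' b' c' d' =
  mx2 (a * a' + b * c') (a * b' + b * d') (c * a' + d * c') (c * b' + d * d').
Proof.
by apply/matrixP => i j; rewrite !mxE !big_ord_recl !big_ord0 !mxE/= !addr0;
  case: ifP; case: ifP.
Qed.

Lemma mx2_1 : mx2 1 0 0 1 = 1%:M :> 'M[R]_2.
Proof.
by apply/matrixP => -[[|[|//]] i] [[|[|//]] j]; rewrite !mxE.
Qed.

Lemma invmx_eq (A B : 'M[R]_2) : A *m B = 1%:M -> invmx A = B.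
Proof.
by move=> AB; have [uA _] := mulmx1_unit AB; rewrite -[LHS]mulmx1 -AB mulKmx.
Qed.

Lemma conj_shearletE (psi : P2 -> R[i]) p x : shearS p ->
  conj_shearlet psi p x =
  (`|p.2| `^ (- (3 / 4)))%:C%C * conjc (psi (shear_point p x)).
Proof.
case: p => [[b s] a] /= a0; have r0 := lt0r_neq0 (rho_gt0 a0).
rewrite /conj_shearlet /shearlet /shear_point/=.
have -> : invmx (shear_mx s) = mx2 1 s 0 1.
  apply: invmx_eq; rewrite mulmx_mx2 -mx2_1; congr mx2; ring.
have -> : invmx (dil_mx a) = mx2 a^-1 0 0 (a * rho a)^-1.
  apply: invmx_eq; rewrite /dil_mx (_ : a *: _ = mx2 a 0 0 (a * rho a)); last first.
    apply/matrixP => i j; rewrite !mxE; case: ifP; case: ifP => _ _ //.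
    - by rewrite mulr1.
    - by rewrite mulr0.
    - by rewrite mulr0.
  by rewrite mulmx_mx2 -mx2_1; congr mx2; field; rewrite ?r0 ?a0.
rewrite !mxact_mx2/= conjc_realM.
by congr (_ * conjc (psi _)); congr pair; field; rewrite ?r0 ?a0.
Qed.

(** Solving for [x] in terms of [y = shear_point p x] gives an affine map whose coefficients are all
    at most [om p ^+ 2]. The worst one is [s * a * rho a], bounded by [jap s] times the square of
    [|a| + 1 / |a|], hence by [(Js * t) * t]. The 3 is the number of constant terms left in
    [1 + |x.1| + |x.2|]. *)
Lemma size2_shear_point p x : shearS p ->
  size2 x <= 3 * om p ^+ 2 * size2 (shear_point p x).
Proof.
move=> Sp; have a0 : p.2 != 0 := Sp; have r0 := rho_gt0 a0.
have [h1 h2 h3 h4 h5] := om_factors Sp.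
set y := shear_point p x.
have x2 : x.2 = p.1.1.2 + p.2 * rho p.2 * y.2.
  by rewrite /y /=; field; rewrite a0 gt_eqF.
have x1 : x.1 = p.1.1.1 + p.2 * y.1 - p.1.2 * (p.2 * rho p.2 * y.2).
  by rewrite /y /=; field; rewrite a0 gt_eqF.
have W1 := om_ge1 Sp.
have t1 := tau_ge1 a0.
have rt : rho p.2 <= `|p.2| + `|p.2|^-1 by apply: powR_le_tau => //; apply/andP; split; lra.
have ar : `|p.2| * rho p.2 <= (`|p.2| + `|p.2|^-1) ^+ 2.
  by rewrite expr2; apply: ler_pM => //; [exact: ltW|rewrite lerDl].
have B0 : 1 <= om p ^+ 2 by exact: om_le_sqr.
have B1 : `|p.1.1.1| <= om p ^+ 2.
  by apply: om_le_sqr => //; rewrite (le_trans (ler_jap _)).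
have B2 : `|p.1.1.2| <= om p ^+ 2.
  by apply: om_le_sqr => //; rewrite (le_trans (ler_jap _)).
have B3 : `|p.2| <= om p ^+ 2.
  by apply: om_le_sqr => //; rewrite (le_trans _ h5)// lerDl.
have B4 : `|p.2| * rho p.2 <= om p ^+ 2.
  by rewrite (le_trans ar)// lerXn2r ?nnegrE//; lra.
have B5 : `|p.1.2| * (`|p.2| * rho p.2) <= om p ^+ 2.
  have s0 := normr_ge0 p.1.2; have := ler_jap p.1.2 => sJ.
  rewrite (@le_trans _ _ (jap p.1.2 * (`|p.2| + `|p.2|^-1) ^+ 2))//.
    by rewrite ler_pM// mulr_ge0// ltW.
  have J0 : 0 <= jap p.1.2 by exact: sqrtr_ge0.
  have t0 : 0 <= `|p.2| + `|p.2|^-1 by lra.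
  rewrite expr2 mulrA expr2; apply: ler_pM => //; exact: mulr_ge0.
have N1 : `|x.1| <= `|p.1.1.1| + `|p.2| * `|y.1| + `|p.1.2| * (`|p.2| * rho p.2) * `|y.2|.
  rewrite x1 (le_trans (ler_normB _ _))// lerD//.
    by rewrite (le_trans (ler_normD _ _))// normrM.
  by rewrite !normrM (gtr0_norm r0) !mulrA.
have N2 : `|x.2| <= `|p.1.1.2| + `|p.2| * rho p.2 * `|y.2|.
  by rewrite x2 (le_trans (ler_normD _ _))// !normrM (gtr0_norm r0).
have y10 := normr_ge0 y.1; have y20 := normr_ge0 y.2.
have C3 := ler_wpM2r y10 B3; have C4 := ler_wpM2r y20 B4; have C5 := ler_wpM2r y20 B5.
rewrite /size2; nra.
Qed.

End ShearPoint.

Section ShearContinuity.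
Context {R : realType}.
Local Notation P4 := (R * R * R * R)%type.
Local Notation P2 := (R * R)%type.
Implicit Types (p : P4) (x : P2).

Lemma cvg_p2 p : q.2 @[q --> p] --> p.2.
Proof. exact: cvg_snd. Qed.

Lemma cvg_p12 p : q.1.2 @[q --> p] --> p.1.2.
Proof. by apply: (cvg_comp _ _ (cvg_fst : q.1 @[q --> p] --> p.1)); exact: cvg_snd. Qed.

Let cvg_p11 p : q.1.1 @[q --> p] --> p.1.1.
Proof. by apply: (cvg_comp _ _ (cvg_fst : q.1 @[q --> p] --> p.1)); exact: cvg_fst. Qed.

Lemma cvg_p112 p : q.1.1.2 @[q --> p] --> p.1.1.2.
Proof. by apply: (cvg_comp _ _ (@cvg_p11 p)); exact: cvg_snd. Qed.

Lemma cvg_p111 p : q.1.1.1 @[q --> p] --> p.1.1.1.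
Proof. by apply: (cvg_comp _ _ (@cvg_p11 p)); exact: cvg_fst. Qed.

Lemma jap_continuous (t : R) : jap u @[u --> t] --> jap t.
Proof.
have H : (1 + u * u : R) @[u --> t] --> 1 + t * t.
  by apply: cvgD; [exact: cvg_cst|apply: cvgM; exact: cvg_id].
rewrite /jap; under eq_fun do rewrite expr2.
by rewrite expr2; apply: (cvg_comp _ _ H); exact: sqrt_continuous.
Qed.

Lemma norm_p2_cvg p : `|q.2| @[q --> p] --> `|p.2|.
Proof. by apply: cvg_norm; exact: cvg_p2. Qed.

Lemma om_continuous p : shearS p -> om q @[q --> p] --> om p.
Proof.
move=> Sp; rewrite /om; apply: cvgM; first apply: cvgM; first apply: cvgM.
- by apply: (cvg_comp _ _ (@cvg_p111 p)); exact: jap_continuous.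
- by apply: (cvg_comp _ _ (@cvg_p112 p)); exact: jap_continuous.
- by apply: (cvg_comp _ _ (@cvg_p12 p)); exact: jap_continuous.
- apply: cvgD; first exact: norm_p2_cvg.
  by apply: cvgV; [rewrite normr_eq0|exact: norm_p2_cvg].
Qed.

Definition coef (c : P4 -> R) :=
  (forall p, shearS p -> c q @[q --> p] --> c p) /\
  exists m, forall p, shearS p -> `|c p| <= om p ^+ m.

Lemma powR_p2_cvg p (r : R) : shearS p -> `|q.2| `^ r @[q --> p] --> `|p.2| `^ r.
Proof.
move=> Sp; apply: (cvg_comp _ (fun u : R => u `^ r) (@norm_p2_cvg p)).
have /derivable1_diffP/differentiable_continuous : derivable (fun u : R => u `^ r) `|p.2| 1.
  by apply: derivable_powR; rewrite in_itv/= andbT normr_gt0.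
exact.
Qed.

Lemma coef_powR (r : R) : -1 <= r <= 1 -> coef (fun p => `|p.2| `^ r).
Proof.
move=> r1; split=> [p Sp|]; first exact: powR_p2_cvg.
exists 1%N => p Sp; have [_ _ _ _ h] := om_factors Sp.
by rewrite ger0_norm ?powR_ge0// expr1 (le_trans _ h)// powR_le_tau.
Qed.

Lemma coef_invp2 : coef (fun p => p.2^-1).
Proof.
split=> [p Sp|]; first by apply: cvgV => //; exact: cvg_p2.
exists 1%N => p Sp; have [_ _ _ _ h] := om_factors Sp.
by rewrite normfV expr1 (le_trans _ h)// lerDr.
Qed.

Lemma coef_p12 : coef (fun p => p.1.2).
Proof.
split=> [p Sp|]; first exact: cvg_p12.
exists 1%N => p Sp; have [_ _ _ h _] := om_factors Sp.
by rewrite expr1 (le_trans _ h)// ler_jap.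
Qed.

Lemma coefM c d : coef c -> coef d -> coef (fun p => c p * d p).
Proof.
move=> [cc [m cm]] [cd [n dn]]; split=> [p Sp|].
  by apply: cvgM; [exact: cc|exact: cd].
by exists (m + n)%N => p Sp; rewrite normrM exprD ler_pM// ?cm ?dn.
Qed.

Lemma coef_invrho : coef (fun p => (rho p.2)^-1).
Proof.
have E : (fun p : P4 => (rho p.2)^-1) = (fun p => `|p.2| `^ 2^-1).
  by apply/funext => p; rewrite /rho powRN invrK.
by rewrite E; apply: coef_powR; apply/andP; split; lra.
Qed.

Lemma coef_invp2rho : coef (fun p => (p.2 * rho p.2)^-1).
Proof.
rewrite (_ : (fun p => _) = (fun p : P4 => p.2^-1 * (rho p.2)^-1)).
  by apply: coefM; [exact: coef_invp2|exact: coef_invrho].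
by apply/funext => p; rewrite invfM.
Qed.

Lemma coef_p12V : coef (fun p => p.1.2 / p.2).
Proof. by apply: coefM; [exact: coef_p12|exact: coef_invp2]. Qed.

Lemma cvg_fst6 (V : topologicalType) (c : P4 -> V) (z : P4 * P2) :
  c q @[q --> z.1] --> c z.1 -> c y.1 @[y --> z] --> c z.1.
Proof. by apply: (cvg_comp fst c); exact: cvg_fst. Qed.

Lemma shear_point_cvg (z : P4 * P2) : shearS z.1 ->
  shear_point y.1 y.2 @[y --> z] --> shear_point z.1 z.2.
Proof.
move=> Sz.
have x1 : y.2.1 @[y --> z] --> z.2.1.
  by apply: (cvg_comp snd fst (cvg_snd : y.2 @[y --> z] --> z.2)); exact: cvg_fst.
have x2 : y.2.2 @[y --> z] --> z.2.2.
  by apply: (cvg_comp snd snd (cvg_snd : y.2 @[y --> z] --> z.2)); exact: cvg_snd.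
have b1 := cvg_fst6 (@cvg_p111 z.1); have b2 := cvg_fst6 (@cvg_p112 z.1).
have s := cvg_fst6 (@cvg_p12 z.1).
have a := cvg_fst6 (proj1 coef_invp2 _ Sz).
have r := cvg_fst6 (proj1 coef_invp2rho _ Sz).
have A : (shear_point y.1 y.2).1 @[y --> z] --> (shear_point z.1 z.2).1.
  exact: (cvgM (cvgD (cvgB x1 b1) (cvgM s (cvgB x2 b2))) a).
have B : (shear_point y.1 y.2).2 @[y --> z] --> (shear_point z.1 z.2).2.
  exact: (cvgM (cvgB x2 b2) r).
exact: (cvg_pair A B).
Qed.

End ShearContinuity.

Lemma conjc_lincomb {R : realType} (r s : R) (z w : R[i]) :
  conjc (r%:C%C * z + s%:C%C * w) = r%:C%C * conjc z + s%:C%C * conjc w.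
Proof.
by rewrite -!conjc_realM; apply: eq_ReIm; rewrite ?cRe_conj ?cIm_conj ?cReD ?cImD
  ?cRe_conj ?cIm_conj ?opprD.
Qed.

(** * Kernels generated from shearlets by differentiation *)

Section ShearKernel.
Context {R : realType}.
Local Notation P4 := (R * R * R * R)%type.
Local Notation P2 := (R * R)%type.
Local Notation E1 := (Defs.e1 : R * R).
Local Notation E2 := (Defs.e2 : R * R).
Variable psi : P2 -> R[i].
Hypothesis psiS : schwartz2 psi.

(* The smallest class containing the kernel [conj_shearlet psi] and closed under
   partial derivatives in [x]: by the chain rule these only produce coefficients
   of polynomial growth in [om]. *)
Inductive shear_kernel : (P4 -> P2 -> R[i]) -> Prop :=
| shear_kernel_derivs us : word us ->
    shear_kernel (fun p x => conjc (derivsC us psi (shear_point p x)))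
| shear_kernelD K1 K2 : shear_kernel K1 -> shear_kernel K2 ->
    shear_kernel (fun p x => K1 p x + K2 p x)
| shear_kernelZ c K : coef c -> shear_kernel K ->
    shear_kernel (fun p x => (c p)%:C%C * K p x).

Lemma is_derive_affine (V W : normedModType R) (g : V -> W) (A : V -> V) x v w d :
  (forall h : R, A (h *: v + x) = h *: w + A x) ->
  is_derive (A x) w g d -> is_derive x v (g \o A) d.
Proof.
move=> Av [dg dE].
have E : (fun h : R => h^-1 *: (((g \o A) \o shift x) (h *: v) - (g \o A) x)) =
    (fun h => h^-1 *: ((g \o shift (A x)) (h *: w) - g (A x))).
  by apply/funext => h /=; rewrite Av.
by split; rewrite ?/derivable ?/derive E.
Qed.

Lemma shear_point_line p x (h : R) v : shear_point p (h *: v + x) =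
  h *: ((v.1 + p.1.2 * v.2) / p.2, v.2 / (p.2 * rho p.2)) + shear_point p x.
Proof.
have e1 : (h *: v + x).1 = h * v.1 + x.1 by [].
have e2 : (h *: v + x).2 = h * v.2 + x.2 by [].
transitivity (h * ((v.1 + p.1.2 * v.2) / p.2) + (shear_point p x).1,
  h * (v.2 / (p.2 * rho p.2)) + (shear_point p x).2); last by [].
by rewrite /shear_point e1 e2; congr pair; rewrite /=; ring.
Qed.

(** The formulas hold for every [p], even with [a = 0]: the inverse of 0 is 0, so the shear point is
    then constant in [x] and the derivatives vanish. Differentiation under the integral can thus
    range over the whole product space. *)
Lemma shear_kernel_is_cderive K : shear_kernel K -> exists K1 K2,
  [/\ shear_kernel K1, shear_kernel K2,
      forall p x, is_cderive x E1 (K p) (K1 p x) &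
      forall p x, is_cderive x E2 (K p) (K2 p x)].
Proof.
elim=> [us wus|K1 K2 _ [K11 [K12 [s11 s12 d11 d12]]] _ [K21 [K22 [s21 s22 d21 d22]]]|
        c K0 cc _ [K1 [K2 [s1 s2 d1 d2]]]].
- pose G v p x := conjc (derivsC (v :: us) psi (shear_point p x)).
  have dG p x v : is_cderive x v (fun y => conjc (derivsC us psi (shear_point p y)))
      ((((v.1 + p.1.2 * v.2) / p.2)%:C)%C * G E1 p x +
       ((v.2 / (p.2 * rho p.2))%:C)%C * G E2 p x).
    have [r i] := schwartz2_is_cderive_plane psiS
      ((v.1 + p.1.2 * v.2) / p.2, v.2 / (p.2 * rho p.2)) (shear_point p x) wus.
    have D : is_cderive x v (fun y => derivsC us psi (shear_point p y))
      ((((v.1 + p.1.2 * v.2) / p.2)%:C)%C * derivsC (E1 :: us) psi (shear_point p x) +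
       ((v.2 / (p.2 * rho p.2))%:C)%C * derivsC (E2 :: us) psi (shear_point p x)).
      split.
      + exact: (is_derive_affine (fun h => shear_point_line p x h v) r).
      + exact: (is_derive_affine (fun h => shear_point_line p x h v) i).
    by have := is_cderive_conj D; rewrite conjc_lincomb.
  exists (fun p x => (p.2^-1)%:C%C * G E1 p x).
  exists (fun p x => (p.1.2 / p.2)%:C%C * G E1 p x +
                     ((p.2 * rho p.2)^-1)%:C%C * G E2 p x).
  have k1 : shear_kernel (G E1) by apply: shear_kernel_derivs; apply: word_cons => //; exact: mem_E1.
  have k2 : shear_kernel (G E2) by apply: shear_kernel_derivs; apply: word_cons => //; exact: mem_E2.
  split.
  + by apply: shear_kernelZ => //; exact: coef_invp2.
  + by apply: shear_kernelD; apply: shear_kernelZ => //;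
      [exact: coef_p12V|exact: coef_invp2rho].
  + move=> p x; have := dG p x E1.
    by rewrite /Defs.e1/= mulr0 addr0 !mul0r mul1r addr0.
  + move=> p x; have := dG p x E2.
    by rewrite /Defs.e2/= mulr1 add0r mul1r.
- exists (fun p x => K11 p x + K21 p x), (fun p x => K12 p x + K22 p x).
  split; [exact: shear_kernelD|exact: shear_kernelD| |].
  + by move=> p x; exact: is_cderiveD.
  + by move=> p x; exact: is_cderiveD.
- exists (fun p x => (c p)%:C%C * K1 p x), (fun p x => (c p)%:C%C * K2 p x).
  split; [exact: shear_kernelZ|exact: shear_kernelZ| |].
  + by move=> p x; exact: is_cderiveZ.
  + by move=> p x; exact: is_cderiveZ.
Qed.

Lemma shear_kernel_ccont K (z : P4 * P2) : shear_kernel K -> shearS z.1 ->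
  ccont (fun y : P4 * P2 => K y.1 y.2) z.
Proof.
move=> + Sz; elim=> [us wus|K1 K2 _ c1 _ c2|c K0 [cc _] _ cK].
- apply: ccont_conj.
  apply: (ccont_comp (f := derivsC us psi) (h := fun y => shear_point y.1 y.2)).
    exact: shear_point_cvg.
  exact: schwartz2_ccont.
- exact: ccontD.
- apply: ccontM => //; apply: (ccont_real (r := fun y : P4 * P2 => c y.1)).
  by apply: cvg_fst6; exact: cc.
Qed.

(** By [size2_shear_point], [k] powers of [size2 x] cost [2 * k] powers of [om p] and [k] powers of
    [size2] at the shear point, which the decay of the derivatives of [psi] absorbs. Sums and
    coefficients only raise the power of [om]. *)
Lemma shear_kernel_decay K k : shear_kernel K -> exists2 C : R, 0 <= C &
  exists m, forall p x, shearS p ->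
    size2 x ^+ k * normc (K p x) <= C * om p ^+ m.
Proof.
elim=> [us wus|K1 K2 _ [C1 C10 [m1 H1]] _ [C2 C20 [m2 H2]]|c K0 [_ [n cn]] _ [C C0 [m H]]].
- have [C C0 HC] := schwartz2_decay psiS k wus.
  exists (3 ^+ k * C); first by rewrite mulr_ge0// exprn_ge0.
  exists (2 * k)%N => p x Sp; rewrite normc_conj.
  set y := shear_point p x; set d := derivsC us psi y.
  have W0 : 0 <= om p by rewrite (le_trans _ (om_ge1 Sp)).
  rewrite (@le_trans _ _ ((3 * om p ^+ 2 * size2 y) ^+ k * normc d))//.
    rewrite ler_wpM2r ?normc_ge0// lerXn2r ?nnegrE ?size2_shear_point//.
      exact: ltW (size2_gt0 x).
    by rewrite mulr_ge0 ?(ltW (size2_gt0 _))// mulr_ge0// exprn_ge0.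
  have -> : (3 * om p ^+ 2 * size2 y) ^+ k * normc d =
      3 ^+ k * om p ^+ (2 * k) * (size2 y ^+ k * normc d).
    by rewrite exprM; move: (om p ^+ 2) => w; rewrite !exprMn !mulrA.
  rewrite [leRHS](_ : _ = 3 ^+ k * om p ^+ (2 * k) * C); last by ring.
  apply: ler_wpM2l; last exact: HC.
  by apply: mulr_ge0; apply: exprn_ge0.
- exists (C1 + C2); first exact: addr_ge0.
  exists (m1 + m2)%N => p x Sp.
  rewrite (le_trans (ler_wpM2l _ (normc_triangle _ _)))//.
    by rewrite exprn_ge0// ltW// size2_gt0.
  rewrite mulrDr mulrDl lerD//.
  + rewrite (le_trans (H1 p x Sp))// ler_wpM2l// om_le_pow// leq_addr//.
  + rewrite (le_trans (H2 p x Sp))// ler_wpM2l// om_le_pow// leq_addl//.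
- exists C => //; exists (n + m)%N => p x Sp.
  rewrite normc_prod normc_real mulrCA exprD [leRHS]mulrCA.
  apply: ler_pM => //; [|exact: cn|exact: H].
  by apply: mulr_ge0; rewrite ?normc_ge0// exprn_ge0// ltW// size2_gt0.
Qed.

Lemma shear_kernel_conj_shearlet : exists2 K, shear_kernel K &
  forall p x, shearS p -> conj_shearlet psi p x = K p x.
Proof.
exists (fun p x => (`|p.2| `^ (- (3 / 4)))%:C%C * conjc (psi (shear_point p x))).
  apply: shear_kernelZ; first by apply: coef_powR; apply/andP; split; lra.
  exact: (shear_kernel_derivs word_nil).
by move=> p x Sp; exact: conj_shearletE.
Qed.

End ShearKernel.

Lemma cmeasurable_sum {R : realType} {d : measure_display} {T : measurableType d}
  n (F : nat -> T -> R[i]) : (forall j, cmeasurable (F j)) ->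
  cmeasurable (fun x => \sum_(j < n) F j x).
Proof.
move=> mF; elim: n => [|n IH].
  by under eq_fun do rewrite big_ord0; exact: cmeasurable_cst.
by under eq_fun do rewrite big_ord_recr; exact: cmeasurableD.
Qed.

(** * Quadrature for equicontinuous families *)

Section EquicontinuousQuadrature.
Context {R : realType} {d : measure_display} {X : measurableType d}.
Variables (nb : X -> set (set X)) (mu : {measure set X -> \bar R}) (U : set X).
Hypotheses (net : countable_net nb) (mU : measurable U).
Variables (w : X -> R[i]) (B G : X -> R) (L : set (X -> R[i])).
Hypotheses (mw : cmeasurable w) (mwL : forall l, L l -> cmeasurable (fun p => w p * l p)).
Hypotheses (w0 : forall p, ~ U p -> w p = 0) (B0 : forall p, 0 <= B p).
(** With [1 + B] in place of [B], one integrable function dominates both [w], whose cell masses are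
    the weights, and the products [w * l]. *)
Hypotheses (iG : mu.-integrable setT (EFin \o G))
  (wG : forall p, normc (w p) * (1 + B p) <= G p).
Hypothesis LB : forall l p, L l -> U p -> normc (l p) <= B p.
Hypothesis Lcont : forall p (e : R), U p -> 0 < e ->
  nb p [set p' | U p' -> forall l, L l -> normc (l p' - l p) <= e].

Let G0 p : 0 <= G p.
Proof. by rewrite (le_trans _ (wG p))// mulr_ge0 ?normc_ge0// addr_ge0. Qed.

Let wleG p : normc (w p) <= G p.
Proof. by rewrite (le_trans _ (wG p))// ler_peMr ?normc_ge0// lerDl. Qed.

Let wBleG p : normc (w p) * B p <= G p.
Proof. by rewrite (le_trans _ (wG p))// ler_wpM2l ?normc_ge0// lerDr. Qed.

(** Each point of [U] lies in some [A j], so the indicators are eventually 0 pointwise, and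
    dominated convergence applies with bound [G]. *)
Lemma Rintegral_tail (A : nat -> set X) : (forall n, measurable (A n)) ->
  U `<=` \bigcup_n A n ->
  Rintegral mu setT (fun p => \1_(U `\` \bigcup_(j in `I_n) A j) p * G p)
    @[n --> \oo] --> (0 : R).
Proof.
move=> mA UA; set T := fun n => U `\` \bigcup_(j in `I_n) A j.
have mT n : measurable (T n) by apply: measurableD => //; exact: bigcup_measurable.
have mG : measurable_fun setT G by have /measurable_int/measurable_EFinP := iG.
have := @dominated_cvg _ _ _ mu setT measurableT
  (fun n p => (\1_(T n) p * G p)%:E) (cst 0%E) (EFin \o G).
rewrite integral0 => H; apply/fine_cvg; apply: H => //.
- by move=> n; apply/measurable_EFinP; apply: measurable_funM => //; exact: measurable_indic.
- move=> p _; apply: cvg_near_cst.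
  have [Up|nUp] := pselect (U p).
  + have [N _ AN] := UA p Up.
    near=> n; have Nn : (N < n)%N by near: n; exists N.+1.
    rewrite indicE memNset ?mul0r// => -[_]; apply; exists N => //.
  + by near=> n; rewrite indicE memNset ?mul0r// => -[].
- move=> n p _; rewrite /= lee_fin normrM (ger0_norm (G0 p)) ler_piMl//.
  by rewrite indicE; case: (_ \in _); rewrite ?normr1 ?normr0.
Unshelve. all: by end_near. Qed.

(* [U] is covered by countably many measurable cells on which every [l] in [L]
   oscillates by at most [e]; finitely many of them carry all but a small part
   of the mass of [G], and [c j] is the [w]-mass of the [j]-th cell. *)
Lemma equicontinuous_quadrature (eta : R) : 0 < eta -> U !=set0 ->
  exists (n : nat) (c : nat -> R[i]) (q : nat -> X),
    (forall j, U (q j)) /\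
    forall l, L l ->
      normc (Cintegral mu setT (fun p => w p * l p) -
             \sum_(j < n) c j * l (q j)) <= eta.
Proof.
move=> eta0 [p0 Up0]; have [Bn [mBn nBn]] := net.
pose tot := Rintegral mu setT G.
have tot0 : 0 <= tot by apply: Rintegral_ge0.
(* The final bound is twice [e * tot] plus the tail, by [normc_Cintegral_le]. This choice gives the
   first term [eta / 2], and a tail below [eta / 4] gives the rest; [tot + 1] avoids dividing by
   0. *)
pose e : R := eta / (4 * (tot + 1)).
have e0 : 0 < e by rewrite divr_gt0// mulr_gt0// ltr_wpDl.
have eI : 2 * (e * tot) <= eta / 2.
  have -> : 2 * (e * tot) = eta / 2 * (tot / (tot + 1)).
    by rewrite /e; field; rewrite gt_eqF// ltr_wpDl.
  apply: ler_piMr; first by rewrite ltW// divr_gt0.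
  by rewrite ler_pdivrMr ?ltr_wpDl// mul1r lerDl.
(* One node must serve every [l] at once; it need not lie in the basic set itself. Basic sets
   without such a node are replaced by the empty set below, and [p0] is a filler for their nodes. *)
pose good n q := U q /\
  forall p, Bn n p -> U p -> forall l, L l -> normc (l p - l q) <= e.
have [q qP] : {q : nat -> X & forall n, U (q n) /\ ((exists q', good n q') -> good n (q n))}.
  apply: (@choice _ _ (fun n q => U q /\ ((exists q', good n q') -> good n q))) => n.
  have [[q' gq]|ng] := pselect (exists q', good n q'); last by exists p0.
  by exists q'; split => //; case: gq.
pose A n := if `[< exists q', good n q' >] then Bn n `&` U else set0.
have mA n : measurable (A n) by rewrite /A; case: ifP => // _; exact: measurableI.
have UA : U `<=` \bigcup_n A n.
  move=> p Up; have [n Bp BnU] := nBn _ _ (Lcont Up e0).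
  exists n => //; rewrite /A; case: asboolP => // ng; exfalso; apply: ng.
  by exists p; split=> // p' /BnU H Up'; exact: H.
(* Disjoint cells, so that at each point at most one term of the finite sum survives. *)
pose E := seqDU A.
have mE n : measurable (E n) by apply: measurableD => //; exact: bigsetU_measurable.
have tE : trivIset setT E := trivIset_seqDU A.
have /cvgrPdist_lt/(_ (eta / 4)) := Rintegral_tail mA UA.
rewrite divr_gt0// => /(_ isT)[n _ /(_ n (leqnn n))] /=.
rewrite sub0r normrN => tail.
exists n, (fun j => Cintegral mu setT (fun p => (\1_(E j) p)%:C%C * w p)), q.
split=> [j|l Ll]; first by have [] := qP j.
pose F j p := l (q j) * ((\1_(E j) p)%:C%C * w p).
have m1w j : cmeasurable (fun p => (\1_(E j) p)%:C%C * w p).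
  by apply: cmeasurableM => //; exact: cmeasurable_indic.
have i1w j : Cintegrable mu setT (fun p => (\1_(E j) p)%:C%C * w p).
  apply: (cintegrable_le (m1w j) iG) => p.
  rewrite normc_prod normc_real (le_trans _ (wleG p))// ler_piMl ?normc_ge0//.
  by rewrite indicE; case: (_ \in _); rewrite ?normr1 ?normr0.
have iF j : Cintegrable mu setT (F j) by exact: CintegrableZ.
have iwl : Cintegrable mu setT (fun p => w p * l p).
  apply: (cintegrable_le (mwL Ll) iG) => p; have [Up|nUp] := pselect (U p).
    by rewrite normc_prod (le_trans _ (wBleG p))// ler_wpM2l ?normc_ge0// LB.
  by rewrite w0// mul0r normc_zero.
have -> : Cintegral mu setT (fun p => w p * l p) - \sum_(j < n)
    Cintegral mu setT (fun p => (\1_(E j) p)%:C%C * w p) * l (q j) =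
    Cintegral mu setT (fun p => w p * l p + (- 1) * \sum_(j < n) F j p).
  rewrite CintegralD//; last by apply: CintegrableZ; exact: Cintegrable_sum.
  rewrite CintegralZ; last exact: Cintegrable_sum.
  rewrite Cintegral_sum// mulN1r; congr (_ - _); apply: eq_bigr => j _.
  by rewrite CintegralZ// mulrC.
set T := U `\` \bigcup_(j in `I_n) A j.
have mT : measurable T by apply: measurableD => //; exact: bigcup_measurable.
have mG : measurable_fun setT G by have /measurable_int/measurable_EFinP := iG.
have i1 : mu.-integrable setT (EFin \o (fun p => e * G p)).
  by rewrite /comp; under eq_fun do rewrite EFinM; exact: integrableZl.
have i2 : mu.-integrable setT (EFin \o (fun p => \1_T p * G p)).
  apply: (le_integrable measurableT _ _ iG).
    by apply/measurable_EFinP; apply: measurable_funM => //; exact: measurable_indic.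
  move=> p _; rewrite lee_fin normrM ler_piMl//.
  by rewrite indicE; case: (_ \in _); rewrite ?normr1 ?normr0.
(* On a cell [j < n] the integrand is [w p * (l p - l (q j))], controlled by the oscillation [e]. On
   [T] the sum vanishes and [w * l] alone is at most [G]. *)
have bound p : normc (w p * l p + (- 1) * \sum_(j < n) F j p) <= e * G p + \1_T p * G p.
  have r1 : 0 <= e * G p by rewrite mulr_ge0// ltW.
  have r2 : 0 <= \1_T p * G p by rewrite mulr_ge0// indicE.
  have [Up|nUp] := pselect (U p); last first.
    rewrite w0// mul0r big1 ?mulr0 ?addr0 ?normc_zero ?addr_ge0//.
    by move=> j _; rewrite /F w0// !mulr0.
  have [[j0 jn Aj]|nA] := pselect ((\bigcup_(j in `I_n) A j) p); last first.
    rewrite big1 => [|j _].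
      rewrite mulr0 addr0 normc_prod (@le_trans _ _ (G p))//.
        by rewrite (le_trans _ (wBleG p))// ler_wpM2l ?normc_ge0// LB.
      by rewrite indicE mem_set ?mul1r ?lerDr.
    rewrite /F indicE memNset ?mul0r ?mulr0// => -[Aj _]; apply: nA.
    by exists j => //=; exact: ltn_ord.
  have [j jn' Ej] : exists2 j, (j < n)%N & E j p.
    have : (\bigcup_(j in `I_n) E j) p.
      by rewrite bigcup_mkord -bigsetU_seqDU -bigcup_mkord; exists j0.
    by move=> [j jn' Ej]; exists j.
  rewrite (bigD1 (Ordinal jn'))//= big1 => [|k kj]; last first.
    rewrite /F indicE memNset ?mul0r ?mulr0// => Ek.
    move: kj; rewrite -val_eqE/= => /eqP; apply.
    by apply: (tE k j I I); exists p.
  have [Aj' _] := Ej.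
  have [_ Qj] := qP j.
  move: Aj'; rewrite /A; case: asboolP => // gj [Bp _].
  have [Uq Hq] := Qj gj.
  rewrite addr0 /F indicE mem_set// mul1r mulN1r (mulrC (l _)) -mulrBr normc_prod.
  rewrite (@le_trans _ _ (e * G p)) ?lerDl// mulrC ler_pM ?normc_ge0//.
  exact: Hq.
have mdiff : cmeasurable (fun p => w p * l p + (- 1) * \sum_(j < n) F j p).
  apply: cmeasurableD; first exact: mwL.
  apply: cmeasurableM; first exact: cmeasurable_cst.
  apply: cmeasurable_sum => j.
  by apply: cmeasurableM; [exact: cmeasurable_cst|exact: m1w].
have i12 : mu.-integrable setT (EFin \o (fun p => e * G p + \1_T p * G p)).
  by rewrite /comp; under eq_fun do rewrite EFinD; exact: integrableD.
rewrite (le_trans (normc_Cintegral_le mdiff i12 bound))// RintegralD// RintegralZl//.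
have := ler_norm (Rintegral mu setT (fun p => \1_T p * G p)).
rewrite -/tot; lra.
Qed.

End EquicontinuousQuadrature.

(** * The Lizorkin space *)

Section SchwartzCriterion.
Context {R : realType}.
Local Notation P2 := (R * R)%type.
Local Notation E1 := (Defs.e1 : R * R).
Local Notation E2 := (Defs.e2 : R * R).
Implicit Types (f g : P2 -> R[i]) (x : P2).

(* A coinductive criterion: [S] is closed under partial derivatives. *)
Lemma schwartz2_criterion (S : (P2 -> R[i]) -> Prop) :
  (forall g, S g -> forall x, ccont g x) ->
  (forall g, S g -> forall k, exists C : R,
    forall x, size2 x ^+ k * normc (g x) <= C) ->
  (forall g v, S g -> v \in [:: E1; E2] ->
    exists2 g', S g' & forall x, is_cderive x v g (g' x)) ->
  forall f, S f -> schwartz2 f.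
Proof.
move=> Sc Sb Sd f Sf.
have Sw us : word us -> S (derivsC us f).
  elim: us => [//|v us IH /word_consP[vE /IH Su]] /=.
  have [g' Sg' dg'] := Sd _ _ Su vE.
  rewrite (_ : Defs.derivC _ _ = g')//.
  by apply/funext => x; exact: is_cderive_derivC.
split=> [us wus x _ g|k m1 m2].
  have Sg : S g := Sw us wus; have [c1 c2] := Sc _ Sg x.
  split; [move=> v vE|move=> v vE|exact: c1|exact: c2].
  - by have [g' _ dg'] := Sd _ _ Sg vE; have [[]] := dg' x.
  - by have [g' _ dg'] := Sd _ _ Sg vE; have [_ []] := dg' x.
have [C HC] := Sb _ (Sw _ (@word_nseq R m1 m2)) k.
apply: (@le_lt_trans _ _ C%:E); last exact: ltry.
apply/seminorm2_le => x; rewrite (le_trans _ (HC x))// ler_wpM2r ?normc_ge0//.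
by rewrite lerXn2r ?nnegrE ?jap2_ge0 ?jap2_le_size2// ltW// size2_gt0.
Qed.

Lemma schwartz2_lincomb (c : R[i]) f g : schwartz2 f -> schwartz2 g ->
  schwartz2 (fun x => c * f x + g x).
Proof.
move=> fS gS.
apply: (@schwartz2_criterion (fun h => exists2 us, word us &
  h = (fun x => c * derivsC us f x + derivsC us g x))).
- move=> _ [us wus ->] x; apply: ccontD; last exact: (schwartz2_ccont gS).
  by apply: ccontM; [exact: ccont_cst|exact: (schwartz2_ccont fS)].
- move=> _ [us wus ->] k.
  have [C1 _ H1] := schwartz2_decay fS k wus; have [C2 _ H2] := schwartz2_decay gS k wus.
  exists (normc c * C1 + C2) => x.
  have s0 : 0 <= size2 x ^+ k by rewrite exprn_ge0// ltW// size2_gt0.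
  rewrite (le_trans (ler_wpM2l s0 (normc_triangle _ _)))// mulrDr lerD//.
  by rewrite normc_prod mulrCA ler_wpM2l ?normc_ge0.
- move=> _ v [us wus ->] vE.
  exists (fun x => c * derivsC (v :: us) f x + derivsC (v :: us) g x).
    by exists (v :: us) => //; exact: word_cons.
  move=> x; apply: is_cderiveD; last exact: (schwartz2_is_cderive gS).
  by apply: is_cderiveZ; exact: (schwartz2_is_cderive fS).
- by exists [::].
Qed.

End SchwartzCriterion.

(** * Vanishing moments and their behaviour under affine maps *)

Section Moments.
Context {R : realType}.
Local Notation P2 := (R * R)%type.
Local Notation M2 := (measurableTypeR R * measurableTypeR R)%type.
Local Notation leb := (@lebesgue_measure R).
Implicit Types (f g : P2 -> R[i]) (x : P2).

Definition plane_weight x : R := (1 + x.1 ^+ 2)^-1 * (1 + x.2 ^+ 2)^-1.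

Lemma integrable_plane_weight :
  leb2.-integrable (setT : set M2) (EFin \o plane_weight).
Proof.
apply: (integrable_prod (m1 := leb) (m2 := leb) (f := fun t : R => (1 + t ^+ 2)^-1)
  (g := fun t : R => (1 + t ^+ 2)^-1)).
- by move=> t; rewrite invr_ge0 addr_ge0 ?sqr_ge0.
- by move=> t; rewrite invr_ge0 addr_ge0 ?sqr_ge0.
- exact: integrable_oneDsqrV.
- exact: integrable_oneDsqrV.
Qed.

Lemma plane_weight_ge0 x : 0 <= plane_weight x.
Proof. by rewrite mulr_ge0// invr_ge0 addr_ge0 ?sqr_ge0. Qed.

(** Integrability over the plane is bought with four powers of [size2], two per coordinate; this is
    the 4 in the decay order [m1 + m2 + 4] used for moments. *)
Lemma plane_weight_size2 x : 1 <= plane_weight x * size2 x ^+ 4.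
Proof.
rewrite /plane_weight -invfM mulrC ler_pdivlMr ?mul1r; last first.
  by rewrite mulr_gt0// ltr_pwDl ?sqr_ge0.
have B1 : 1 + x.1 ^+ 2 <= size2 x ^+ 2.
  rewrite /size2 -(real_normK (num_real x.1)).
  by have := normr_ge0 x.1; have := normr_ge0 x.2; rewrite !expr2; nra.
have B2 : 1 + x.2 ^+ 2 <= size2 x ^+ 2.
  rewrite /size2 -(real_normK (num_real x.2)).
  by have := normr_ge0 x.1; have := normr_ge0 x.2; rewrite !expr2; nra.
rewrite (exprM _ 2 2) [leRHS]expr2.
by apply: ler_pM => //; rewrite addr_ge0 ?sqr_ge0.
Qed.

Definition monomial (m1 m2 : nat) x : R[i] := (x.1 ^+ m1 * x.2 ^+ m2)%:C%C.

Lemma normc_monomial m1 m2 x : normc (monomial m1 m2 x) <= size2 x ^+ (m1 + m2).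
Proof.
rewrite normc_real normrM !normrX exprD ler_pM ?exprn_ge0//.
- rewrite lerXn2r ?nnegrE// ?(ltW (size2_gt0 _))// /size2.
  by have := normr_ge0 x.2; lra.
- rewrite lerXn2r ?nnegrE// ?(ltW (size2_gt0 _))// /size2.
  by have := normr_ge0 x.1; lra.
Qed.

Lemma monomial_bound m1 m2 x (z : R[i]) (C : R) :
  size2 x ^+ (m1 + m2 + 4) * normc z <= C ->
  normc (monomial m1 m2 x * z) <= C * plane_weight x.
Proof.
move=> zC; rewrite normc_prod.
rewrite (@le_trans _ _ (size2 x ^+ (m1 + m2) * normc z))//.
  by rewrite ler_wpM2r ?normc_ge0// normc_monomial.
rewrite (@le_trans _ _ (size2 x ^+ (m1 + m2 + 4) * normc z * plane_weight x))//.
  rewrite (exprD _ (m1 + m2)%N 4) [leRHS](_ : _ =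
    size2 x ^+ (m1 + m2) * normc z * (plane_weight x * size2 x ^+ 4)); last by ring.
  apply: ler_peMr; last exact: plane_weight_size2.
  by rewrite mulr_ge0 ?normc_ge0// exprn_ge0// ltW// size2_gt0.
by rewrite ler_wpM2r// plane_weight_ge0.
Qed.

Lemma ccont_cmeasurable2 f : (forall x, ccont f x) -> cmeasurable (f : M2 -> R[i]).
Proof. by move=> cf; split; apply: continuous_measurable2 => x; case: (cf x). Qed.

Lemma cmeasurable_monomial m1 m2 : cmeasurable (monomial m1 m2 : M2 -> R[i]).
Proof.
split => /=; last exact: measurable_cst.
by apply: measurable_funM; apply: measurable_funX.
Qed.

(** Integrability is recorded along with the value, because the vanishing of the total [Cintegral]
    alone would not pass to linear combinations. *)
Definition moment_free f := forall m1 m2,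
  Cintegrable leb2 setT (fun x => monomial m1 m2 x * f x) /\
  Cintegral leb2 setT (fun x => monomial m1 m2 x * f x) = 0.

Lemma schwartz2_moment_integrable f m1 m2 : schwartz2 f ->
  Cintegrable leb2 setT (fun x => monomial m1 m2 x * f x).
Proof.
move=> fS; have [C C0 HC] := schwartz2_decay fS (m1 + m2 + 4) word_nil.
apply: (@cintegrable_le _ M2 R leb2 _ (fun x => C * plane_weight x)).
- apply: cmeasurableM; first exact: cmeasurable_monomial.
  by apply: ccont_cmeasurable2 => x; exact: (schwartz2_ccont fS x word_nil).
- rewrite /comp; under eq_fun do rewrite EFinM.
  by apply: integrableZl => //; exact: integrable_plane_weight.
- by move=> x; apply: monomial_bound; exact: HC.
Qed.

Lemma lizorkin2P f : lizorkin2 f <-> schwartz2 f /\ moment_free f.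
Proof.
split=> [[fS f0]|[fS f0]]; split => //.
  by move=> m1 m2; split; [exact: schwartz2_moment_integrable|exact: f0].
by move=> m1 m2; have [] := f0 m1 m2.
Qed.

Lemma moment_free_lincomb (c : R[i]) f g : moment_free f -> moment_free g ->
  moment_free (fun x => c * f x + g x).
Proof.
move=> f0 g0 m1 m2; have [fi fz] := f0 m1 m2; have [gi gz] := g0 m1 m2.
have E : (fun x => monomial m1 m2 x * (c * f x + g x)) =
    (fun x => c * (monomial m1 m2 x * f x) + monomial m1 m2 x * g x).
  by apply/funext => x; rewrite mulrDr mulrCA.
split; rewrite E.
  by apply: CintegrableD => //; exact: CintegrableZ.
by rewrite CintegralD ?CintegralZ ?fz ?gz ?mulr0 ?addr0//; exact: CintegrableZ.
Qed.

Lemma lizorkin2_lincomb (c : R[i]) f g : lizorkin2 f -> lizorkin2 g ->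
  lizorkin2 (fun x => c * f x + g x).
Proof.
move=> /lizorkin2P[f1 f2] /lizorkin2P[g1 g2]; apply/lizorkin2P; split.
  exact: schwartz2_lincomb.
exact: moment_free_lincomb.
Qed.

Lemma lizorkin2_0 : lizorkin2 (fun=> 0 : R[i]).
Proof.
split; last first.
  by move=> m1 m2; under eq_fun do rewrite mulr0; exact: Cintegral0.
apply: (@schwartz2_criterion _ (fun h => h = fun=> 0)) => //.
- by move=> _ -> x; exact: ccont_cst.
- by move=> _ -> k; exists 0 => x; rewrite normc_zero mulr0.
- by move=> _ v -> _; exists (fun=> 0) => // x; exact: is_cderive_cst.
Qed.

(** Every moment of the product is a combination of three moments of [f]. Iterated, this handles the
    powers of affine functions into which a change of variables turns monomials. *)
Lemma moment_free_affine (c0 c1 c2 : R) f : moment_free f ->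
  moment_free (fun x => (c0 + c1 * x.1 + c2 * x.2)%:C%C * f x).
Proof.
move=> f0 m1 m2.
have [i0 z0] := f0 m1 m2; have [i1 z1] := f0 m1.+1 m2; have [i2 z2] := f0 m1 m2.+1.
have E : (fun x => monomial m1 m2 x * ((c0 + c1 * x.1 + c2 * x.2)%:C%C * f x)) =
    (fun x => c0%:C%C * (monomial m1 m2 x * f x) +
      (c1%:C%C * (monomial m1.+1 m2 x * f x) + c2%:C%C * (monomial m1 m2.+1 x * f x))).
  apply/funext => x; rewrite /monomial !exprS.
  by apply: eq_ReIm; rewrite ?cReD ?cImD ?cReM ?cImM/= ?cReM ?cImM/=; ring.
split; rewrite E.
  by apply: CintegrableD; [|apply: CintegrableD]; exact: CintegrableZ.
rewrite CintegralD; [|exact: CintegrableZ|by apply: CintegrableD; exact: CintegrableZ].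
rewrite CintegralD; [|exact: CintegrableZ|exact: CintegrableZ].
by rewrite !CintegralZ// z0 z1 z2 !mulr0 !addr0.
Qed.

Lemma moment_free_affine_pow (c0 c1 c2 : R) f n : moment_free f ->
  moment_free (fun x => ((c0 + c1 * x.1 + c2 * x.2) ^+ n)%:C%C * f x).
Proof.
move=> f0; elim: n => [|n IH].
  by rewrite (_ : (fun x => _) = f)//; apply/funext => x; rewrite expr0 mul1r.
rewrite (_ : (fun x => _) = (fun x => (c0 + c1 * x.1 + c2 * x.2)%:C%C *
    (((c0 + c1 * x.1 + c2 * x.2) ^+ n)%:C%C * f x))); first exact: moment_free_affine.
by apply/funext => x; rewrite exprS rmorphM mulrA.
Qed.

Lemma Cintegral_triangular (al ga de : R) (be : R -> R) (F : M2 -> R[i]) :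
  al != 0 -> ga != 0 -> measurable_fun (setT : set (measurableTypeR R)) be ->
  Cintegrable leb2 setT F ->
  Cintegral leb2 setT (fun x : M2 => F (al * x.1 + be x.2, ga * x.2 + de)) =
  (`|al|^-1 * `|ga|^-1)%:C%C * Cintegral leb2 setT F.
Proof.
move=> al0 ga0 mbe [F1 F2]; apply: eq_ReIm; rewrite ?cReM ?cImM /= mul0r ?subr0 ?addr0.
- exact: (Rintegral_triangular de al0 ga0 mbe F1).
- exact: (Rintegral_triangular de al0 ga0 mbe F2).
Qed.

Lemma Cintegral_conj (F : M2 -> R[i]) : Cintegrable leb2 setT F ->
  Cintegral leb2 setT (fun x => conjc (F x)) = conjc (Cintegral leb2 setT F).
Proof.
move=> [F1 F2]; apply: eq_ReIm; rewrite ?cRe_conj ?cIm_conj/=.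
  by under eq_Rintegral do rewrite cRe_conj.
under eq_Rintegral do rewrite cIm_conj -mulN1r.
by rewrite RintegralZl// mulN1r.
Qed.

(** With [y = shear_point p x] as new variable, both coordinates of [x] are affine in [y], so up to
    the Jacobian the integral is that of [psi] against two powers of affine functions. *)
Lemma moment_shear_point (psi : P2 -> R[i]) (p : R * R * R * R) m1 m2 :
  shearS p -> moment_free psi ->
  Cintegral leb2 setT (fun x => monomial m1 m2 x * psi (shear_point p x)) = 0.
Proof.
move=> Sp psi0; have a0 : p.2 != 0 := Sp; have r0 := lt0r_neq0 (rho_gt0 a0).
pose X1 (y : M2) := p.1.1.1 + p.2 * y.1 + (- (p.1.2 * (p.2 * rho p.2))) * y.2.
pose X2 (y : M2) := p.1.1.2 + 0 * y.1 + (p.2 * rho p.2) * y.2.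
have := moment_free_affine_pow p.1.1.1 p.2 (- (p.1.2 * (p.2 * rho p.2))) m1
  (moment_free_affine_pow p.1.1.2 0 (p.2 * rho p.2) m2 psi0).
(* The zeroth moment suffices: the two affine powers already carry the monomial. *)
move=> /(_ 0%N 0%N)[iF F0].
have al0 : p.2^-1 != 0 by rewrite invr_eq0.
have ga0 : (p.2 * rho p.2)^-1 != 0 by rewrite invr_eq0 mulf_neq0.
have mbe : measurable_fun (setT : set (measurableTypeR R))
    (fun t : R => (- p.1.1.1 + p.1.2 * (t - p.1.1.2)) / p.2).
  apply: measurable_funM => //; apply: measurable_funD => //.
  by apply: measurable_funM => //; apply: measurable_funB.
have := Cintegral_triangular (- (p.1.1.2 / (p.2 * rho p.2))) al0 ga0 mbe iF.
rewrite F0 mulr0 => <-.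
congr (Cintegral _ _ _); apply/funext => x.
have -> : (p.2^-1 * x.1 + (- p.1.1.1 + p.1.2 * (x.2 - p.1.1.2)) / p.2,
    (p.2 * rho p.2)^-1 * x.2 - p.1.1.2 / (p.2 * rho p.2)) = shear_point p x.
  by rewrite /shear_point; congr pair; field; rewrite ?a0 ?r0.
rewrite /monomial !expr0 mulr1 mul1r mulrA; congr (_ * _).
rewrite -rmorphM/=; congr ((_ ^+ m1 * _ ^+ m2)%:C%C).
- by field; rewrite ?a0 ?r0.
- by field; rewrite ?a0 ?r0.
Qed.

End Moments.

(** * The synthesis operator *)

Section DifferentiationUnderIntegral.
Context {R : realType} {V : normedModType R}.
Context {d : measure_display} {Y : measurableType d} {mu : {measure set Y -> \bar R}}.

(** On the line [t |-> t *: v + x] this is the one-variable theorem at [t = 0] on the interval from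
    -1 to 1; the bound [G] does not depend on the point of the line. *)
Lemma is_derive_Rintegral (H H' : Y -> V -> R) (G : Y -> R) (v x : V) :
  (forall p y, is_derive y v (H p : V -> R^o) (H' p y)) ->
  (forall y, mu.-integrable setT (EFin \o H ^~ y)) ->
  mu.-integrable setT (EFin \o G) ->
  (forall p y, `|H' p y| <= G p) ->
  is_derive x v (fun y => Rintegral mu setT (H ^~ y) : R^o)
    (Rintegral mu setT (H' ^~ x)).
Proof.
move=> dH iH iG H'G.
pose f (t : R) p := H p (t *: v + x).
have df (t : R) p : is_derive t 1 (f ^~ p) (H' p (t *: v + x)).
  have [D E] := dH p (t *: v + x).
  by have := is_derive_line D; rewrite E.
have G0 p : 0 <= G p by rewrite (le_trans _ (H'G p x)).
have I0 : `](-1), 1[%classic (0 : R) by rewrite /= in_itv/=; apply/andP; split; lra.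
have d1 (t : R) p : partial1of2 f t p = H' p (t *: v + x).
  by rewrite partial1of2E; have [_ ->] := df t p.
have intf (t : R) : `](-1), 1[%classic t -> mu.-integrable setT (EFin \o f t) by move=> _; exact: iH.
have derf (t : R) p : `](-1), 1[%classic t -> setT p -> derivable (f ^~ p) t 1.
  by move=> _ _; have [] := df t p.
have Gub (t : R) p : `](-1), 1[%classic t -> setT p -> `|partial1of2 f t p| <= G p.
  by move=> _ _; rewrite d1.
have D := derivable_under_integral measurableT I0 intf derf G0 iG Gub.
have E := differentiation_under_integral measurableT I0 intf derf G0 iG Gub.
pose F y : R^o := Rintegral mu setT (H ^~ y).
have DF : derivable F x v by apply/derivable1P.
split=> //.
have DF' : derivable F (0 *: v + x) v by rewrite scale0r add0r.
have [_] := is_derive_line DF'; rewrite scale0r add0r => <-.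
rewrite -derive1E [LHS]E; apply: eq_Rintegral => p _.
by rewrite d1 scale0r add0r.
Qed.

End DifferentiationUnderIntegral.

Section ProductSigmaFinite.
Local Open Scope ereal_scope.
Context d1 d2 (T1 : measurableType d1) (T2 : measurableType d2) (R : realType).
Variables (m1 : {sigma_finite_measure set T1 -> \bar R}).
Variables (m2 : {sigma_finite_measure set T2 -> \bar R}).

Lemma sigma_finite_prod : sigma_finite setT (m1 \x m2).
Proof.
have [F FT Ffin] := sigma_finiteT m1; have [G GT Gfin] := sigma_finiteT m2.
exists (fun n => if (unpickle n : option (nat * nat)) is Some (j, k)
  then F j `*` G k else set0).
  apply/esym; rewrite -subTset => -[x y] _.
  have [j _ Fx] : (\bigcup_i F i) x by rewrite -FT.
  have [k _ Gy] : (\bigcup_i G i) y by rewrite -GT.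
  by exists (pickle (j, k)); rewrite //= pickleK.
move=> n; case: unpickle => [[j k]|]; last by rewrite measure0 ltry.
have [mF Fj] := Ffin j; have [mG Gk] := Gfin k.
split; first exact: measurableX.
by rewrite /= product_measure1E// lte_mul_pinfty// ge0_fin_numE.
Qed.

(* Packed by hand: the structure is not inferred for [m1 \x m2], and iterated
   applications of Fubini's theorem need it. *)
Definition product_sigma_finite : {sigma_finite_measure set (T1 * T2)%type -> \bar R} :=
  HB.pack (m1 \x m2)
    (Measure_isSigmaFinite.Build _ _ _ (m1 \x m2) sigma_finite_prod).

End ProductSigmaFinite.

(** * Synthesis integrals of general kernels *)

Section Synthesis.
Context {R : realType}.
Local Notation P4 := (R * R * R * R)%type.
Local Notation P2 := (R * R)%type.
Local Notation M2 := (measurableTypeR R * measurableTypeR R)%type.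
Local Notation M4 := (measurableTypeR R * measurableTypeR R *
    measurableTypeR R * measurableTypeR R)%type.
Local Notation E1 := (Defs.e1 : R * R).
Local Notation E2 := (Defs.e2 : R * R).
Local Notation leb := (@lebesgue_measure R).
Local Notation M3 := (measurableTypeR R * measurableTypeR R * measurableTypeR R)%type.
Let sleb2 : {sigma_finite_measure set M2 -> \bar R} := product_sigma_finite leb leb.
Let sleb3 : {sigma_finite_measure set M3 -> \bar R} := product_sigma_finite sleb2 leb.
Let sleb4 : {sigma_finite_measure set M4 -> \bar R} := product_sigma_finite sleb3 leb.
Variables (psi : P2 -> R[i]) (Phi : P4 -> R[i]).
Hypotheses (psiS : schwartz2 psi) (PhiS : schwartzS Phi).

(** The [w] of the overview, extended by 0 so that integrals run over the whole product space. *)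
Definition density (p : P4) : R[i] :=
  if p.2 == 0 then 0 else Phi p * (`|p.2| ^- 3)%:C%C.

Definition space_weight (p : P4) : R :=
  (1 + p.1.1.1 ^+ 2)^-1 * (1 + p.1.1.2 ^+ 2)^-1 * (1 + p.1.2 ^+ 2)^-1 *
  (1 + p.2 ^+ 2)^-1.

Lemma space_weight_ge0 p : 0 <= space_weight p.
Proof. by rewrite !mulr_ge0// invr_ge0 addr_ge0 ?sqr_ge0. Qed.

Lemma integrable_space_weight :
  leb4.-integrable (setT : set M4) (EFin \o space_weight).
Proof.
have g0 (t : R) : 0 <= (1 + t ^+ 2)^-1 by rewrite invr_ge0 addr_ge0 ?sqr_ge0.
have i2 := integrable_prod (m1 := leb) (m2 := leb) g0 g0
  integrable_oneDsqrV integrable_oneDsqrV.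
have h2 (z : M2) : 0 <= (1 + z.1 ^+ 2)^-1 * (1 + z.2 ^+ 2)^-1 by rewrite mulr_ge0.
have i3 := integrable_prod (m1 := sleb2) (m2 := leb) h2 g0 i2 integrable_oneDsqrV.
have h3 (z : M3) :
  0 <= (1 + z.1.1 ^+ 2)^-1 * (1 + z.1.2 ^+ 2)^-1 * (1 + z.2 ^+ 2)^-1 by rewrite !mulr_ge0.
exact: (integrable_prod (m1 := sleb3) (m2 := leb) h3 g0 i3 integrable_oneDsqrV).
Qed.

(** Two powers of [om] suffice for integrability, since [jap t ^+ 2] is [1 + t ^+ 2] and the square
    of [|a| + 1 / |a|] exceeds [1 + a ^+ 2]. *)
Lemma space_weight_om p : shearS p -> 1 <= space_weight p * om p ^+ 2.
Proof.
move=> Sp; rewrite /space_weight -!invfM mulrC ler_pdivlMr ?mul1r; last first.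
  by rewrite !mulr_gt0// ltr_pwDl ?sqr_ge0.
rewrite /om !exprMn !sqr_jap.
have pos (t : R) : 0 <= 1 + t ^+ 2 by rewrite addr_ge0 ?sqr_ge0.
apply: ler_wpM2l; first by rewrite !mulr_ge0.
have a0 : `|p.2| != 0 by rewrite normr_eq0.
rewrite sqrrD divff// -(real_normK (num_real p.2)).
have := sqr_ge0 `|p.2|^-1; lra.
Qed.

(** Passes from the factor in powers of [om] to the one in [seminormS]: the sum is at most twice the
    larger of [t] and its inverse. *)
Lemma tau_pow (t : R) k : 0 < t -> (t + t^-1) ^+ k <= 2 ^+ k * (t ^+ k + 1 / t ^+ k).
Proof.
move=> t0; rewrite div1r -exprVn.
have [h|h] := leP t t^-1.
- rewrite (@le_trans _ _ ((2 * t^-1) ^+ k))//.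
    rewrite lerXn2r ?nnegrE ?addr_ge0 ?mulr_ge0 ?invr_ge0 ?(ltW t0)//; lra.
  by rewrite exprMn ler_wpM2l ?exprn_ge0// lerDr exprn_ge0// ltW.
- rewrite (@le_trans _ _ ((2 * t) ^+ k))//.
    rewrite lerXn2r ?nnegrE ?addr_ge0 ?mulr_ge0 ?invr_ge0 ?(ltW t0)//; lra.
  by rewrite exprMn ler_wpM2l ?exprn_ge0// lerDl exprn_ge0// invr_ge0 ltW.
Qed.

Lemma schwartzS_decay k : exists2 C : R, 0 <= C &
  forall p, shearS p -> normc (Phi p) * om p ^+ k <= C.
Proof.
have [_ /(_ k k k k 0 0 0 0)%N] := PhiS.
move=> /lty_exists_fin[r Er].
exists (2 ^+ k * `|r|); first by rewrite mulr_ge0// exprn_ge0.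
move=> [[[b1 b2] s] a] Sp.
have : ((jap b1 ^+ k * jap b2 ^+ k * jap s ^+ k * (`|a| ^+ k + 1 / `|a| ^+ k) *
   normc (Phi (b1, b2, s, a)))%:E <= r%:E)%E.
  by apply: le_trans Er; apply: ereal_sup_ubound; exists (b1, b2, s, a).
rewrite lee_fin => H; rewrite /om !exprMn/=.
have a0 : 0 < `|a| by rewrite normr_gt0.
have := tau_pow k a0; set T := (_ + _) ^+ k => HT.
have J0 : 0 <= jap b1 ^+ k * jap b2 ^+ k * jap s ^+ k * normc (Phi (b1, b2, s, a)).
  by rewrite !mulr_ge0 ?normc_ge0// exprn_ge0// sqrtr_ge0.
rewrite (@le_trans _ _ (2 ^+ k * r))//; last first.
  by rewrite ler_wpM2l ?exprn_ge0// ler_norm.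
have := ler_wpM2l J0 HT.
have := ler_wpM2l (exprn_ge0 k (ler0n R 2)) H.
rewrite mulrA; lra.
Qed.

Lemma density_decay m : exists2 C : R, 0 <= C &
  forall p, normc (density p) * om p ^+ m <= C * space_weight p.
Proof.
(* Three powers of [om] absorb the factor [|a| ^- 3] and two produce [space_weight]. *)
have [C C0 HC] := schwartzS_decay (m + 3 + 2); exists C => // p.
rewrite /density; case: ifPn => [_|Sp].
  by rewrite normc_zero mul0r mulr_ge0// space_weight_ge0.
have W1 := om_ge1 Sp; have W0 : 0 <= om p by exact: le_trans W1.
have [_ _ _ _ ht] := om_factors Sp.
rewrite normc_prod normc_real ger0_norm ?invr_ge0 ?exprn_ge0//.
rewrite (@le_trans _ _ (normc (Phi p) * om p ^+ (m + 3)))//.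
  rewrite -mulrA ler_wpM2l ?normc_ge0// exprD mulrC ler_wpM2l ?exprn_ge0//.
  by rewrite -exprVn lerXn2r ?nnegrE ?invr_ge0// (le_trans _ ht)// lerDr.
rewrite (@le_trans _ _ (normc (Phi p) * om p ^+ (m + 3 + 2) * space_weight p))//.
  rewrite (exprD _ (m + 3)%N 2) [leRHS](_ : _ = normc (Phi p) * om p ^+ (m + 3) *
    (space_weight p * om p ^+ 2)); last by ring.
  apply: ler_peMr; last exact: space_weight_om.
  by rewrite mulr_ge0 ?normc_ge0// exprn_ge0.
by rewrite ler_wpM2r ?space_weight_ge0// HC.
Qed.

Lemma density_off p : ~ shearS p -> density p = 0.
Proof. by rewrite /density /shearS/=; case: eqP. Qed.

Lemma density_ccont p : shearS p -> ccont density p.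
Proof.
move=> Sp; apply: (@eq_near_ccont _ _ (fun q => Phi q * (`|q.2| ^- 3)%:C%C)).
  near=> q; have Sq : q.2 != 0 by near: q; exact: shearS_nbhs.
  by rewrite /density (negbTE Sq).
apply: ccontM.
  by have [smooth _] := PhiS; have [] := smooth [::] _ p Sp.
apply: (ccont_real (r := fun q : P4 => `|q.2| ^- 3)).
apply: cvgV; first by rewrite expf_neq0// normr_eq0.
by apply: (cvg_comp _ (fun u : R => u ^+ 3) (@norm_p2_cvg R p)); exact: exprn_continuous.
Unshelve. all: by end_near. Qed.

Lemma ccont_cmeasurable4 (f : M4 -> R[i]) : (forall p, shearS p -> ccont (f : P4 -> R[i]) p) ->
  (forall p, ~ shearS p -> f p = 0) -> cmeasurable f.
Proof.
move=> cf f0; split; apply: continuous_measurable4 => p Sp.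
- by case: (cf p Sp).
- by rewrite f0.
- by case: (cf p Sp).
- by rewrite f0.
Qed.

Lemma ccont_cmeasurable6 (f : M4 * M2 -> R[i]) :
  (forall z, shearS z.1 -> ccont (f : P4 * P2 -> R[i]) z) ->
  (forall z, ~ shearS z.1 -> f z = 0) -> cmeasurable f.
Proof.
move=> cf f0; split; apply: continuous_measurable6 => z Sz.
- by case: (cf z Sz).
- by rewrite f0.
- by case: (cf z Sz).
- by rewrite f0.
Qed.

Lemma cmeasurable_density : cmeasurable (density : M4 -> R[i]).
Proof. by apply: ccont_cmeasurable4; [exact: density_ccont|exact: density_off]. Qed.

Section Kernel.
Variable K : P4 -> P2 -> R[i].
Hypothesis sK : shear_kernel psi K.

Let dK_ccont (z : P4 * P2) : shearS z.1 ->
  ccont (fun y : P4 * P2 => density y.1 * K y.1 y.2) z.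
Proof.
move=> Sz; apply: ccontM; last exact: (shear_kernel_ccont psiS sK Sz).
by apply: (ccont_comp (f := density) (h := fst)); [exact: cvg_fst|exact: density_ccont].
Qed.

Lemma density_kernel_cmeasurable6 :
  cmeasurable (fun z : M4 * M2 => density z.1 * K z.1 z.2).
Proof.
apply: ccont_cmeasurable6 => [z Sz|z /density_off->]; last by rewrite mul0r.
exact: dK_ccont.
Qed.

Lemma density_kernel_cmeasurable x : cmeasurable (fun p : M4 => density p * K p x).
Proof.
apply: ccont_cmeasurable4 => [p Sp|p /density_off->]; last by rewrite mul0r.
apply: (ccont_comp (f := fun y : P4 * P2 => density y.1 * K y.1 y.2)
  (h := fun q => (q, x)) _ (@dK_ccont (p, x) Sp)).
exact: (cvg_pair (@cvg_id _ (nbhs p)) (cvg_cst x)).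
Qed.

(** The growth of the kernel in [om] is spent against the decay of the density. As the bound is
    uniform in [x], it is the dominating function for all later integrals. *)
Lemma density_kernel_bound k : exists2 C : R, 0 <= C &
  forall p x, size2 x ^+ k * normc (density p * K p x) <= C * space_weight p.
Proof.
have [C C0 [m HC]] := shear_kernel_decay psiS k sK.
have [D D0 HD] := density_decay m.
exists (C * D); first exact: mulr_ge0.
move=> p x; have [Sp|nSp] := pselect (shearS p); last first.
  rewrite density_off// mul0r normc_zero mulr0.
  by rewrite mulr_ge0 ?space_weight_ge0// mulr_ge0.
rewrite normc_prod mulrCA (@le_trans _ _ (normc (density p) * (C * om p ^+ m)))//.
  by rewrite ler_wpM2l ?normc_ge0// HC.
by rewrite mulrCA -mulrA ler_wpM2l// HD.
Qed.

Lemma density_kernel_integrable x :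
  Cintegrable leb4 setT (fun p : M4 => density p * K p x).
Proof.
have [C C0 HC] := density_kernel_bound 0.
apply: (@cintegrable_le _ M4 R leb4 _ (fun p => C * space_weight p)).
- exact: density_kernel_cmeasurable.
- rewrite /comp; under eq_fun do rewrite EFinM.
  by apply: integrableZl => //; exact: integrable_space_weight.
- by move=> p; have := HC p x; rewrite expr0 mul1r.
Qed.

Definition synthesis x : R[i] := Cintegral leb4 setT (fun p : M4 => density p * K p x).

Lemma synthesis_decay k : exists C : R, forall x, size2 x ^+ k * normc (synthesis x) <= C.
Proof.
have [C C0 HC] := density_kernel_bound k.
exists (2 * (C * Rintegral leb4 setT (space_weight : M4 -> R))) => x.
have s0 : 0 < size2 x ^+ k by rewrite exprn_gt0// size2_gt0.
have iw : leb4.-integrable setT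
    (EFin \o (fun p : M4 => C / size2 x ^+ k * space_weight p)).
  rewrite /comp; under eq_fun do rewrite EFinM.
  by apply: integrableZl => //; exact: integrable_space_weight.
have B p : normc (density p * K p x) <= C / size2 x ^+ k * space_weight p.
  by rewrite mulrAC ler_pdivlMr// mulrC HC.
have := normc_Cintegral_le (density_kernel_cmeasurable x) iw B.
rewrite RintegralZl//; last exact: integrable_space_weight.
rewrite -/(synthesis x) => H; rewrite mulrC -ler_pdivlMr// (le_trans H)//.
by rewrite -!mulrA ler_wpM2l// ler_wpM2l// mulrC.
Qed.

End Kernel.

Lemma synthesis_is_cderive K K' v x : shear_kernel psi K -> shear_kernel psi K' ->
  (forall p y, is_cderive y v (K p) (K' p y)) ->
  is_cderive x v (synthesis K) (synthesis K' x).
Proof.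
move=> sK sK' dK; have [C C0 HC] := density_kernel_bound sK' 0.
have iG : leb4.-integrable setT (EFin \o (fun p : M4 => C * space_weight p)).
  rewrite /comp; under eq_fun do rewrite EFinM.
  by apply: integrableZl => //; exact: integrable_space_weight.
have B p y : normc (density p * K' p y) <= C * space_weight p.
  by have := HC p y; rewrite expr0 mul1r.
have dwK p y := is_cderiveZ (density p) (dK p y).
split.
- apply: (is_derive_Rintegral (mu := leb4) (G := fun p : M4 => C * space_weight p)
    (H := fun p y => cRe (density p * K p y)) (H' := fun p y => cRe (density p * K' p y))) => //.
  + by move=> p y; have [] := dwK p y.
  + by move=> y; have [] := density_kernel_integrable sK y.
  + by move=> p y; rewrite (le_trans (cRe_le _)).
- apply: (is_derive_Rintegral (mu := leb4) (G := fun p : M4 => C * space_weight p)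
    (H := fun p y => cIm (density p * K p y)) (H' := fun p y => cIm (density p * K' p y))) => //.
  + by move=> p y; have [] := dwK p y.
  + by move=> y; have [] := density_kernel_integrable sK y.
  + by move=> p y; rewrite (le_trans (cIm_le _)).
Qed.

(* A function with bounded partial derivatives is continuous, so no dominated
   convergence in [x] is needed. *)
Lemma synthesis_ccont K x : shear_kernel psi K -> ccont (synthesis K) x.
Proof.
move=> sK; have [K1 [K2 [s1 s2 d1 d2]]] := shear_kernel_is_cderive psiS sK.
have D1 y := synthesis_is_cderive y sK s1 d1.
have D2 y := synthesis_is_cderive y sK s2 d2.
have [C1 H1] := synthesis_decay s1 0; have [C2 H2] := synthesis_decay s2 0.
have B1 y : normc (synthesis K1 y) <= `|C1| + `|C2|.
  by have := H1 y; rewrite expr0 mul1r; have := ler_norm C1; have := normr_ge0 C2; lra.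
have B2 y : normc (synthesis K2 y) <= `|C1| + `|C2|.
  by have := H2 y; rewrite expr0 mul1r; have := ler_norm C2; have := normr_ge0 C1; lra.
split.
- apply: (@bounded_partials_continuous R (fun y => cRe (synthesis K y)) x (`|C1| + `|C2|)) => y.
  + by have [[]] := D1 y.
  + by have [[]] := D2 y.
  + by have [[_ ->] _] := D1 y; rewrite (le_trans (cRe_le _)).
  + by have [[_ ->] _] := D2 y; rewrite (le_trans (cRe_le _)).
- apply: (@bounded_partials_continuous R (fun y => cIm (synthesis K y)) x (`|C1| + `|C2|)) => y.
  + by have [_ []] := D1 y.
  + by have [_ []] := D2 y.
  + by have [_ [_ ->]] := D1 y; rewrite (le_trans (cIm_le _)).
  + by have [_ [_ ->]] := D2 y; rewrite (le_trans (cIm_le _)).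
Qed.

(** A single [K'] serves both equations, so derivatives of the synthesis integral and of finite sums
    of kernels are compared through the same functions of [p]. *)
Lemma synthesis_derivsC K us : shear_kernel psi K -> word us ->
  exists2 K', shear_kernel psi K' &
    derivsC us (synthesis K) = synthesis K' /\ forall p, derivsC us (K p) = K' p.
Proof.
move=> sK; elim: us => [_|v us IH /word_consP[vE /IH[K' sK' [E1' E2']]]]; first by exists K.
have [K1 [K2 [s1 s2 d1 d2]]] := shear_kernel_is_cderive psiS sK'.
move: vE; rewrite !inE => /orP[|] /eqP->.
- exists K1 => //; split=> [|p]; apply/funext => x /=; rewrite ?E1' ?E2'.
    exact/is_cderive_derivC/synthesis_is_cderive.
  exact: is_cderive_derivC.
- exists K2 => //; split=> [|p]; apply/funext => x /=; rewrite ?E1' ?E2'.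
    exact/is_cderive_derivC/synthesis_is_cderive.
  exact: is_cderive_derivC.
Qed.

Lemma synthesis_schwartz2 K : shear_kernel psi K -> schwartz2 (synthesis K).
Proof.
move=> sK; apply: (@schwartz2_criterion _
  (fun g => exists2 K, shear_kernel psi K & g = synthesis K)); last by exists K.
- by move=> _ [K' sK' ->] x; exact: synthesis_ccont.
- by move=> _ [K' sK' ->] k; exact: synthesis_decay.
- move=> _ v [K' sK' ->] vE.
  have [K1 [K2 [s1 s2 d1 d2]]] := shear_kernel_is_cderive psiS sK'.
  move: vE; rewrite !inE => /orP[|] /eqP->.
  + by exists (synthesis K1); [exists K1|move=> x; exact: synthesis_is_cderive].
  + by exists (synthesis K2); [exists K2|move=> x; exact: synthesis_is_cderive].
Qed.

(** Fubini on the product of parameter space and plane moves the moment onto [K p], where it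
    vanishes for each [p] in [shearS]; elsewhere the density is 0. *)
Lemma synthesis_moment_free K : shear_kernel psi K ->
  (forall p, shearS p -> moment_free (K p)) -> moment_free (synthesis K).
Proof.
move=> sK K0 m1 m2; split.
  by apply: schwartz2_moment_integrable; exact: synthesis_schwartz2.
pose H (z : M4 * M2) := monomial m1 m2 z.2 * (density z.1 * K z.1 z.2).
have [C C0 HC] := density_kernel_bound sK (m1 + m2 + 4).
have mH : cmeasurable H.
  apply: cmeasurableM; last exact: density_kernel_cmeasurable6.
  have [r i] := @cmeasurable_monomial R m1 m2.
  by split; [exact: (measurableT_comp r measurable_snd)|
             exact: (measurableT_comp i measurable_snd)].
have iH : Cintegrable (sleb4 \x sleb2)%E setT H.
  apply: (@cintegrable_le _ _ R _ _
    (fun z : M4 * M2 => (C * space_weight z.1) * plane_weight z.2)) => //.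
    apply: (integrable_prod (m1 := sleb4) (m2 := sleb2)
      (f := fun p : M4 => C * space_weight p) (g := @plane_weight R)).
    - by move=> p; rewrite mulr_ge0// space_weight_ge0.
    - exact: plane_weight_ge0.
    - rewrite /comp; under eq_fun do rewrite EFinM.
      by apply: integrableZl => //; exact: integrable_space_weight.
    - exact: integrable_plane_weight.
  by move=> z; apply: monomial_bound; exact: HC.
transitivity (Cintegral (sleb4 \x sleb2)%E setT H).
  rewrite (Cfubini2 (m1 := sleb4) (m2 := sleb2) iH).
  congr (Cintegral _ _ _); apply/funext => x.
  by rewrite /synthesis -CintegralZ//; exact: density_kernel_integrable.
rewrite (Cfubini1 (m1 := sleb4) (m2 := sleb2) iH).
rewrite -(@Cintegral0 _ M4 R leb4); congr (Cintegral _ _ _); apply/funext => p.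
have [Sp|nSp] := pselect (shearS p); last first.
  rewrite /H/= density_off//; under eq_fun do rewrite mul0r mulr0.
  exact: Cintegral0.
have [i z] := K0 p Sp m1 m2.
have -> : (fun x : M2 => H (p, x)) = (fun x => density p * (monomial m1 m2 x * K p x)).
  by apply/funext => x; rewrite /H/= mulrCA.
by rewrite CintegralZ// z mulr0.
Qed.

End Synthesis.

Lemma conjc_eq0 {R : realType} (z : R[i]) : conjc z = 0 -> z = 0.
Proof. by case: z => a b [-> /eqP]; rewrite oppr_eq0 => /eqP ->. Qed.

(** * Conjugate shearlets as elements of the Lizorkin space *)

Section ShearletLizorkin.
Context {R : realType}.
Local Notation P4 := (R * R * R * R)%type.
Local Notation P2 := (R * R)%type.
Local Notation E1 := (Defs.e1 : R * R).
Local Notation E2 := (Defs.e2 : R * R).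

Lemma shear_kernel_schwartz2 (psi : P2 -> R[i]) K p : schwartz2 psi ->
  shear_kernel psi K -> shearS p -> schwartz2 (K p).
Proof.
move=> psiS sK Sp; apply: (@schwartz2_criterion _
  (fun g => exists2 K, shear_kernel psi K & g = K p)); last by exists K.
- move=> _ [K' sK' ->] x.
  apply: (ccont_comp (f := fun y : P4 * P2 => K' y.1 y.2) (h := fun y => (p, y))
    _ (@shear_kernel_ccont _ _ psiS _ (p, x) sK' Sp)).
  exact: (cvg_pair (cvg_cst p) (@cvg_id _ (nbhs x))).
- move=> _ [K' sK' ->] k; have [C _ [m HC]] := shear_kernel_decay psiS k sK'.
  by exists (C * om p ^+ m) => x; exact: HC.
- move=> _ v [K' sK' ->] vE.
  have [K1 [K2 [s1 s2 d1 d2]]] := shear_kernel_is_cderive psiS sK'.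
  move: vE; rewrite !inE => /orP[|] /eqP->.
  + by exists (K1 p); [exists K1|exact: d1].
  + by exists (K2 p); [exists K2|exact: d2].
Qed.

Lemma conj_shearlet_lizorkin2 (psi : P2 -> R[i]) p : lizorkin2 psi -> shearS p ->
  lizorkin2 (conj_shearlet psi p).
Proof.
move=> /lizorkin2P[psiS psi0] Sp.
have sK := shear_kernel_derivs psi word_nil.
have KS := shear_kernel_schwartz2 psiS sK Sp.
have K0 : lizorkin2 (fun x => conjc (psi (shear_point p x))).
  split=> // m1 m2.
  have iF := schwartz2_moment_integrable m1 m2 KS.
  have := Cintegral_conj iF.
  rewrite (_ : (fun x => conjc _) = fun x => monomial m1 m2 x * psi (shear_point p x)).
    by rewrite moment_shear_point// => /esym/conjc_eq0.
  by apply/funext => x; rewrite conjc_realM conjcK.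
have -> : conj_shearlet psi p = fun x => (`|p.2| `^ (- (3 / 4)))%:C%C *
    conjc (psi (shear_point p x)) + (fun=> 0) x.
  by apply/funext => x; rewrite addr0 conj_shearletE.
exact: lizorkin2_lincomb K0 lizorkin2_0.
Qed.

(* For large [x] both terms are small by decay of order [k + 1]; on the remaining
   compact box joint continuity is uniform. *)
Lemma shear_kernel_equicontinuous (psi : P2 -> R[i]) K k (p0 : P4) (e : R) :
  schwartz2 psi -> shear_kernel psi K -> shearS p0 -> 0 < e ->
  \forall p \near p0, forall x, size2 x ^+ k * normc (K p x - K p0 x) <= e.
Proof.
move=> psiS sK Sp0 e0.
have [C C0 [m HC]] := shear_kernel_decay psiS k.+1 sK.
pose M : R := C * (om p0 + 1) ^+ m.
have W1 := om_ge1 Sp0.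
have M0 : 0 <= M by rewrite mulr_ge0// exprn_ge0//; lra.
have om_near : \forall p \near p0, shearS p /\ om p <= om p0 + 1.
  apply: filterI; first exact: shearS_nbhs.
  have /cvgrPdist_le/(_ 1 ltr01) := om_continuous Sp0.
  by apply: filterS => p; rewrite distrC ler_norml => /andP[_]; lra.
have KM p : shearS p -> om p <= om p0 + 1 -> forall x,
    size2 x * (size2 x ^+ k * normc (K p x)) <= M.
  move=> Sp op x; rewrite mulrA -exprS (le_trans (HC p x Sp))// ler_wpM2l//.
  by rewrite lerXn2r ?nnegrE//; [rewrite (le_trans _ (om_ge1 Sp))|lra].
(* Outside the box [size2 x >= r], and the two terms together are at most [2 * M / size2 x], hence
   at most [e]. *)
pose r : R := 2 * M / e.
have r0 : 0 <= r by rewrite divr_ge0 ?(ltW e0)// mulr_ge0.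
pose box : set P2 := `[- r, r]%classic `*` `[- r, r]%classic.
have cbox : compact box by apply: compact_setX; exact: segment_compact.
have near_box : \forall p \near p0,
    box `<=` [set x | size2 x ^+ k * normc (K p x - K p0 x) <= e].
  (* Compactness as a tube lemma: neighbourhoods of the points [(p0, x)] combine into one
     neighbourhood of [p0] valid on the whole box. *)
  move/compact_near_coveringP : cbox => /(_ P4 (nbhs p0)
    (fun p x => size2 x ^+ k * normc (K p x - K p0 x) <= e)); apply => x _.
  have cK : ccont (fun z : P4 * P2 => K z.1 z.2 - K p0 z.2) (p0, x).
    have A := @shear_kernel_ccont _ _ psiS _ (p0, x) sK Sp0.
    have B : ccont (fun z : P4 * P2 => (- 1) * K p0 z.2) (p0, x).
      apply: ccontM; first exact: ccont_cst.
      apply: (ccont_comp (f := fun y : P4 * P2 => K y.1 y.2) (h := fun z => (p0, z.2)) _ A).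
      exact: (cvg_pair (cvg_cst p0) cvg_snd).
    have := ccontD A B; rewrite (_ : (fun y => _) = (fun z => K z.1 z.2 - K p0 z.2))//.
    by apply/funext => z; rewrite mulN1r.
  have := ccont_normc cK; rewrite subrr normc_zero => nK.
  have cs : size2 z.2 ^+ k @[z --> (p0, x)] --> size2 x ^+ k.
    have s : size2 (z : P4 * P2).2 @[z --> (p0, x)] --> size2 x.
      have x1 : z.2.1 @[z --> (p0, x)] --> x.1.
        by apply: (cvg_comp snd fst (cvg_snd : y.2 @[y --> (p0, x)] --> x)); exact: cvg_fst.
      have x2 : z.2.2 @[z --> (p0, x)] --> x.2.
        by apply: (cvg_comp snd snd (cvg_snd : y.2 @[y --> (p0, x)] --> x)); exact: cvg_snd.
      by apply: cvgD; [apply: cvgD; [exact: cvg_cst|exact: cvg_norm]|exact: cvg_norm].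
    by apply: (cvg_comp _ (fun u : R => u ^+ k) s); exact: exprn_continuous.
  have H : size2 z.2 ^+ k * normc (K z.1 z.2 - K p0 z.2) @[z --> (p0, x)] --> (0 : R).
    by rewrite -[X in _ --> X](mulr0 (size2 x ^+ k)); exact: cvgM.
  move/cvgrPdist_le : H => /(_ e e0)[[A B] /= [nA nB] AB].
  exists (B, A) => //= -[x' p] [/= Bx' Ap]; have := AB (p, x') (conj Ap Bx').
  by rewrite /= sub0r normrN; apply: le_trans; rewrite ler_norm.
near=> p => x.
have [Sp op] : shearS p /\ om p <= om p0 + 1 by near: p.
have [bx|nbx] := pselect (box x).
  by have : box `<=` [set x | size2 x ^+ k * normc (K p x - K p0 x) <= e];
    [near: p|apply].
have sx : r <= size2 x.
  rewrite leNgt; apply/negP => h; apply: nbx; move: h; rewrite /size2 => h.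
  have := normr_ge0 x.1; have := normr_ge0 x.2 => h1 h2.
  by split; rewrite /= in_itv/= -ler_norml; lra.
have s0 := size2_gt0 x; have sk : 0 <= size2 x ^+ k by rewrite exprn_ge0// ltW.
have A := KM p Sp op x.
have B : size2 x * (size2 x ^+ k * normc (K p0 x)) <= M by apply: KM => //; lra.
rewrite -(ler_pM2l s0) (@le_trans _ _ (M + M))//.
  rewrite (le_trans _ (lerD A B))// -!mulrDr ler_wpM2l ?(ltW s0)// ler_wpM2l//.
  by rewrite (le_trans (normc_triangle _ _))// normc_opp.
rewrite (@le_trans _ _ (r * e))//; last by rewrite ler_wpM2r// ltW.
rewrite /r divfK ?gt_eqF//; lra.
Unshelve. all: by end_near. Qed.

End ShearletLizorkin.

(** * Continuous functionals on the Lizorkin space *)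

Section Functional.
Context {R : realType}.
Local Notation P2 := (R * R)%type.
Local Notation E1 := (Defs.e1 : R * R).
Local Notation E2 := (Defs.e2 : R * R).
Implicit Types (g h : P2 -> R[i]).

Lemma derivsC_lincomb (c : R[i]) g h us : schwartz2 g -> schwartz2 h -> word us ->
  derivsC us (fun x => c * g x + h x) = fun x => c * derivsC us g x + derivsC us h x.
Proof.
move=> gS hS; elim: us => [//|v us IH /word_consP[vE wus]] /=.
rewrite (IH wus); apply/funext => x; apply: is_cderive_derivC.
apply: is_cderiveD; last exact: (schwartz2_is_cderive hS).
by apply: is_cderiveZ; exact: (schwartz2_is_cderive gS).
Qed.

Lemma derivsC_zero us : derivsC us (fun=> 0 : R[i]) = (fun=> 0) :> (P2 -> R[i]).
Proof.
elim: us => [//|v us IH] /=; rewrite IH; apply/funext => x.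
exact/is_cderive_derivC/is_cderive_cst.
Qed.

Variable f : (P2 -> R[i]) -> R[i].
Hypothesis fL : lizorkin_dual f.

Lemma lizorkin_dual_lincomb (c : R[i]) g h : lizorkin2 g -> lizorkin2 h ->
  f (fun x => c * g x + h x) = c * f g + f h.
Proof. by move=> gL hL; have [lin _] := fL; exact: lin. Qed.

Lemma lizorkin_dual0 : f (fun=> 0) = 0.
Proof.
have := lizorkin_dual_lincomb 1 (@lizorkin2_0 R) (@lizorkin2_0 R).
rewrite (_ : (fun x => _) = fun=> 0); last by apply/funext => x; rewrite mulr0 addr0.
by rewrite mul1r -{1}[f _]addr0 => /addrI.
Qed.

(** Continuity at 0 with tolerance 1, made homogeneous. Scaled by [del / (2 * eta)], [phi] has
    seminorms at most [del / 2], where the 2 supplies the strict inequality required; hence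
    [C = 2 / del]. *)
Lemma lizorkin_dual_bounded : exists N (C : R), 0 < C /\
  forall phi (eta : R), lizorkin2 phi -> 0 < eta ->
    (forall k m1 m2 x, (k <= N)%N -> (m1 <= N)%N -> (m2 <= N)%N ->
      jap2 x ^+ k * normc (derivsC (nseq m2 E2 ++ nseq m1 E1) phi x) <= eta) ->
    normc (f phi) <= C * eta.
Proof.
have [_ /(_ _ (@lizorkin2_0 R) 1 ltr01)[N [del [del0 H]]]] := fL.
exists N, (2 / del); split; first by rewrite divr_gt0.
move=> phi eta phiL eta0 phi_le.
pose c : R := del / (2 * eta).
have c0 : 0 < c by rewrite divr_gt0// mulr_gt0.
have phi'L := lizorkin2_lincomb c%:C%C phiL (@lizorkin2_0 R).
have := H _ phi'L.
rewrite (lizorkin_dual_lincomb _ phiL (@lizorkin2_0 R)) lizorkin_dual0 subr0 addr0.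
rewrite normc_prod normc_real gtr0_norm// => Hc.
have -> : 2 / del * eta = 1 / c.
  by rewrite /c; field; rewrite !gt_eqF.
rewrite ler_pdivlMr// mulrC; apply/ltW/Hc => k m1 m2 kN m1N m2N.
apply: (@le_lt_trans _ _ (del / 2)%:E); last by rewrite lte_fin; lra.
rewrite (_ : (fun x => _) = fun x => c%:C%C * phi x + (fun=> 0) x); last first.
  by apply/funext => x; rewrite subr0.
apply/seminorm2_le => x.
have [phiS _] := phiL; have [S0 _] := @lizorkin2_0 R.
rewrite (derivsC_lincomb _ phiS S0 (@word_nseq _ _ _)) derivsC_zero addr0.
rewrite normc_prod normc_real gtr0_norm// mulrCA.
rewrite (_ : del / 2 = c * eta); last by rewrite /c; field; rewrite gt_eqF.
by rewrite ler_pM2l// phi_le.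
Qed.

(** The three claims go through one induction: [f] is linear only on the Lizorkin space, so each
    step needs membership of the preceding sum. *)
Lemma lizorkin_dual_sum n (c : nat -> R[i]) (g : nat -> P2 -> R[i]) :
  (forall j, lizorkin2 (g j)) ->
  [/\ lizorkin2 (fun x => \sum_(j < n) c j * g j x),
     f (fun x => \sum_(j < n) c j * g j x) = \sum_(j < n) c j * f (g j) &
     forall us, word us -> derivsC us (fun x => \sum_(j < n) c j * g j x) =
       fun x => \sum_(j < n) c j * derivsC us (g j) x].
Proof.
move=> gL; elim: n => [|n [IHL IHf IHd]].
  have -> : (fun x : P2 => \sum_(j < 0) c j * g j x) = fun=> 0.
    by apply/funext => x; rewrite big_ord0.
  split; [exact: lizorkin2_0|by rewrite big_ord0 lizorkin_dual0|].
  by move=> us _; rewrite derivsC_zero; apply/funext => x; rewrite big_ord0.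
have -> : (fun x => \sum_(j < n.+1) c j * g j x) =
    (fun x => c n * g n x + \sum_(j < n) c j * g j x).
  by apply/funext => x; rewrite big_ord_recr addrC.
split; first exact: lizorkin2_lincomb.
  by rewrite lizorkin_dual_lincomb// IHf big_ord_recr addrC.
have [gS _] := gL n; have [sS _] := IHL.
move=> us wus; rewrite derivsC_lincomb// IHd//.
by apply/funext => x; rewrite big_ord_recr addrC.
Qed.

End Functional.

(** * The iterated synthesis integral as a joint integral *)

Section SynthesisFubini.
Context {R : realType}.
Local Notation P4 := (R * R * R * R)%type.
Local Notation P2 := (R * R)%type.
Local Notation M1 := (measurableTypeR R).
Local Notation M2 := (measurableTypeR R * measurableTypeR R)%type.
Local Notation M3 := (measurableTypeR R * measurableTypeR R * measurableTypeR R)%type.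
Local Notation M4 := (measurableTypeR R * measurableTypeR R *
    measurableTypeR R * measurableTypeR R)%type.
Local Notation leb := (@lebesgue_measure R).
Let sleb2 : {sigma_finite_measure set M2 -> \bar R} := product_sigma_finite leb leb.
Let sleb3 : {sigma_finite_measure set M3 -> \bar R} := product_sigma_finite sleb2 leb.

(** Fubini in [a] and then in [s]. The second use takes place for each fixed [a], so slices must be
    integrable for every [a] and not just almost every one; the pointwise bound by [space_weight]
    provides this. *)
Lemma synthesis_conjE (psi : P2 -> R[i]) (Phi : P4 -> R[i]) K :
  schwartz2 psi -> schwartzS Phi -> shear_kernel psi K ->
  (forall p x, shearS p -> conj_shearlet psi p x = K p x) ->
  synthesis_conj psi Phi = synthesis Phi K.
Proof.
move=> psiS PhiS sK EK; apply/funext => x.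
pose H (p : M4) := density Phi p * K p x.
have iH : Cintegrable (sleb3 \x leb)%E setT H := density_kernel_integrable psiS PhiS sK x.
have mH : cmeasurable H := density_kernel_cmeasurable psiS PhiS sK x.
have [C C0 HC] := density_kernel_bound psiS PhiS sK 0.
have g0 (t : R) : 0 <= (1 + t ^+ 2)^-1 by rewrite invr_ge0 addr_ge0 ?sqr_ge0.
have i2 := integrable_prod (m1 := leb) (m2 := leb) g0 g0
  (@integrable_oneDsqrV R) (@integrable_oneDsqrV R).
have h2 (z : M2) : 0 <= (1 + z.1 ^+ 2)^-1 * (1 + z.2 ^+ 2)^-1 by rewrite mulr_ge0.
have i3 := integrable_prod (m1 := sleb2) (m2 := leb) h2 g0 i2 (@integrable_oneDsqrV R).
have iHa (a : M1) : Cintegrable (sleb2 \x leb)%E setT (fun q : M3 => H (q, a)).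
  apply: (@cintegrable_le _ M3 R _ _ (fun q : M3 => C * (1 + a ^+ 2)^-1 *
      ((1 + q.1.1 ^+ 2)^-1 * (1 + q.1.2 ^+ 2)^-1 * (1 + q.2 ^+ 2)^-1))).
  - have [r i] := mH; have mp : measurable_fun setT (fun q : M3 => (q, a) : M4).
      exact: measurable_pair2.
    by split; [exact: (measurableT_comp r mp)|exact: (measurableT_comp i mp)].
  - rewrite /comp; under eq_fun do rewrite EFinM.
    by apply: integrableZl => //; exact: i3.
  - move=> q; have := HC (q, a) x; rewrite expr0 mul1r => /le_trans; apply.
    by rewrite /space_weight/=; lra.
rewrite /synthesis_conj /synthesis -/H.
transitivity (Cintegral (sleb3 \x leb)%E setT H); last by [].
rewrite (Cfubini2 (m1 := sleb3) (m2 := leb) iH) Cintegral_mkcond.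
congr (Cintegral _ _ _); apply/funext => a.
case: ifPn => [|]; last first.
  rewrite notin_setE/= => /negP; rewrite negbK => /eqP ->.
  rewrite /H /density/= eqxx; under eq_fun do rewrite mul0r.
  by rewrite Cintegral0.
rewrite inE/= => a0.
transitivity (Cintegral (sleb2 \x leb)%E setT (fun q : M3 => H (q, a))); last by [].
rewrite (Cfubini2 (m1 := sleb2) (m2 := leb) (iHa a)).
congr (Cintegral _ _ _); apply/funext => s.
congr (Cintegral _ _ _); apply/funext => b.
by rewrite /H /density/= (negbTE a0) EK// mulrAC.
Qed.

End SynthesisFubini.

Lemma ccont_normcP {R : realType} {V : topologicalType} (f : V -> R[i]) (x : V) :
  (forall e : R, 0 < e -> \forall y \near x, normc (f y - f x) <= e) -> ccont f x.
Proof.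
move=> H; split; apply/cvgrPdist_le => e e0; apply: filterS (H e e0) => y fy.
- rewrite distrC (le_trans _ fy)// (le_trans _ (cRe_le _))//.
  by case: (f y) (f x) => ? ? [].
- rewrite distrC (le_trans _ fy)// (le_trans _ (cIm_le _))//.
  by case: (f y) (f x) => ? ? [].
Qed.

Lemma normc_le_eq0 {R : realType} (z : R[i]) :
  (forall e : R, 0 < e -> normc z <= e) -> z = 0.
Proof.
move=> H; apply: ComplexField.Normc.eq0_normc; apply/eqP.
rewrite eq_le normc_ge0 andbT; apply/ler_addgt0Pr => e e0.
by rewrite add0r H.
Qed.

(** * Exchanging the functional and the integral *)

Section ShearletTransform.
Context {R : realType}.
Local Notation P4 := (R * R * R * R)%type.
Local Notation P2 := (R * R)%type.
Local Notation M4 := (measurableTypeR R * measurableTypeR R *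
    measurableTypeR R * measurableTypeR R)%type.
Local Notation E1 := (Defs.e1 : R * R).
Local Notation E2 := (Defs.e2 : R * R).
Variables (psi : P2 -> R[i]) (f : (P2 -> R[i]) -> R[i]) (Phi : P4 -> R[i]).
Hypotheses (psiL : lizorkin2 psi) (fL : lizorkin_dual f) (PhiS : schwartzS Phi).

Let psiS : schwartz2 psi. Proof. by case: psiL. Qed.

Let mixed (m : nat * nat) : seq P2 := nseq m.2 E2 ++ nseq m.1 E1.

Variables (K : P4 -> P2 -> R[i]) (Kw : nat * nat -> P4 -> P2 -> R[i]).
Hypotheses (sK : shear_kernel psi K)
  (EK : forall p x, shearS p -> conj_shearlet psi p x = K p x)
  (sKw : forall m, shear_kernel psi (Kw m))
  (dsK : forall m, derivsC (mixed m) (synthesis Phi K) = synthesis Phi (Kw m))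
  (dK : forall m p, derivsC (mixed m) (K p) = Kw m p).

Variables (N : nat) (C : R).
Hypotheses (C0 : 0 < C) (fC : forall phi (eta : R), lizorkin2 phi -> 0 < eta ->
    (forall k m1 m2 x, (k <= N)%N -> (m1 <= N)%N -> (m2 <= N)%N ->
      jap2 x ^+ k * normc (derivsC (mixed (m1, m2)) phi x) <= eta) ->
    normc (f phi) <= C * eta).

Let EKf p : shearS p -> conj_shearlet psi p = K p.
Proof. by move=> Sp; apply/funext => x; exact: EK. Qed.

Let KL p : shearS p -> lizorkin2 (K p).
Proof. by move=> Sp; rewrite -EKf//; exact: conj_shearlet_lizorkin2. Qed.

Lemma jap2_pow_le k (x : P2) : (k <= N)%N -> jap2 x ^+ k <= size2 x ^+ N.
Proof.
move=> kN; rewrite (@le_trans _ _ (size2 x ^+ k))//.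
  by rewrite lerXn2r ?nnegrE ?jap2_ge0 ?jap2_le_size2// ltW// size2_gt0.
by rewrite ler_weXn2l// size2_ge1.
Qed.

(** Only finitely many orders occur, so constants and exponents are summed; as [om p >= 1], a larger
    exponent does no harm. [D] is kept positive because [fC] asks for a positive bound. *)
Lemma uniform_decay : exists2 D : R, 0 < D & exists M, forall p m1 m2 x,
  shearS p -> (m1 <= N)%N -> (m2 <= N)%N ->
  size2 x ^+ N * normc (Kw (m1, m2) p x) <= D * om p ^+ M.
Proof.
have /choice[D DP] : forall m, exists t : R * nat, 0 <= t.1 /\ forall p x, shearS p ->
    size2 x ^+ N * normc (Kw m p x) <= t.1 * om p ^+ t.2.
  by move=> m; have [c c0 [n H]] := shear_kernel_decay psiS N (sKw m); exists (c, n).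
pose D1 := \sum_(t : 'I_N.+1 * 'I_N.+1) (D (t.1 : nat, t.2 : nat)).1.
pose M1 := (\sum_(t : 'I_N.+1 * 'I_N.+1) (D (t.1 : nat, t.2 : nat)).2)%N.
have D10 : 0 <= D1 by apply: sumr_ge0 => t _; have [] := DP (t.1 : nat, t.2 : nat).
exists (1 + D1); first by rewrite ltr_pwDl.
exists M1 => p m1 m2 x Sp m1N m2N.
have [_ /(_ p x Sp)/le_trans] := DP (m1, m2); apply.
pose t : 'I_N.+1 * 'I_N.+1 := (Ordinal (m1N : (m1 < N.+1)%N), Ordinal (m2N : (m2 < N.+1)%N)).
apply: ler_pM.
- by have [] := DP (m1, m2).
- by rewrite exprn_ge0// (le_trans _ (om_ge1 Sp)).
- rewrite /D1 (bigD1 t)//= addrCA lerDl addr_ge0// sumr_ge0// => u _.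
  by have [] := DP (u.1 : nat, u.2 : nat).
- by apply: om_le_pow => //; rewrite /M1 (bigD1 t)//= leq_addr.
Qed.

Lemma uniform_equicontinuity p0 (e : R) : shearS p0 -> 0 < e ->
  \forall p \near p0, forall m1 m2 x, (m1 <= N)%N -> (m2 <= N)%N ->
    size2 x ^+ N * normc (Kw (m1, m2) p x - Kw (m1, m2) p0 x) <= e.
Proof.
move=> Sp0 e0.
have H : \forall p \near p0, forall t : 'I_N.+1 * 'I_N.+1, forall x,
    size2 x ^+ N * normc (Kw (t.1 : nat, t.2 : nat) p x -
      Kw (t.1 : nat, t.2 : nat) p0 x) <= e.
  exact: (filter_forall (nbhs_filter p0) (fun t : 'I_N.+1 * 'I_N.+1 =>
    shear_kernel_equicontinuous N psiS (sKw (t.1 : nat, t.2 : nat)) Sp0 e0)).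
apply: filterS H => p H m1 m2 x m1N m2N.
exact: (H (Ordinal (m1N : (m1 < N.+1)%N), Ordinal (m2N : (m2 < N.+1)%N)) x).
Qed.

Let scaled k (u : R) (x : P2) (z : R[i]) : (k <= N)%N -> size2 x ^+ N * normc z <= u ->
  jap2 x ^+ k * normc z <= u.
Proof.
by move=> kN; apply: le_trans; rewrite ler_wpM2r ?normc_ge0// jap2_pow_le.
Qed.

Lemma functional_bound p (u : R) : shearS p -> 0 < u ->
  (forall m1 m2 x, (m1 <= N)%N -> (m2 <= N)%N ->
    size2 x ^+ N * normc (Kw (m1, m2) p x) <= u) ->
  normc (f (K p)) <= C * u.
Proof.
move=> Sp u0 H; apply: fC => // [|k m1 m2 x kN m1N m2N]; first exact: KL.
by rewrite dK; apply: scaled => //; exact: H.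
Qed.

Lemma functional_dist p q (u : R) : shearS p -> shearS q -> 0 < u ->
  (forall m1 m2 x, (m1 <= N)%N -> (m2 <= N)%N ->
    size2 x ^+ N * normc (Kw (m1, m2) p x - Kw (m1, m2) q x) <= u) ->
  normc (f (K p) - f (K q)) <= C * u.
Proof.
move=> Sp Sq u0 H.
have pL := KL Sp; have qL := KL Sq.
have -> : f (K p) - f (K q) = f (fun x => (- 1) * K q x + K p x).
  by rewrite lizorkin_dual_lincomb// mulN1r addrC.
apply: fC => // [|k m1 m2 x kN m1N m2N]; first exact: lizorkin2_lincomb.
rewrite derivsC_lincomb ?dK; [|by case: qL|by case: pL|exact: word_nseq].
by rewrite mulN1r addrC; apply: scaled => //; exact: H.
Qed.

(** Set to 0 at [a = 0], where [f (K p)] is not controlled. *)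
Let lf (p : P4) : R[i] := if p.2 == 0 then 0 else f (K p).

Let lfE p : shearS p -> lf p = f (K p).
Proof. by move=> Sp; rewrite /lf (negbTE (Sp : p.2 != 0)). Qed.

Let lx k m x (p : P4) : R[i] := (jap2 x ^+ k)%:C%C * Kw m p x.

(* The quadrature applies simultaneously to [f] and to the weighted point
   evaluations of derivatives that make up the seminorms controlling [f]. *)
Let L : set (M4 -> R[i]) := [set l | l = lf \/ exists k m1 m2 x,
  [/\ (k <= N)%N, (m1 <= N)%N, (m2 <= N)%N & l = lx k (m1, m2) x]].

Let L_equicontinuous p0 (e : R) : shearS p0 -> 0 < e ->
  \forall p \near p0, shearS p -> forall l, L l -> normc (l p - l p0) <= e.
Proof.
(* The oscillation is at most [C * u] for [lf] and at most [u] for the evaluations; both are below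
   [(1 + C) * u = e]. *)
move=> Sp0 e0; pose u := e / (1 + C).
have C1 : 0 < 1 + C by rewrite addr_gt0.
have u0 : 0 < u by rewrite divr_gt0.
have uE : u * (1 + C) = e by rewrite /u divfK ?gt_eqF.
have Cu : 0 <= C * u by rewrite mulr_ge0// ltW.
apply: filterS (uniform_equicontinuity Sp0 u0) => p H Sp l [->|].
  by rewrite !lfE// (le_trans (functional_dist Sp Sp0 u0 H))//; lra.
move=> [k [m1 [m2 [x [kN m1N m2N ->]]]]].
rewrite /lx -mulrBr normc_prod normc_real ger0_norm ?exprn_ge0 ?jap2_ge0//.
by rewrite (le_trans (scaled kN (H m1 m2 x m1N m2N)))//; lra.
Qed.

Let lf_ccont p : shearS p -> ccont (fun q => density Phi q * lf q) p.
Proof.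
move=> Sp; apply: ccontM; first exact: density_ccont.
apply: ccont_normcP => e e0.
near=> q; have Sq : shearS q by near: q; exact: shearS_nbhs.
have H : shearS q -> forall l, L l -> normc (l q - l p) <= e.
  by near: q; exact: L_equicontinuous.
by apply: H => //; left.
Unshelve. all: by end_near. Qed.

Let L_cmeasurable l : L l -> cmeasurable (fun p : M4 => density Phi p * l p).
Proof.
move=> [->|[k [m1 [m2 [x [_ _ _ ->]]]]]].
  by apply: ccont_cmeasurable4 => [p Sp|p /density_off->];
    [exact: lf_ccont|rewrite mul0r].
rewrite (_ : (fun p => _) = fun p : M4 => (jap2 x ^+ k)%:C%C *
    (density Phi p * Kw (m1, m2) p x)); last first.
  by apply/funext => p; rewrite /lx mulrCA.
by apply: cmeasurableM; [exact: cmeasurable_cst|exact: (density_kernel_cmeasurable psiS PhiS (sKw _) x)].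
Qed.

Lemma functional_of_synthesis :
  Cintegrable leb4 setT (fun p : M4 => density Phi p * lf p) /\
  f (synthesis Phi K) = Cintegral leb4 setT (fun p : M4 => density Phi p * lf p).
Proof.
have [D D0 [M HD]] := uniform_decay.
have [A0 A00 HA0] := density_decay PhiS 0; have [A A0' HA] := density_decay PhiS M.
(* The factor [1 + C] again covers both kinds of members of [L]. In [G] below, [A0] accounts for the
   1 in [1 + B] and [A] for the growth of [B]. *)
pose B (p : M4) : R := if p.2 == 0 then 0 else (1 + C) * (D * om p ^+ M).
pose G (p : M4) : R := (A0 + (1 + C) * (D * A)) * space_weight p.
have C1 : 0 < 1 + C by rewrite addr_gt0.
have iG : leb4.-integrable setT (EFin \o G).
  rewrite /comp; under eq_fun do rewrite EFinM.
  by apply: integrableZl => //; exact: integrable_space_weight.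
have DM p : shearS p -> 0 < D * om p ^+ M.
  by move=> Sp; rewrite mulr_gt0// exprn_gt0// (lt_le_trans _ (om_ge1 Sp)).
have B0 p : 0 <= B p.
  rewrite /B; case: ifPn => // Sp; rewrite mulr_ge0 ?(ltW C1)// ltW//; exact: DM.
have wG p : normc (density Phi p) * (1 + B p) <= G p.
  have := HA0 p; have := HA p; rewrite expr0 mulr1 /B /G => H H0.
  have W0 := space_weight_ge0 p.
  case: ifPn => [_|_].
    rewrite addr0 mulr1 (le_trans H0)// ler_wpM2r// lerDl.
    by rewrite mulr_ge0 ?(ltW C1)// mulr_ge0// ltW.
  have CD0 : 0 <= (1 + C) * D by rewrite mulr_ge0 ?(ltW C1)// ltW.
  have H1 := ler_wpM2l CD0 H.
  rewrite [leLHS](_ : _ = normc (density Phi p) +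
    (1 + C) * D * (normc (density Phi p) * om p ^+ M)); last by ring.
  rewrite [leRHS](_ : _ = A0 * space_weight p +
    (1 + C) * D * (A * space_weight p)); last by ring.
  exact: lerD.
have LB l p : L l -> shearS p -> normc (l p) <= B p.
  move=> Ll Sp; have DMp := DM p Sp.
  rewrite /B (negbTE (Sp : p.2 != 0)).
  have CD : 0 <= C * (D * om p ^+ M) by rewrite mulr_ge0// ltW.
  case: Ll => [->|[k [m1 [m2 [x [kN m1N m2N ->]]]]]].
    rewrite lfE//; have := functional_bound Sp DMp (fun m1 m2 x => HD p m1 m2 x Sp).
    by move=> /le_trans; apply; lra.
  rewrite /lx normc_prod normc_real ger0_norm ?exprn_ge0 ?jap2_ge0//.
  by rewrite (le_trans (scaled kN (HD p m1 m2 x Sp m1N m2N)))//; lra.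
have Llf : L lf by left.
split.
  apply: (cintegrable_le (L_cmeasurable Llf) iG) => p.
  have [Sp|nSp] := pselect (shearS p); last first.
    by rewrite density_off// mul0r normc_zero (le_trans _ (wG p))// mulr_ge0 ?normc_ge0 ?addr_ge0.
  rewrite normc_prod (le_trans _ (wG p))// ler_wpM2l ?normc_ge0//.
  by rewrite (le_trans (LB _ _ Llf Sp))// lerDr.
apply/eqP; rewrite -subr_eq0; apply/eqP/normc_le_eq0 => e e0.
(* [C * eta] will be spent between [f] of the synthesis integral and the finite sum, and [eta]
   between that sum and the scalar integral. *)
pose eta := e / (1 + C).
have eta0 : 0 < eta by rewrite divr_gt0.
have S0 : (shearS : set M4) !=set0 by exists (0, 0, 0, 1); rewrite /shearS/= oner_eq0.
have [n [c [q [Sq Hq]]]] := equicontinuous_quadrature (@net4 R) measurable_shearS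
  (cmeasurable_density PhiS) L_cmeasurable (@density_off _ Phi) B0 iG wG LB
  L_equicontinuous eta0 S0.
have [sL sf sd] := lizorkin_dual_sum fL n c (g := fun j => K (q j)) (fun j => KL (Sq j)).
have TL : lizorkin2 (synthesis Phi K).
  apply/lizorkin2P; split; first exact: (synthesis_schwartz2 psiS PhiS sK).
  apply: (synthesis_moment_free psiS PhiS sK) => p Sp.
  by have /lizorkin2P[] := KL Sp.
(* The quadrature error for the evaluation [lx k (m1, m2) x] is exactly a weighted derivative at [x]
   of the synthesis integral minus the finite sum. These errors bound all seminorms that control
   [f]. *)
have near1 : normc (f (synthesis Phi K) - \sum_(j < n) c j * f (K (q j))) <= C * eta.
  have -> : f (synthesis Phi K) - \sum_(j < n) c j * f (K (q j)) =
      f (fun x => (- 1) * (\sum_(j < n) c j * K (q j) x) + synthesis Phi K x).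
    by rewrite lizorkin_dual_lincomb// sf mulN1r addrC.
  apply: fC => // [|k m1 m2 x kN m1N m2N]; first exact: lizorkin2_lincomb.
  have [sS _] := sL; have [TS _] := TL.
  rewrite derivsC_lincomb//; last exact: word_nseq.
  rewrite dsK sd; last exact: word_nseq.
  have -> : (- 1) * (\sum_(j < n) c j * derivsC (mixed (m1, m2)) (K (q j)) x) +
      synthesis Phi (Kw (m1, m2)) x =
      synthesis Phi (Kw (m1, m2)) x - \sum_(j < n) c j * Kw (m1, m2) (q j) x.
    by rewrite mulN1r addrC; congr (_ - _); apply: eq_bigr => j _; rewrite dK.
  have Llx : L (lx k (m1, m2) x) by right; exists k, m1, m2, x.
  have := Hq _ Llx.
  rewrite (_ : (fun p => _) = fun p : M4 => (jap2 x ^+ k)%:C%C *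
      (density Phi p * Kw (m1, m2) p x)); last first.
    by apply/funext => p; rewrite /lx mulrCA.
  rewrite CintegralZ; last exact: (density_kernel_integrable psiS PhiS (sKw _) x).
  rewrite (_ : \sum_(j < n) _ = (jap2 x ^+ k)%:C%C * \sum_(j < n) c j * Kw (m1, m2) (q j) x).
    by rewrite -mulrBr normc_prod normc_real ger0_norm ?exprn_ge0 ?jap2_ge0.
  by rewrite mulr_sumr; apply: eq_bigr => j _; rewrite /lx mulrCA.
have near2 := Hq _ Llf.
have sE : \sum_(j < n) c j * lf (q j) = \sum_(j < n) c j * f (K (q j)).
  by apply: eq_bigr => j _; rewrite lfE.
rewrite sE normc_distC in near2.
have -> : e = C * eta + eta by rewrite /eta; field; rewrite gt_eqF.
apply: le_trans (lerD near1 near2); apply: le_trans (normc_triangle _ _).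
by rewrite addrA subrK.
Qed.

End ShearletTransform.

Lemma shearlet_transform_given_by (R : realType) (psi : R * R -> R[i])
    (f : (R * R -> R[i]) -> R[i]) : lizorkin2 psi -> lizorkin_dual f ->
  given_by (shearlet_transform psi f) (fun p => f (conj_shearlet psi p)).
Proof.
move=> psiL fL Phi PhiS G; have [psiS _] := psiL.
have [K sK EK] := shear_kernel_conj_shearlet psi.
have [N [C [C0 fC]]] := lizorkin_dual_bounded fL.
have /choice[Kw KwP] : forall m : nat * nat, exists K', shear_kernel psi K' /\
    (derivsC (nseq m.2 Defs.e2 ++ nseq m.1 Defs.e1) (synthesis Phi K) = synthesis Phi K' /\
     forall p, derivsC (nseq m.2 Defs.e2 ++ nseq m.1 Defs.e1) (K p) = K' p).
  move=> m; have [K' sK' [H1 H2]] :=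
    synthesis_derivsC psiS PhiS sK (@word_nseq R m.1 m.2).
  by exists K'.
have [iF fE] := functional_of_synthesis psiL fL PhiS sK EK
  (fun m => proj1 (KwP m)) (fun m => proj1 (proj2 (KwP m)))
  (fun m => proj2 (proj2 (KwP m))) C0 fC.
have GE : (fun p => if p \in shearS then G p else 0) =
    (fun p => density Phi p * (if p.2 == 0 then 0 else f (K p))).
  apply/funext => p; rewrite /density; case: ifPn => [|].
    rewrite inE => Sp; rewrite (negbTE (Sp : p.2 != 0)) /G.
    rewrite (_ : conj_shearlet psi p = K p); last by apply/funext => x; exact: EK.
    by rewrite -mulrA mulrC.
  by rewrite notin_setE /shearS/= => /negP; rewrite negbK => ->; rewrite mul0r.
split.
  by apply: (Cintegrable_mkcond (@measurable_shearS R)); rewrite GE.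
rewrite Cintegral_mkcond GE -fE /shearlet_transform.
by rewrite (synthesis_conjE psiS PhiS sK EK).
Qed.

(** [psi0] is the representative in the Lizorkin space of the class of [psi] in [L^2]; evaluation at
    points and pairing with [f] refer to it. *)
Theorem theorem10 (R : realType)
    (psi hpsi : R * R -> R[i]) (psi1 hpsi1 psi2 phi2 chi1 : R -> R[i])
    (psi0 : R * R -> R[i]) (f : (R * R -> R[i]) -> R[i]) :
  admissible psi ->
  L2_fourier leb2 fourier2 psi hpsi ->
  L2_fourier leb1 fourier1 psi1 hpsi1 ->
  L2_fourier leb1 fourier1 psi2 phi2 ->
  {ae leb2, forall xi : R * R, xi.1 != 0 ->
     hpsi xi = hpsi1 xi.1 * phi2 (xi.2 / xi.1)} ->
  lizorkin1 chi1 ->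
  {ae leb1, forall tau : R, fourier1 chi1 tau = `|tau|%:C%C * hpsi1 tau} ->
  schwartz1 phi2 ->
  lizorkin2 psi0 ->
  {ae leb2, forall x : R * R, psi x = psi0 x} ->
  lizorkin_dual f ->
  given_by (shearlet_transform psi0 f) (fun p => f (conj_shearlet psi0 p)).
Proof.
by move=> _ _ _ _ _ _ _ _ psi0L _ fL; exact: shearlet_transform_given_by.
Qed.
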